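(* Let $K\in\mathbb{N}$, $\alpha>0$, $c_5>0$, $\hat\eta=\frac{c_5}{\sqrt{K}}$, and let $\{\bm{w}^k\}$ be generated by $$\bm{w}^{k+1}=\bm{w}^k-\frac{\hat{\eta}\psi_k}{M}\sum_{i=1}^M\widehat{\nabla} F(\bm{w}^k+\hat{\bm{u}}^k,\bm{\xi}^{k,i},\bm{b}^{k,i})+\hat{\bm{e}}^k ,$$ in the setting described in the context (with $\alpha_k=\alpha$ and $\hat\eta_k=\hat\eta$ for all $k$), run for $\hat k$ iterations, where $\hat{k}$ is uniformly sampled from $\{0,1,\dots,K-1\}$ (independently of the algorithm), and put $\hat{\bm{w}}:=\bm{w}^{\hat{k}+1}$. Assume that there are constants $c_1,c_2,c_3,c_4>0$ and $0<\underline{\Psi}^U\le\overline{\Psi}^U<\infty$ such that for all $k\in\mathbb{N}$: (A) almost surely, $\langle \mathbb{E}[\widehat{\nabla} F(\bm{w}^k+\hat{\bm{u}}^k,\bm{\xi},\bm{b}^k)\mid\mathcal{F}_{k-1}],\nabla f_{\alpha}(\bm{w}^k)\rangle\geq c_1 \|\nabla f_{\alpha}(\bm{w}^k)\|^2_2$ and $\mathbb{E}[\|\widehat{\nabla} F(\bm{w}^k+\hat{\bm{u}}^k,\bm{\xi},\bm{b}^k)\|^2_2\mid\mathcal{F}_{k-1}]\leq c_2Q$; (B) there are $\mathcal{F}_{k-1}$-measurable random variables $0\le\Psi^L_k\le\Psi^U_k<\infty$ with $\mathbb{P}(\Psi^L_k\leq\psi_k\leq\Psi^U_k\mid\mathcal{F}_{k-1})=1$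 almost surely and $\mathbb{P}(\underline{\Psi}^U\leq\Psi^U_k\leq\overline{\Psi}^U)=1$; (C) almost surely, $\mathbb{E}[\hat{\bm{e}}^k\mid\mathcal{F}_{k-1},\mathcal{G}_k]=\bm{0}$ and $\mathbb{E}[\|\hat{\bm{e}}^k\|^2_2\mid\mathcal{F}_{k-1}]\leq c_3\hat{\eta}^2$; (D) $\Delta_k:=\Psi^U_k-\Psi^L_k\le c_4\frac{\hat\eta}{\alpha}$ almost surely. Assume also that $K\geq\left(\frac{c_4c_5}{\alpha c_1\underline{\Psi}^U}\right)^2$. Then $$\mathbb{E}[\operatorname{dist}(\bm{0},\partial^{\infty}_{\alpha}f(\hat{\bm{w}}))^2]\leq \frac{\kappa_1f_{\alpha}(\bm{w}^1)}{\sqrt{K}}+\frac{\kappa_2Q}{\alpha \sqrt{K}}+\frac{\kappa_3\sqrt{d}L_0}{\alpha\sqrt{K}}\left((\overline{\Psi}^U)^2c_2Q+c_3\right),$$ where $\kappa_1:=\frac{2}{c_1c_5\underline{\Psi}^U}$, $\kappa_2:=\frac{c_2c_4c_5}{c_1\underline{\Psi}^U}$, and $\kappa_3:=\frac{c_5}{c_1\underline{\Psi}^U}$. Consequently, $\mathbb{E}[\operatorname{dist}(\bm{0},\partial^{\infty}_{\alpha}f(\hat{\bm{w}}))]\leq \nu$ for $\nu>0$ can be guaranteed with a choice of $K=O(\alpha^{-2}\nu^{-4})$ (as $\alpha,\nu\to0$, all the other constants $c_1,\dots,c_5,\underline{\Psi}^U,\overline{\Psi}^U,d,L_0,Q$ and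 $\bm{w}^1$, $f$ being fixed).
   Context: Loss function. $d,n,s\in\mathbb{N}$; $\bm{\xi}$ is an $\mathbb{R}^n$-valued random vector on a probability space $(\Omega,\mathcal{F},P)$. $F:\mathbb{R}^d\times\mathbb{R}^n\to\mathbb{R}$ is such that $F(\cdot,\bm{\xi})$ is continuous for each $\bm{\xi}\in\mathbb{R}^n$ and $F(\bm{w},\cdot)$ is Borel measurable for each $\bm{w}\in\mathbb{R}^d$. There is a measurable $L_0:\mathbb{R}^n\to\mathbb{R}$ such that for almost all $\bm{\xi}$, $|F(\bm{w},\bm{\xi})-F(\bm{w}',\bm{\xi})|\le L_0(\bm{\xi})\|\bm{w}-\bm{w}'\|_2$ for all $\bm{w},\bm{w}'\in\mathbb{R}^d$, and $Q:=\mathbb{E}[L_0(\bm{\xi})^2]<\infty$. The loss is $f:=\mathbb{E}[F(\cdot,\bm{\xi})]:\mathbb{R}^d\to\mathbb{R}_{\ge 0}$ (assumed real-valued and non-negative); it is Lipschitz continuous with constant $L_0:=\mathbb{E}[L_0(\bm{\xi})]$. Smoothing. For $\alpha>0$, $B^\infty_\alpha(\bm{w}):=\{\bm{x}\in\mathbb{R}^d:\|\bm{x}-\bm{w}\|_\infty\le\alpha\}$, $B^\infty_\alpha:=B^\infty_\alpha(\bm{0})$, $U(B^\infty_\alpha)$ is the uniform distribution on it, and $f_\alpha(\bm{w}):=\mathbb{E}[f(\bm{w}+\bm{u})]$ with $\bm{u}\sim U(B^\infty_\alpha)$. It is known that $f_\alpha$ is differentiable and $\nabla f_\alpha$ is $\alpha^{-1}\sqrt{d}L_0$-Lipschitz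 continuous. Subdifferentials. For locally Lipschitz $h:\mathbb{R}^d\to\mathbb{R}$, the Clarke subdifferential is $\partial h(\bm{w})=\operatorname{co}\{\bm{v}:\exists\,\bm{w}^k\to\bm{w},\ h \text{ differentiable at each } \bm{w}^k,\ \nabla h(\bm{w}^k)\to\bm{v}\}$ ($\operatorname{co}$ = convex hull), and the $L_\infty$-norm Clarke $\alpha$-subdifferential is $\partial^\infty_\alpha h(\bm{w}):=\operatorname{co}\bigcup_{\bm{x}\in B^\infty_\alpha(\bm{w})}\partial h(\bm{x})$. $\operatorname{dist}$ is Euclidean distance to a set. Algorithm. $M\in\mathbb{N}$ is the mini-batch size and $\bm{w}^1\in\mathbb{R}^d$ is a given initial point. $\widehat{\nabla} F:\mathbb{R}^d\times\mathbb{R}^n\times\mathbb{R}^s\to\mathbb{R}^d$ is a Borel measurable function (an approximate stochastic gradient). At iteration $k$: $\hat{\bm{u}}^k\in\mathbb{R}^d$ is a sample from a deterministic (pre-specified) probability distribution $\widehat{P}^k$; $\bm{\xi}^{k,1},\dots,\bm{\xi}^{k,M}$ are samples of $\bm{\xi}$; $\bm{b}^{k,1},\dots,\bm{b}^{k,M}$ are samples of a discrete random vector $\bm{b}^k\in\mathbb{R}^s$, each of whose components is uniformly distributed on a finite set; the sampling of $\hat{\bm{u}}^k,\{\bm{\xi}^{k,i}\},\{\bm{b}^{k,i}\}$ is done independently (of each other and of the past). $\psi_k\ge0$ is a random variable, and $\hat{\bm{e}}^k\in\mathbb{R}^d$ is a random vector. $\mathcal{F}_k:=\sigma(\hat{\bm{u}}^j,\{\bm{\xi}^{j,i}\},\{\bm{b}^{j,i}\},\psi_j,\hat{\bm{e}}^j: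 j\in\{1,\dots,k\})$ (with $\mathcal{F}_0$ trivial) and $\mathcal{G}_k:=\sigma(\hat{\bm{u}}^k,\{\bm{\xi}^{k,i}\},\{\bm{b}^{k,i}\},\psi_k)$. In (A), $\hat{\bm{u}}^k\sim\widehat P^k$, $\bm{b}^k$ and $\bm{\xi}$ denote generic such samples, independent of each other and of $\mathcal{F}_{k-1}$. *)

(* Defs.v *)
From HB Require Import structures.
From mathcomp Require Import all_boot all_order all_algebra.
From mathcomp Require Import all_classical all_reals all_analysis.
From mathcomp Require Import measurable_realfun.

Set Implicit Arguments.
Unset Strict Implicit.
Unset Printing Implicit Defensive.
Import Order.TTheory GRing.Theory Num.Theory.
Import numFieldNormedType.Exports.

Local Open Scope classical_set_scope.
Local Open Scope ring_scope.

(* Matrices, in particular 'rV[R]_n, carry the Borel sigma-algebra. *)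
Section Borel.
Context (R : realType) (m n : nat).
Let opens := @open 'M[R]_(m, n).
Let borel0 : <<s opens >> set0. Proof. exact: sigma_algebra0. Qed.
Let borelC A : <<s opens >> A -> <<s opens >> (~` A).
Proof. exact: sigma_algebraC. Qed.
Let borelU (A : (set 'M[R]_(m, n))^nat) :
  (forall i, <<s opens >> (A i)) -> <<s opens >> (\bigcup_i A i).
Proof. exact: sigma_algebra_bigcup. Qed.
HB.instance Definition _ := @isMeasurable.Build (sigma_display opens)
  'M[R]_(m, n) <<s opens >> borel0 borelC borelU.
End Borel.

Lemma measurable_rVP (R : realType) (d : nat) (dT : measure_display)
    (T : measurableType dT) (g : T -> 'rV[R]_d) :
  (forall j, measurable_fun setT (fun x => g x 0 j)) -> measurable_fun setT g.
Proof.
move=> mg; apply: (measurability (@open 'rV[R]_d)) => // _ [U oU <-].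
rewrite setTI.
pose B (p : 'rV[rat]_d * rat) : set 'rV[R]_d :=
  ball (map_mx ratr p.1 : 'rV[R]_d) (ratr p.2).
have -> : g @^-1` U =
    \bigcup_p (if pselect (B p `<=` U) then g @^-1` B p else set0).
  apply/seteqP; split=> [x /= Ux|x [p _]]; last first.
    by case: pselect => //= BU /BU.
  move: oU; rewrite openE => /(_ _ Ux)/nbhs_ballP[e /= e0 xeU].
  have e20 : 0 < e / 2 by rewrite divr_gt0.
  have [r] := rat_in_itvoo e20; rewrite in_itv/= => /andP[r0 re].
  have qP j : {q : rat | `|g x 0 j - ratr q| < ratr r}.
    apply/cid; have : g x 0 j - ratr r < g x 0 j + ratr r.
      by rewrite ltrD2l gtrN.
    move=> /rat_in_itvoo[q]; rewrite in_itv/= => /andP[q1 q2].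
    by exists q; rewrite distrC ltr_distl q1 q2.
  pose q : 'rV[rat]_d := \row_j sval (qP j).
  have Bx : B (q, r) (g x).
    split=> //= i j; rewrite ord1 /ball/= !mxE distrC.
    by case: (qP j).
  exists (q, r) => //; case: pselect => //= nBU; case: nBU => y By.
  apply: xeU; rewrite (splitr e).
  apply: (@ball_triangle _ _ (map_mx ratr q : 'rV[R]_d)).
    apply: (le_ball (ltW re)); exact: ball_sym.
  exact: (le_ball (ltW re)).
apply: countable_bigcupT_measurable => [|p]; first exact: countableP.
case: pselect => BU; last exact: measurable0.
have -> : g @^-1` B p =
    (if 0 < (ratr p.2 : R) then setT else set0) `&`
    \big[setI/setT]_(j < d) ((fun x => g x 0 j) @^-1`
       ball (ratr (p.1 0 j) : R) (ratr p.2)).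
  apply/seteqP; split=> x /=.
    move=> [p0 xp]; rewrite p0; split=> //.
    by elim/big_ind: _ => // j _; have := xp 0 j; rewrite mxE.
  case: ifPn => [p0|_] [//= _ xp]; split=> // i j; rewrite ord1 mxE.
  by move: xp; rewrite (bigD1 j)//= => -[].
apply: measurableI; first by case: ifPn.
apply: bigsetI_measurable => j _; rewrite -[X in measurable X]setTI.
by apply: mg => //; exact: measurable_ball.
Qed.

Lemma measurable_rV_coord (R : realType) (d : nat) (j : 'I_d) :
  measurable_fun setT (fun v : 'rV[R]_d => v 0 j).
Proof.
apply: (measurability _ (RGenOpens.measurableE R)) => _ [_ [a [b ->] <-]].
rewrite setTI; apply: sub_sigma_algebra.
apply: open_comp; last exact: interval_open.
by move=> v _; exact: coord_continuous.
Qed.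

Section UniformCube.
Context (R : realType).

Definition cons_rV d (p : measurableTypeR R * 'rV[R]_d) : 'rV[R]_d.+1 :=
  row_mx (p.1%:M : 'rV[R]_1) p.2.

Lemma cons_rV0 d p : @cons_rV d p 0 ord0 = p.1.
Proof.
rewrite /cons_rV (_ : ord0 = lshift d (ord0 : 'I_1)); last exact: val_inj.
by rewrite (@row_mxEl _ 1 1 d) mxE mulr1n.
Qed.

Lemma cons_rVS d p (i : 'I_d) : cons_rV p 0 (lift ord0 i) = p.2 0 i.
Proof.
rewrite /cons_rV (_ : lift ord0 i = rshift 1 i); last exact: val_inj.
by rewrite (@row_mxEr _ 1 1 d).
Qed.

Lemma measurable_cons_rV d : measurable_fun setT (@cons_rV d).
Proof.
apply: measurable_rVP => j; case: (unliftP ord0 j) => [i|] ->.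
  under eq_fun do rewrite cons_rVS.
  apply: (@measurableT_comp _ _ _ _ _ _ (fun v : 'rV[R]_d => v 0 i) _ snd).
    exact: measurable_rV_coord.
  exact: measurable_snd.
by under eq_fun do rewrite cons_rV0; exact: measurable_fst.
Qed.

HB.instance Definition _ d :=
  isMeasurableFun.Build _ _ _ _ (@cons_rV d) (@measurable_cons_rV d).

Lemma opp_lt_pos (a : R) : 0 < a -> - a < a.
Proof. by move=> a0; rewrite (lt_trans _ a0)// oppr_lt0. Qed.

(* Uniform distribution on the cube [-a, a]^d, as the product of d uniform
   distributions on [-a, a]; see uniform_cube_box. *)
Fixpoint uniform_cube (a : R) (a0 : 0 < a) (d : nat) : probability 'rV[R]_d R :=
  if d is d'.+1 then
    distribution (uniform_prob (opp_lt_pos a0) \x uniform_cube a0 d')%E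
      (@cons_rV d')
  else \d_(0 : 'rV[R]_0).

Lemma uniform_cube_box (a : R) (a0 : 0 < a) (d : nat)
    (A : 'I_d -> set (measurableTypeR R)) : (forall i, measurable (A i)) ->
  uniform_cube a0 d [set v | forall i, A i (v 0 i)] =
  (\prod_(i < d) uniform_prob (opp_lt_pos a0) (A i))%E.
Proof.
elim: d A => [|d IH] A mA.
  by rewrite big_ord0/= diracE mem_set// => -[].
rewrite big_ord_recl/= -IH// /distribution/= /pushforward/=.
rewrite -product_measure1E//; last first.
  rewrite [X in measurable X](_ : _ = \big[setI/setT]_(i < d)
      ((fun v : 'rV[R]_d => v 0 i) @^-1` A (lift ord0 i))).
    apply: bigsetI_measurable => i _; rewrite -[X in measurable X]setTI.
    by apply: measurable_rV_coord => //; exact: mA.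
  apply/seteqP; split=> v /=.
    by move=> Av; elim/big_ind: _ => // i _; exact: Av.
  by move=> + i; rewrite (bigD1 i)//= => -[].
congr (_ _); apply/seteqP; split=> -[x v] /=.
  move=> Axv; split=> [|i]; first by have := Axv ord0; rewrite cons_rV0.
  by have := Axv (lift ord0 i); rewrite cons_rVS.
move=> [Ax Av] j; case: (unliftP ord0 j) => [i|] ->.
  by rewrite cons_rVS; exact: Av.
by rewrite cons_rV0.
Qed.
End UniformCube.

Section Euclidean.
Context (R : realType) (d : nat).
Implicit Types (u v w x : 'rV[R]_d) (A : set 'rV[R]_d) (h : 'rV[R]_d -> R).

Definition dotv u v : R := \sum_j u 0 j * v 0 j.

(* The library norm `|v| on 'rV[R]_d is the sup norm, not this one. *)
Definition l2norm v : R := Num.sqrt (\sum_j v 0 j ^+ 2).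

(* Equal to +oo when A is empty. *)
Definition dist v A : \bar R := ereal_inf [set (l2norm (v - x))%:E | x in A].

Definition grad h w : 'rV[R]_d := \row_j 'D_(delta_mx 0 j) h w.

Definition conv_hull A : set 'rV[R]_d := smallest (@convex_set R 'rV[R]_d) A.

Definition clarke h w : set 'rV[R]_d :=
  conv_hull [set v | exists x : nat -> 'rV[R]_d,
    [/\ x k @[k --> \oo] --> w,
        forall k, differentiable h (x k) &
        grad h (x k) @[k --> \oo] --> v]].

(* {x | `|x - w| <= alpha} is a cube, as `|.| is the sup norm. *)
Definition clarke_cube (alpha : R) h w : set 'rV[R]_d :=
  conv_hull (\bigcup_(x in [set x | `|x - w| <= alpha]) clarke h x).

Definition smoothing (alpha : R) (alpha0 : 0 < alpha) h w : R :=
  fine 'E_(uniform_cube alpha0 d)[fun u => h (w + u)].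

End Euclidean.

Section Probability.
Context (dT : measure_display) (T : measurableType dT) (R : realType).
Variable P : probability T R.

Definition sigma_rv (d' : measure_display) (T' : measurableType d')
    (X : T -> T') : set_system T :=
  preimage_set_system setT X measurable.

Definition mutually_independent (Gs : seq (set_system T)) : Prop :=
  forall (I : {set 'I_(size Gs)}) (A : 'I_(size Gs) -> set T),
    (forall i, i \in I -> nth set0 Gs i (A i)) ->
    P (\bigcap_(i in [set` I]) A i) = (\prod_(i in I) P (A i))%E.

(* Y is a version of E[X | G]; this includes that X is integrable. *)
Definition is_cond_exp (G : set_system T) (X Y : T -> R) : Prop :=
  [/\ P.-integrable setT (EFin \o X),
      P.-integrable setT (EFin \o Y),
      sigma_rv Y `<=` G &
      forall A, G A ->
        (\int[P]_(o in A) (Y o)%:E = \int[P]_(o in A) (X o)%:E)%E].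

Definition is_cond_exp_rV (n : nat) (G : set_system T) (X Y : T -> 'rV[R]_n) :
    Prop :=
  forall j, is_cond_exp G (fun o => X o 0 j) (fun o => Y o 0 j).

Definition is_cond_prob (G : set_system T) (A : set T) (Y : T -> R) : Prop :=
  is_cond_exp G \1_A Y.

End Probability.

Definition same_law (d' : measure_display) (T' : measurableType d')
    (R : realType) (mu nu : set T' -> \bar R) : Prop :=
  forall B, measurable B -> mu B = nu B.

(* Iteration indices start at 1; entries with index 0 are never used.
   xis k i and bs k i are the i-th mini-batch samples at step k; bvec k and
   xigen k are the generic samples of b^k and xi entering the conditional
   expectations at step k. *)
Record sgd_run (R : realType) (d : nat) := SgdRun {
  dim_xi : nat;
  dim_b : nat;
  batch : nat;
  disp : measure_display;
  Omega : measurableType disp;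
  prob : probability Omega R;
  xi : {RV prob >-> 'rV[R]_dim_xi};
  lossF : 'rV[R]_d -> 'rV[R]_dim_xi -> R;
  lipF : 'rV[R]_dim_xi -> R;
  gradF : 'rV[R]_d * 'rV[R]_dim_xi * 'rV[R]_dim_b -> 'rV[R]_d;
  Phat : nat -> probability 'rV[R]_d R;
  uhat : nat -> {RV prob >-> 'rV[R]_d};
  xis : forall k : nat, 'I_batch -> {RV prob >-> 'rV[R]_dim_xi};
  bvec : nat -> {RV prob >-> 'rV[R]_dim_b};
  bs : forall k : nat, 'I_batch -> {RV prob >-> 'rV[R]_dim_b};
  xigen : nat -> {RV prob >-> 'rV[R]_dim_xi};
  psi : nat -> {RV prob >-> R};
  ehat : nat -> {RV prob >-> 'rV[R]_d};
  PsiL : nat -> Omega -> R;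
  PsiU : nat -> Omega -> R;
  iterate : nat -> Omega -> 'rV[R]_d;
  khat : {RV prob >-> nat}
}.

Arguments dim_xi {R d} s.
Arguments dim_b {R d} s.
Arguments batch {R d} s.
Arguments disp {R d} s.
Arguments Omega {R d} s.
Arguments prob {R d} s.
Arguments xi {R d} s.
Arguments lossF {R d} s.
Arguments lipF {R d} s.
Arguments gradF {R d} s.
Arguments Phat {R d} s.
Arguments uhat {R d} s.
Arguments xis {R d} s.
Arguments bvec {R d} s.
Arguments bs {R d} s.
Arguments xigen {R d} s.
Arguments psi {R d} s.
Arguments ehat {R d} s.
Arguments PsiL {R d} s.
Arguments PsiU {R d} s.
Arguments iterate {R d} s.
Arguments khat {R d} s.

Section Run.
Context (R : realType) (d : nat) (E : sgd_run R d).
Local Notation P := (prob E).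

Definition sigma_step (k : nat) : set_system (Omega E) :=
  <<s sigma_rv (uhat E k) `|`
      (\bigcup_(i in [set: 'I_(batch E)]) sigma_rv (xis E k i)) `|`
      (\bigcup_(i in [set: 'I_(batch E)]) sigma_rv (bs E k i)) `|`
      sigma_rv (psi E k) >>.

Definition sigma_past (k : nat) : set_system (Omega E) :=
  <<s \bigcup_(j in [set j | (1 <= j <= k)%N])
        (sigma_step j `|` sigma_rv (ehat E j)) >>.

Record is_loss (f : 'rV[R]_d -> R) (L0 Q : R) : Prop := IsLoss {
  lossF_continuous : forall x, continuous (fun w => lossF E w x);
  lossF_measurable : forall w, measurable_fun setT (lossF E w);
  lipF_measurable : measurable_fun setT (lipF E);
  lossF_lipschitz : {ae distribution P (xi E), forall x, forall w w',
    `|lossF E w x - lossF E w' x| <= lipF E x * l2norm (w - w')};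
  lipF_moment1 : ('E_P[lipF E \o xi E] = L0%:E)%E;
  lipF_moment2 : ('E_P[fun o => (lipF E (xi E o) ^+ 2)%R] = Q%:E)%E;
  lossE : forall w, ('E_P[lossF E w \o xi E] = (f w)%:E)%E;
  loss_ge0 : forall w, 0 <= f w
}.

Record is_sampling : Prop := IsSampling {
  dim_xi_gt0 : (0 < dim_xi E)%N;
  dim_b_gt0 : (0 < dim_b E)%N;
  batch_gt0 : (0 < batch E)%N;
  gradF_measurable : measurable_fun setT (gradF E);
  uhat_law : forall k, (0 < k)%N ->
    same_law (distribution P (uhat E k)) (Phat E k);
  xis_law : forall k i, (0 < k)%N ->
    same_law (distribution P (xis E k i)) (distribution P (xi E));
  bs_law : forall k i, (0 < k)%N ->
    same_law (distribution P (bs E k i)) (distribution P (bvec E k));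
  b_uniform : forall k l, (0 < k)%N -> exists S : seq R,
    [/\ uniq S, S != [::] & forall x, x \in S ->
      P [set o | bvec E k o 0 l = x] = ((size S)%:R^-1)%:E];
  samples_independent : forall k, (0 < k)%N -> mutually_independent P
    ([:: sigma_past k.-1; sigma_rv (uhat E k)]
     ++ [seq sigma_rv (xis E k i) | i <- enum 'I_(batch E)]
     ++ [seq sigma_rv (bs E k i) | i <- enum 'I_(batch E)]);
  xigen_law : forall k, (0 < k)%N ->
    same_law (distribution P (xigen E k)) (distribution P (xi E));
  generic_independent : forall k, (0 < k)%N -> mutually_independent P
    [:: sigma_past k.-1; sigma_rv (uhat E k); sigma_rv (xigen E k);
        sigma_rv (bvec E k)];
  psi_ge0 : forall k o, (0 < k)%N -> 0 <= psi E k o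
}.

Definition is_iteration (w1 : 'rV[R]_d) (eta : R) : Prop :=
  (forall o, iterate E 1 o = w1) /\
  (forall k o, (0 < k)%N -> iterate E k.+1 o =
     iterate E k o
     - (eta * psi E k o / (batch E)%:R) *:
         \sum_(i < batch E) gradF E (iterate E k o + uhat E k o,
                                     xis E k i o, bs E k i o)
     + ehat E k o).

Definition is_uniform_output (K : nat) : Prop :=
  (forall j, (j < K)%N -> P [set o | khat E o = j] = (K%:R^-1)%:E) /\
  mutually_independent P
    [:: <<s \bigcup_k sigma_past k >>; sigma_rv (khat E)].

Definition output (o : Omega E) : 'rV[R]_d := iterate E (khat E o).+1 o.

Definition gradient_estimate (k : nat) (o : Omega E) : 'rV[R]_d :=
  gradF E (iterate E k o + uhat E k o, xigen E k o, bvec E k o).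

Definition gradient_condition (f : 'rV[R]_d -> R) (alpha : R)
    (alpha0 : 0 < alpha) (c1 c2 Q : R) : Prop :=
  forall k, (0 < k)%N ->
  (exists2 Y, is_cond_exp_rV P (sigma_past k.-1) (gradient_estimate k) Y &
     {ae P, forall o, let g := grad (smoothing alpha0 f) (iterate E k o) in
        dotv (Y o) g >= c1 * l2norm g ^+ 2}) /\
  (exists2 Z, is_cond_exp P (sigma_past k.-1)
                (fun o => l2norm (gradient_estimate k o) ^+ 2) Z &
     {ae P, forall o, Z o <= c2 * Q}).

Definition stepsize_condition (psil psiu : R) : Prop :=
  forall k, (0 < k)%N ->
  [/\ sigma_rv (PsiL E k) `<=` sigma_past k.-1 /\
        sigma_rv (PsiU E k) `<=` sigma_past k.-1,
      forall o, 0 <= PsiL E k o <= PsiU E k o,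
      exists2 Y, is_cond_prob P (sigma_past k.-1)
                   [set o | PsiL E k o <= psi E k o <= PsiU E k o] Y &
        {ae P, forall o, Y o = 1} &
      P [set o | psil <= PsiU E k o <= psiu] = 1%E].

Definition error_condition (c3 eta : R) : Prop :=
  forall k, (0 < k)%N ->
  (exists2 Y, is_cond_exp_rV P <<s sigma_past k.-1 `|` sigma_step k >>
                (ehat E k) Y &
     {ae P, forall o, Y o = 0}) /\
  (exists2 Z, is_cond_exp P (sigma_past k.-1)
                (fun o => l2norm (ehat E k o) ^+ 2) Z &
     {ae P, forall o, Z o <= c3 * eta ^+ 2}).

Definition gap_condition (c4 eta alpha : R) : Prop :=
  forall k, (0 < k)%N ->
  {ae P, forall o, PsiU E k o - PsiL E k o <= c4 * (eta / alpha)}.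

Record sgd_setting (f : 'rV[R]_d -> R) (L0 Q : R) (w1 : 'rV[R]_d)
    (c1 c2 c3 c4 c5 psil psiu : R) (alpha : R) (alpha0 : 0 < alpha)
    (K : nat) (eta := c5 / Num.sqrt K%:R) : Prop := SgdSetting {
  setting_loss : is_loss f L0 Q;
  setting_sampling : is_sampling;
  setting_iteration : is_iteration w1 eta;
  setting_output : is_uniform_output K;
  setting_gradient : gradient_condition f alpha0 c1 c2 Q;
  setting_stepsize : stepsize_condition psil psiu;
  setting_error : error_condition c3 eta;
  setting_gap : gap_condition c4 eta alpha
}.

End Run.

(* Main.v *)
Require Import Defs.
From HB Require Import structures.
From mathcomp Require Import all_boot all_order all_algebra.
From mathcomp Require Import all_classical all_reals all_analysis.
From mathcomp Require Import measurable_realfun ring lra.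
Set Implicit Arguments.
Unset Strict Implicit.
Unset Printing Implicit Defensive.
Import Order.TTheory GRing.Theory Num.Theory.
Import numFieldNormedType.Exports.
Local Open Scope classical_set_scope.
Local Open Scope ring_scope.

(** The distance from 0 to the subdifferential at w is at most the Euclidean norm
    of the gradient of the smoothed loss at w (dist_clarke_le). It is therefore
    enough to bound the average over the run of the expected square of that
    norm, and the smoothed loss has a Lipschitz gradient, although the loss need
    not even be differentiable, so that the classical descent argument for
    stochastic gradients applies to it.

    The distance. A Lipschitz f is differentiable at w + u for almost every u of
    the cube (rademacher), and by dominated convergence the gradient of the
    smoothing at w is the mean of these gradients of f. They all lie in the
    convex set S whose distance to 0 is wanted. A point x of S of almost minimal
    norm satisfies <x, y> >= |x|^2 - e for every y in S, since moving from x
    towards y stays in S and cannot shorten x much. Integrating over y gives the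
    same inequality for the mean, and Cauchy-Schwarz gives the bound.

    Rademacher's theorem is proved by induction on the number of coordinates:
    along one more coordinate axis f is a Lipschitz function of a real variable,
    hence almost everywhere derivable, and the expansion in the previous
    coordinates is carried from the points of that axis where it is known to
    their neighbours by Lebesgue's density theorem (approx_step).

    The Lipschitz constant. Translating the uniform law of the cube of half-side
    a by t along an axis moves a mass |t| / (2 a) only, so the mean of a function
    bounded by B changes by at most |t| B / a (cube_shift_bound). Applied to
    u |-> f (w + u) - f (w' + u), which is bounded by L |w - w'|, this bounds the
    difference of each partial derivative of the smoothing by L |w - w'| / a,
    hence the difference of the gradients by sqrt d times as much.

    One step. The descent inequality of the smoothing is applied to the step
    from w^k to w^(k+1) and its expectation is taken (smoothing_expected_step).
    Writing g for the gradient of the smoothing at w^k: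
    - the step size psi is replaced by its past-measurable upper bound at the
      cost of the gap, because <S, g> <= (|S|^2 + |g|^2) / 2;
    - each sample of the batch has, jointly with the past, the same law as the
      generic sample (transfer_integral), so the batch mean S inherits the
      moment bound and the descent inequality of the generic gradient;
    - past-measurable factors are pulled out of conditional expectations
      (cond_exp_pull_out), which turns the hypotheses on these into bounds on
      integrals and makes the terms linear in the error vanish.

    Summing over the steps telescopes (telescoped_descent). The lower bound on K
    makes the gap small enough for half of the decrease to survive
    (average_grad_bound), and a uniform output index independent of the run
    turns the expectation at the output into the average over the run
    (output_integral_le). The resulting bound is at most A / sqrt K with A of
    order 1 / alpha for small alpha, so K of order (A / nu^2)^2 brings it below nu^2, and the
    mean of the distance below nu. *)

(** * Almost everywhere derivability and density points on the line *)

Section OneDim.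
Context {R : realType}.
Local Notation mu := (@lebesgue_measure R).
Implicit Types (phi g h : R -> R).

Lemma lipschitz1_continuous phi L :
  (forall x y, `|phi x - phi y| <= L * `|x - y|) -> continuous phi.
Proof.
move=> phiL x; apply/(@cvgrPdist_le _ R^o) => /= e e0; near=> y.
have L1 : 0 < `|L| + 1 by rewrite ltr_wpDl.
apply: (le_trans (phiL _ _)).
apply: (@le_trans _ _ ((`|L| + 1) * `|x - y|)).
  by rewrite ler_wpM2r// (le_trans (ler_norm _))// lerDl.
rewrite mulrC -ler_pdivlMr//.
by near: y; apply: cvgr_dist_le => //; rewrite divr_gt0.
Unshelve. all: by end_near. Qed.

(** (id + phi) / 2 and (id - phi) / 2 are nondecreasing with sum id, so their
    Stieltjes measures add up to the Lebesgue measure and the first one has a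
    density; phi is then, up to affine terms, a primitive of an integrable
    function. *)
Lemma lipschitz1_derivable_ae phi :
  (forall x y, `|phi x - phi y| <= `|x - y|) ->
  {ae mu, forall t, derivable phi t 1}.
Proof.
move=> phi1.
have cphi : continuous phi.
  by apply: (@lipschitz1_continuous _ 1) => x y; rewrite mul1r.
pose g t := (t + phi t) / 2.
pose h t := (t - phi t) / 2.
have cg : continuous g.
  by move=> t; apply: cvgM; [apply: cvgD; [exact: cvg_id|exact: cphi]|exact: cvg_cst].
have ch : continuous h.
  by move=> t; apply: cvgM; [apply: cvgB; [exact: cvg_id|exact: cphi]|exact: cvg_cst].
have ndg : {homo g : x y / x <= y}.
  move=> x y xy; rewrite /g ler_pM2r ?invr_gt0//.
  have := phi1 y x; rewrite (ger0_norm (_ : 0 <= y - x)) ?subr_ge0//.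
  by move=> /ler_normlP[]; lra.
have ndh : {homo h : x y / x <= y}.
  move=> x y xy; rewrite /h ler_pM2r ?invr_gt0//.
  have := phi1 y x; rewrite (ger0_norm (_ : 0 <= y - x)) ?subr_ge0//.
  by move=> /ler_normlP[]; lra.
pose gM := isCumulative.Build _ _ R g ndg (right_continuousW cg).
pose G : cumulative R R := HB.pack g gM.
pose hM := isCumulative.Build _ _ R h ndh (right_continuousW ch).
pose H : cumulative R R := HB.pack h hM.
pose nu := lebesgue_stieltjes_measure G.
have LSE (f : cumulative R R) (a b : R) : a <= b ->
    lebesgue_stieltjes_measure f `]a, b]%classic = (f b - f a)%:E.
  move=> ab; rewrite /lebesgue_stieltjes_measure/= /measure_extension/=.
  by rewrite measurable_mu_extE/= ?wlength_itv_bnd//; exact: is_ocitv.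
have nule A : measurable A -> (nu A <= mu A)%E.
  move=> mA.
  have -> : mu A = measure_add nu (lebesgue_stieltjes_measure H) A.
    apply: lebesgue_measure_unique => //.
    move=> _ [[a b] _ <-] /=.
    rewrite [RHS](measure_addE nu (lebesgue_stieltjes_measure H)).
    have [ab|ba] := leP a b; last first.
      by rewrite set_itv_ge ?measure0 ?adde0// bnd_simp -leNgt ltW.
    transitivity (b - a)%:E; first exact: (LSE idfun).
    transitivity ((g b - g a)%:E + (h b - h a)%:E)%E; last first.
      by congr (_ + _)%E; apply/esym; [exact: (LSE G)|exact: (LSE H)].
    rewrite -EFinD; congr EFin.
    by rewrite /= /g /h; lra.
  by rewrite measure_addE leeDl.
suff main n : {ae mu, forall x, x \in `](- n%:R), n%:R[ -> derivable phi x 1}.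
  have : {ae mu, forall x, forall n : nat, x \in `](- n%:R), n%:R[ -> derivable phi x 1}.
    exact/ae_foralln.
  apply: filterS; first exact: (ae_filter_ringOfSetsType mu).
  move=> x /(_ (Num.truncn `|x|).+1); apply.
  rewrite in_itv/= -ltr_norml; exact: truncnS_gt.
pose I : set (measurableTypeR R) := `](- n%:R), n%:R]%classic.
have mI : measurable I by exact: measurable_itv.
have Ioo : (nu I < +oo)%E.
  rewrite (_ : nu I = (g n%:R - g (- n%:R))%:E) ?ltry//.
  by apply: (LSE G); rewrite (@le_trans _ _ 0)// oppr_le0.
pose nun : {finite_measure set (measurableTypeR R) -> \bar R} := mfrestr mI Ioo.
have dom : nun `<< mu.
  apply/null_content_dominatesP => A mA A0.
  apply/eqP; rewrite eq_le measure_ge0 andbT -A0 /= /mfrestr/= /mrestr.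
  rewrite (le_trans (nule _ _))//; first exact: measurableI.
  by apply: le_measure; rewrite ?inE//; exact: measurableI.
have [f [f0 ffin fi fE]] := radon_nikodym_sigma_finite dom.
have fEr : EFin \o (fine \o f) = f by apply/funext => x /=; rewrite fineK.
have fi' : mu.-integrable setT (EFin \o (fine \o f)) by rewrite fEr.
have locf : locally_integrable setT (fine \o f).
  apply/open_integrable_locally => //; exact: openT.
have := @FTC1 _ (fine \o f) (BRight (- n%:R)) _ locf.
have ii : forall y : R, mu.-integrable [set` Interval (BRight (- n%:R)) (BRight y)]
    (EFin \o (fine \o f)).
  move=> y; apply: integrableS fi' => //.
move=> /(_ ii); apply: filterS; first exact: (ae_filter_ringOfSetsType mu).
move=> x /= + xn.
move: xn; rewrite in_itv/= => /andP[nx xn].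
rewrite lte_fin => /(_ nx)[+ _].
set F := (fun x => _) => dF.
suff gE : derivable g x 1.
  have -> : phi = (fun t => g t * 2 - t).
    by apply/funext => t; rewrite /g; lra.
  apply: derivableB => //; apply: derivableM => //.
have : derivable (F + cst (g (- n%:R))) x 1 by apply: derivableD.
apply: near_eq_derivable.
near=> y.
have ny : - n%:R < y by near: y; exact: lt_nbhsr.
have yn : y < n%:R by near: y; exact: lt_nbhsl.
rewrite /F /= {1}/GRing.add/= /Rintegral.
have := fE _ (measurable_itv `](- n%:R), y]).
rewrite /= /mfrestr/= /mrestr setIidl; last first.
  by apply: subset_itvl; rewrite bnd_simp ltW.
rewrite [LHS](LSE G) ?ltW// => E.
under eq_integral do rewrite fineK//.
by rewrite -E /= subrK.
Unshelve. all: by end_near. Qed.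

Lemma lipschitz_derivable_ae phi L :
  (forall x y, `|phi x - phi y| <= L * `|x - y|) ->
  {ae mu, forall t, derivable phi t 1}.
Proof.
move=> phiL; pose M := `|L| + 1.
have M0 : 0 < M by rewrite ltr_wpDl.
have := @lipschitz1_derivable_ae (fun t => M^-1 * phi t).
have lip x y : `|M^-1 * phi x - M^-1 * phi y| <= `|x - y|.
  rewrite -mulrBr normrM gtr0_norm ?invr_gt0// mulrC ler_pdivrMr// mulrC.
  rewrite (le_trans (phiL _ _))// ler_wpM2r//.
  by rewrite /M (le_trans (ler_norm _))// lerDl.
move=> /(_ lip); apply: filterS; first exact: (ae_filter_ringOfSetsType mu).
move=> t dt; have -> : phi = (fun t => M * (M^-1 * phi t)).
  by apply/funext => s; rewrite mulrA divff ?mul1r// gt_eqF.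
by apply: derivableM => //; exact: derivable_cst.
Qed.

(** At a density point t of A, an interval around t + s of length proportional
    to |s| occupies a fixed fraction of a ball around t of radius proportional to
    |s|, so for small s it has to meet A. *)
Lemma density_approach (A : set R) : measurable A ->
  {ae mu, forall t, A t -> forall e, 0 < e -> exists2 del, 0 < del &
    forall s, `|s| <= del -> exists2 t', A t' & `|t' - (t + s)| <= e * `|s|}.
Proof.
move=> mA; have := lebesgue_density mA.
apply: filterS; first exact: (ae_filter_ringOfSetsType mu).
move=> t + At e0 e0_gt0; rewrite indicE mem_set//=.
wlog : e0 e0_gt0 / e0 <= 1.
  move=> W dt; have [e1|e1] := leP e0 1; first exact: W.
  have [del del0 H] := W _ ltr01 (lexx _) dt.
  exists del => // s /H[t' At' tt']; exists t' => //.
  by rewrite (le_trans tt')// ler_wpM2r// ltW.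
set e := e0 in e0_gt0 * => e1 dt.
(* The interval I below, of length 2 e |s|, fills the fraction e / 3 of the
   ball of radius 3 |s|; a density above 1 - e / 4 leaves it no room outside A. *)
have : \forall r \near 0^'+, ((1 - e / 4)%:E < mu (A `&` ball t r) * (mu (ball t r))^-1)%E.
  move: dt => /(_ [set x : \bar R | ((1 - e / 4)%:E < x)%E]); apply.
  rewrite /nbhs/=.
  have : \forall x \near (1 : R), 1 - e / 4 < x.
    by apply: lt_nbhsr; rewrite gtrBl divr_gt0.
  by apply: filterS => x; rewrite lte_fin.
rewrite /prop_near1/= => -[del /= del0 Hdel].
exists (del / 4); first by rewrite divr_gt0.
move=> s sdel.
have [->|s0] := eqVneq s 0.
  by exists t => //; rewrite addr0 subrr normr0 mulr0.
have s_gt0 : 0 < `|s| by rewrite normr_gt0.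
apply: contrapT => nex.
pose r := 3 * `|s|.
have r0 : 0 < r by rewrite mulr_gt0.
have := Hdel r; rewrite /ball/= sub0r normrN gtr0_norm// => /(_ _ r0).
have rdel : r < del by rewrite /r; lra.
move=> /(_ rdel); apply/negP; rewrite -leNgt.
pose I : set R := `[t + s - e * `|s|, t + s + e * `|s|]%classic.
have muI : mu I = (2 * e * `|s|)%:E.
  rewrite lebesgue_measure_itv/= lte_fin ifT; last first.
    by rewrite ltrBlDr -addrA ltrDl addr_gt0// mulr_gt0.
  by rewrite -EFinB; congr EFin; ring.
have muB : mu (ball t r) = (6 * `|s|)%:E.
  by rewrite lebesgue_measure_ball ?ltW//; congr EFin; rewrite /r; ring.
have IB : I `<=` ball t r.
  move=> x; rewrite /I/= in_itv/= => /andP[x1 x2].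
  rewrite /ball/= /r ltr_distl.
  have := ler_norm s; have := lerNnormlW (lexx `|s|).
  have es : e * `|s| <= `|s| by rewrite ler_piMl.
  by move=> h1 h2; apply/andP; split; lra.
have disj : (A `&` ball t r) `&` I = set0.
  apply/seteqP; split => // x [[Ax _]]; rewrite /I/= in_itv/= => /andP[x1 x2].
  apply: nex; exists x => //; rewrite ler_norml; lra.
have mB : measurable (ball t r) by exact: measurable_ball.
have mI : measurable I by exact: measurable_itv.
have mAB : measurable (A `&` ball t r) by exact: measurableI.
have : (mu (A `&` ball t r) + mu I <= mu (ball t r))%E.
  rewrite -measureU//; apply: le_measure; rewrite ?inE//; first exact: measurableU.
  by rewrite subUset; split => //; exact: subIsetr.
rewrite muI muB -leeBrDr// -EFinB => le1.
rewrite inver gt_eqF ?mulr_gt0//.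
apply: (le_trans (lee_wpmul2r _ le1)).
  by rewrite lee_fin invr_ge0 ltW// mulr_gt0.
rewrite -EFinM lee_fin.
rewrite ler_pdivrMr ?mulr_gt0//.
have -> : (1 - e / 4) * (6 * `|s|) = 6 * `|s| - 3 / 2 * (e * `|s|) by lra.
have : 0 <= e * `|s| by rewrite mulr_ge0// ltW.
lra.
Qed.
End OneDim.

(** * The uniform law on the cube *)

Section Cube.
Context {R : realType}.
Local Notation mu := (@lebesgue_measure R).

Lemma continuous_rV_measurable d (g : 'rV[R]_d -> R) :
  continuous g -> measurable_fun setT g.
Proof.
move=> cg; apply: (measurability _ (RGenOpens.measurableE R)) => _ [_ [a [b ->] <-]].
rewrite setTI; apply: sub_sigma_algebra.
apply: open_comp; last exact: interval_open.
by move=> v _; exact: cg.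
Qed.

Lemma continuous_rV_measurable_rV d1 d2 (g : 'rV[R]_d1 -> 'rV[R]_d2) :
  continuous g -> measurable_fun setT g.
Proof.
move=> cg; apply: measurable_rVP => j.
apply: continuous_rV_measurable => v.
apply: (@continuous_comp _ _ _ g (fun w : 'rV[R]_d2 => w 0 j)); first exact: cg.
exact: coord_continuous.
Qed.

Lemma closed_rV_measurable d (A : set 'rV[R]_d) : closed A -> measurable A.
Proof.
move=> cA; rewrite -[A]setCK; apply: measurableC.
by apply: sub_sigma_algebra; exact: closed_openC.
Qed.

Section integral_cube.
Variables (a : R) (a0 : 0 < a).
Local Notation U := (uniform_prob (opp_lt_pos a0)).

Lemma uniform_cube_tonelli1 d (f : 'rV[R]_d.+1 -> \bar R) :
  measurable_fun setT f -> (forall u, 0 <= f u)%E ->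
  (\int[uniform_cube a0 d.+1]_u f u =
   \int[U]_x \int[uniform_cube a0 d]_v f (cons_rV (x, v)))%E.
Proof.
move=> mf f0.
rewrite [LHS](ge0_integral_pushforward (@measurable_cons_rV R d))//=.
rewrite preimage_setT fubini_tonelli1//.
by apply: measurableT_comp => //; exact: measurable_cons_rV.
Qed.

Lemma uniform_cube_tonelli2 d (f : 'rV[R]_d.+1 -> \bar R) :
  measurable_fun setT f -> (forall u, 0 <= f u)%E ->
  (\int[uniform_cube a0 d.+1]_u f u =
   \int[uniform_cube a0 d]_v \int[U]_x f (cons_rV (x, v)))%E.
Proof.
move=> mf f0.
rewrite [LHS](ge0_integral_pushforward (@measurable_cons_rV R d))//=.
rewrite preimage_setT fubini_tonelli2//.
by apply: measurableT_comp => //; exact: measurable_cons_rV.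
Qed.

End integral_cube.

Lemma cons_rV_shift0 d (x t : R) (v : 'rV[R]_d) :
  cons_rV (x, v) + t *: delta_mx 0 ord0 = cons_rV (x + t, v).
Proof.
apply/rowP => j; case: (unliftP ord0 j) => [i|] ->; rewrite [LHS]mxE [X in _ + X = _]mxE [X in _ * X]mxE.
  by rewrite !cons_rVS eqE/= mulr0 addr0.
by rewrite !cons_rV0 !eqxx mulr1.
Qed.

Lemma cons_rV_shiftS d (x t : R) (v : 'rV[R]_d) (i : 'I_d) :
  cons_rV (x, v) + t *: delta_mx 0 (lift ord0 i) =
  cons_rV (x, v + t *: delta_mx 0 i).
Proof.
apply/rowP => j; case: (unliftP ord0 j) => [k|] ->; rewrite [LHS]mxE [X in _ + X = _]mxE [X in _ * X]mxE.
  by rewrite !cons_rVS [RHS]mxE [X in _ = _ + X]mxE [X in _ = _ + _ * X]mxE (inj_eq lift_inj).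
by rewrite !cons_rV0 eqE/= mulr0 addr0.
Qed.

Lemma measurable_cons_rV1 d (v : 'rV[R]_d) :
  measurable_fun setT (fun x : measurableTypeR R => cons_rV (x, v)).
Proof. by apply: measurableT_comp => //; exact: measurable_cons_rV. Qed.

Lemma measurable_cons_rV2 d (x : measurableTypeR R) :
  measurable_fun setT (fun v : 'rV[R]_d => cons_rV (x, v)).
Proof. by apply: measurableT_comp => //; exact: measurable_cons_rV. Qed.

Lemma rV_norm_le d (v : 'rV[R]_d) (c : R) : 0 <= c ->
  (forall j, `|v 0 j| <= c) -> `|v| <= c.
Proof.
move=> c0 vc; rewrite /Num.norm/= mx_normrE; apply: bigmax_le => // -[i j] _ /=.
by rewrite ord1.
Qed.

Lemma rV_norm_coord d (v : 'rV[R]_d) j : `|v 0 j| <= `|v|.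
Proof.
rewrite [leRHS]/Num.norm/= mx_normrE.
by rewrite (le_bigmax _ (fun ij : 'I_1 * 'I_d => `|v ij.1 ij.2|) (0, j)).
Qed.

(** Induction on the dimension peels off coordinates until the direction k is
    the first one, where Tonelli with the line as inner integral concludes. *)
Lemma uniform_cube_null_lines (a : R) (a0 : 0 < a) d (k : 'I_d)
    (N : set 'rV[R]_d) : measurable N ->
  (forall x, mu [set t | N (x + t *: delta_mx 0 k)] = 0%E) ->
  uniform_cube a0 d N = 0%E.
Proof.
elim: d k N => [|d IH] k N mN N0; first by case: k N0 => [[]].
pose f (u : 'rV[R]_d.+1) := (\1_N u)%:E : \bar R.
have mf : measurable_fun setT f by apply/measurable_EFinP; exact: measurable_indic.
have f0 u : (0 <= f u)%E by rewrite lee_fin.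
have -> : uniform_cube a0 d.+1 N = (\int[uniform_cube a0 d.+1]_u f u)%E.
  by rewrite integral_indic// setIT.
case: (unliftP ord0 k) N0 => [i|] -> N0.
  rewrite uniform_cube_tonelli1//; apply: integral0_eq => x _.
  rewrite (_ : (fun v => _) = (fun v => (\1_[set v | N (cons_rV (x, v))] v)%:E)); last first.
    by apply/funext => v; rewrite /f !indicE; congr (_ _)%:E; congr nat_of_bool; apply/idP/idP; rewrite !inE.
  have mS : measurable [set v | N (cons_rV (x, v))].
    by rewrite -[X in measurable X]setTI; apply: measurable_cons_rV2.
  rewrite integral_indic// setIT; apply: (IH i) => // v.
  rewrite -(N0 (cons_rV (x, v))); congr (mu _); apply/funext => t /=.
  by rewrite cons_rV_shiftS.
rewrite uniform_cube_tonelli2//; apply: integral0_eq => v _.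
rewrite (_ : (fun x => _) = (fun x => (\1_[set x : measurableTypeR R | N (cons_rV (x, v))] x)%:E)); last first.
  by apply/funext => x; rewrite /f !indicE; congr (_ _)%:E; congr nat_of_bool; apply/idP/idP; rewrite !inE.
have mS : measurable [set x : measurableTypeR R | N (cons_rV (x, v))].
  by rewrite -[X in measurable X]setTI; apply: measurable_cons_rV1.
rewrite integral_indic// setIT.
have := dominates_uniform_prob (opp_lt_pos a0).
move/null_content_dominatesP; apply => //.
rewrite -(N0 (cons_rV (0, v))); congr (mu _); apply/funext => t /=.
by rewrite cons_rV_shift0 add0r.
Qed.

(** The cube is the ball of radius a for the sup norm. *)
Lemma uniform_cube_support (a : R) (a0 : 0 < a) d :
  {ae uniform_cube a0 d, forall u, `|u| <= a}.
Proof.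
pose A := (fun _ : 'I_d => `[- a, a]%classic : set (measurableTypeR R)).
have mA i : measurable (A i) by exact: measurable_itv.
have E : uniform_cube a0 d [set v | forall i, A i (v 0 i)] = 1%E.
  rewrite uniform_cube_box// big1// => i _.
  apply: (integral_uniform_pdf1 (opp_lt_pos a0)).
  exact: subset_refl.
have mS : measurable [set v : 'rV[R]_d | forall i, A i (v 0 i)].
  rewrite (_ : mkset _ = \big[setI/setT]_(i < d)
      ((fun v : 'rV[R]_d => v 0 i) @^-1` A i)).
    apply: bigsetI_measurable => i _; rewrite -[X in measurable X]setTI.
    by apply: measurable_rV_coord => //; exact: mA.
  apply/seteqP; split=> v /=.
    by move=> Av; elim/big_ind: _ => // i _; exact: Av.
  by move=> + i; rewrite (bigD1 i)//= => -[].
exists (~` [set v : 'rV[R]_d | forall i, A i (v 0 i)]); split; first exact: measurableC.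
  by rewrite probability_setC// E subee.
apply: subsetC => v /= Av; apply: rV_norm_le => [|j]; first exact: ltW.
by have := Av j; rewrite /A/= in_itv/= ler_norml.
Qed.

Lemma lebesgue_measure_shift (t : R) (A : set R) : measurable A ->
  mu [set x | A (x + t)] = mu A.
Proof.
move=> mA.
have mt : measurable_fun setT (fun x : measurableTypeR R => x + t : measurableTypeR R).
  exact: measurable_funD.
pose nu := pushforward mu (fun x : measurableTypeR R => x + t : measurableTypeR R).
apply/esym; apply: (@lebesgue_measure_unique _ nu) => //.
move=> _ [[x y] _ <-] /=.
rewrite /nu/= /pushforward/=.
rewrite (_ : _ @^-1` _ = `]x - t, y - t]%classic); last first.
  by apply/seteqP; split => z /=; rewrite !in_itv/= ltrBlDr lerBrDr.
rewrite !lebesgue_measure_itv/= !lte_fin ltrD2r; case: ifP => // _.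
by rewrite -!EFinB; congr EFin; ring.
Qed.

Lemma ge0_integral_shift (t : R) (f : R -> \bar R) :
  measurable_fun setT f -> (forall x, 0 <= f x)%E ->
  (\int[mu]_x f (x + t)%R = \int[mu]_x f x)%E.
Proof.
move=> mf f0.
have mt : measurable_fun setT (fun x : measurableTypeR R => x + t : measurableTypeR R).
  exact: measurable_funD.
rewrite -[LHS](@ge0_integral_pushforward _ _ _ _ _ _ mt mu setT f)//.
apply: eq_measure_integral => A mA _; exact: lebesgue_measure_shift.
Qed.

(** The window [-a + t, a + t] exceeds [-a, a] by an interval of length at most
    |t|, on which f is at most M. *)
Lemma ge0_integral_uniform_shift (a : R) (a0 : 0 < a) (M t : R)
    (f : R -> \bar R) :
  measurable_fun setT f -> (forall x, 0 <= f x <= M%:E)%E ->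
  (\int[uniform_prob (opp_lt_pos a0)]_x f (x + t)%R <=
   \int[uniform_prob (opp_lt_pos a0)]_x f x + (`|t| * M / (2 * a))%:E)%E.
Proof.
move=> mf fM.
have f0 x : (0 <= f x)%E by have /andP[] := fM x.
have M0 : 0 <= M by have /andP[h1 h2] := fM 0; rewrite -lee_fin (le_trans h1).
have mft : measurable_fun setT (fun x : measurableTypeR R => f (x + t)).
  apply: measurableT_comp => //; exact: measurable_funD.
rewrite !integral_uniform//.
have -> : a - - a = 2 * a by ring.
have -> : `|t| * M / (2 * a) = (2 * a)^-1 * (M * `|t|) by ring.
rewrite [X in (_ + X)%E]EFinM -ge0_muleDr; last 2 first.
- exact: integral_ge0.
- by rewrite lee_fin mulr_ge0.
apply: lee_wpmul2l; first by rewrite lee_fin invr_ge0 mulr_ge0// ltW.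
pose S : set R := `[- a, a]%classic.
pose St : set R := `[- a + t, a + t]%classic.
have mS : measurable (S : set (measurableTypeR R)) by exact: measurable_itv.
have mSt : measurable (St : set (measurableTypeR R)) by exact: measurable_itv.
rewrite -/S.
have -> : (\int[mu]_(x in S) f (x + t)%R = \int[mu]_(x in St) f x)%E.
  rewrite integral_mkcond [RHS]integral_mkcond -[RHS](ge0_integral_shift t); last 2 first.
  - apply/(measurable_restrictT _ mSt). by apply: measurable_funTS.
  - by move=> x; rewrite patchE; case: ifP.
  apply: eq_integral => x _; rewrite !patchE; congr (if _ then _ else _).
  by apply/idP/idP; rewrite !inE /S /St/= !in_itv/= !lerD2r.
have mD : measurable (St `\` S : set (measurableTypeR R)) by exact: measurableD.
have mI : measurable (St `&` S : set (measurableTypeR R)) by exact: measurableI.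
rewrite -{1}(setUIDK St S) ge0_integral_setU//; last 2 first.
- by rewrite setUIDK; apply: measurable_funTS.
- by apply/disj_set2P; rewrite setDE setIACA setICr setI0.
apply: leeD.
  by apply: ge0_subset_integral => //; apply: measurable_funTS.
apply: (@le_trans _ _ (\int[mu]_(x in St `\` S) M%:E)%E).
  apply: ge0_le_integral => //; first by apply: measurable_funTS.
  by move=> x _; have /andP[] := fM x.
rewrite integral_cst// EFinM lee_wpmul2l ?lee_fin//.
have [t0|t0] := leP 0 t.
  apply: (@le_trans _ _ (mu `]a, a + t]%classic)).
    apply: le_measure => [||x]; [by rewrite inE|by rewrite inE; exact: measurable_itv|].
    rewrite /S /St/= !in_itv/= => -[/andP[x1 ->]] /negP.
    rewrite negb_and -!ltNge andbT => /orP[|//]; lra.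
  rewrite lebesgue_measure_itv/=; case: ifP => _; last by rewrite lee_fin.
  by rewrite -EFinB lee_fin ger0_norm//; lra.
apply: (@le_trans _ _ (mu `[- a + t, - a[%classic)).
  apply: le_measure => [||x]; [by rewrite inE|by rewrite inE; exact: measurable_itv|].
  rewrite /S /St/= !in_itv/= => -[/andP[-> x1]] /negP.
  rewrite negb_and -!ltNge => /orP[//|]; lra.
rewrite lebesgue_measure_itv/=; case: ifP => _; last by rewrite lee_fin.
by rewrite -EFinB lee_fin ltr0_norm//; lra.
Qed.

(** The shift affects a single factor of the product law; integrating over the
    other coordinates reduces to the case of the line. *)
Lemma ge0_integral_uniform_cube_shift (a : R) (a0 : 0 < a) (M t : R) d
    (j : 'I_d) (f : 'rV[R]_d -> \bar R) :
  measurable_fun setT f -> (forall x, 0 <= f x <= M%:E)%E ->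
  (\int[uniform_cube a0 d]_u f (u + t *: delta_mx 0 j)%R <=
   \int[uniform_cube a0 d]_u f u + (`|t| * M / (2 * a))%:E)%E.
Proof.
elim: d j f => [|d IH] j f mf fM; first by case: j.
have f0 x : (0 <= f x)%E by have /andP[] := fM x.
have M0 : 0 <= M by have /andP[h1 h2] := fM 0; rewrite -lee_fin (le_trans h1).
have mft : measurable_fun setT (fun u : 'rV[R]_d.+1 => f (u + t *: delta_mx 0 j)).
  apply: measurableT_comp => //; apply: continuous_rV_measurable_rV => u.
  exact: (cvgD cvg_id (cvg_cst _)).
have mF : measurable_fun setT (fun p => f (@cons_rV R d p)).
  by apply: measurableT_comp => //; exact: measurable_cons_rV.
have mFt : measurable_fun setT (fun p => f (@cons_rV R d p + t *: delta_mx 0 j)).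
  by apply: measurableT_comp mft _; exact: measurable_cons_rV.
have c0 : 0 <= `|t| * M / (2 * a) by rewrite divr_ge0// mulr_ge0// ltW.
have mI1 := measurable_fun_fubini_tonelli_F (m2 := uniform_cube a0 d) _ mF (fun=> f0 _).
have mI2 := measurable_fun_fubini_tonelli_F (m2 := uniform_cube a0 d) _ mFt (fun=> f0 _).
have mI3 := measurable_fun_fubini_tonelli_G (m1 := uniform_prob (opp_lt_pos a0)) _ mF (fun=> f0 _).
have mI4 := measurable_fun_fubini_tonelli_G (m1 := uniform_prob (opp_lt_pos a0)) _ mFt (fun=> f0 _).
case: (unliftP ord0 j) mft mFt mI2 mI4 => [i|] -> mft mFt mI2 mI4.
  rewrite !uniform_cube_tonelli1//.
  have -> : ((`|t| * M / (2 * a))%:E =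
     \int[uniform_prob (opp_lt_pos a0)]_x (`|t| * M / (2 * a))%:E :> \bar R)%E.
    by rewrite integral_cst//= probability_setT mule1.
  rewrite -ge0_integralD//; last by move=> x _; exact: integral_ge0.
  apply: ge0_le_integral => //.
  - by move=> x _; exact: integral_ge0.
  - exact: emeasurable_funD.
  move=> x _; under eq_integral do rewrite cons_rV_shiftS.
  apply: (IH i (fun v => f (cons_rV (x, v)))) => //.
  by apply: measurableT_comp => //; exact: measurable_cons_rV2.
rewrite !uniform_cube_tonelli2//.
have -> : ((`|t| * M / (2 * a))%:E =
   \int[uniform_cube a0 d]_x (`|t| * M / (2 * a))%:E :> \bar R)%E.
  by rewrite integral_cst//= probability_setT mule1.
rewrite -ge0_integralD//; last by move=> x _; exact: integral_ge0.
apply: ge0_le_integral => //.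
- by move=> x _; exact: integral_ge0.
- exact: emeasurable_funD.
move=> v _; under eq_integral do rewrite cons_rV_shift0.
apply: (@ge0_integral_uniform_shift _ _ _ _ (fun x => f (cons_rV (x, v)))) => //.
by apply: measurableT_comp => //; exact: measurable_cons_rV1.
Qed.
End Cube.

(** * Rademacher's theorem *)

Section Rademacher.
Context {R : realType}.
Local Notation mu := (@lebesgue_measure R).

Lemma ae_forall_count (I : countType) (dT : measure_display)
    (T : measurableType dT) (m : {measure set T -> \bar R}) (P : I -> T -> Prop) :
  (forall i, {ae m, forall x, P i x}) -> {ae m, forall x, forall i, P i x}.
Proof.
move=> aeP; have : {ae m, forall x, forall n,
    if unpickle n is Some i then P i x else True}.
  apply/ae_foralln => n; case: unpickle => [i|]; first exact: aeP.
  exact: aeW.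
apply: filterS => x H i; by have := H (pickle i); rewrite pickleK.
Qed.

Lemma dotvDr d (y u v : 'rV[R]_d) : dotv y (u + v) = dotv y u + dotv y v.
Proof. by rewrite /dotv -big_split/=; apply: eq_bigr => j _; rewrite !mxE mulrDr. Qed.

Lemma dotvZr d (y u : 'rV[R]_d) t : dotv y (t *: u) = t * dotv y u.
Proof. by rewrite /dotv mulr_sumr; apply: eq_bigr => j _; rewrite !mxE mulrCA. Qed.

Lemma dotvBr d (y u v : 'rV[R]_d) : dotv y (u - v) = dotv y u - dotv y v.
Proof. by rewrite dotvDr -scaleN1r dotvZr mulN1r. Qed.

Lemma dotv_delta d (y : 'rV[R]_d) k : dotv y (delta_mx 0 k) = y 0 k.
Proof.
rewrite /dotv (bigD1 k)//= mxE !eqxx mulr1 big1 ?addr0// => j jk.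
by rewrite mxE eqxx (negbTE jk) mulr0.
Qed.

Lemma norm_delta d (k : 'I_d) : `|delta_mx 0 k : 'rV[R]_d| <= 1.
Proof.
apply: rV_norm_le => // j; rewrite mxE eqxx/=.
by case: eqP; rewrite ?normr1 ?normr0.
Qed.

Lemma lipschitzV_continuous d (f : 'rV[R]_d -> R) L :
  (forall x y, `|f x - f y| <= L * `|x - y|) -> continuous f.
Proof.
move=> phiL x; apply: (@cvgrPdist_le R R^o _ (nbhs x) _ f (f x)).2 => e e0.
have L1 : 0 < `|L| + 1 by rewrite ltr_wpDl.
have eL : 0 < e / (`|L| + 1) by rewrite divr_gt0.
have idx : y @[y --> x] --> x by exact: cvg_id.
have /cvgrPdist_le /(_ _ eL) := idx.
apply: filterS => y xy; apply: (le_trans (phiL _ _)).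
apply: (@le_trans _ _ ((`|L| + 1) * `|x - y|)).
  by rewrite ler_wpM2r// (le_trans (ler_norm _))// lerDl.
by rewrite mulrC -ler_pdivlMr.
Qed.

Section main.
Variables (d : nat) (f : 'rV[R]_d -> R) (L : R).
Hypothesis L0 : 0 <= L.
Hypothesis fL : forall x y, `|f x - f y| <= L * `|x - y|.

Let cf : continuous f. Proof. exact: lipschitzV_continuous fL. Qed.

(** The subspace of the first k coordinates, along which the differential is
    built up. *)
Definition zero_from (k : nat) (h : 'rV[R]_d) := forall j : 'I_d, (k <= j)%N -> h 0 j = 0.

(** The points at which f has slope y along D with precision e up to radius del.
    Fixing e and del makes this a closed set, hence a measurable one. *)
Definition approx (D : set 'rV[R]_d) (y : 'rV[R]_d) (e del : R) : set 'rV[R]_d :=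
  [set x | forall h, D h -> `|h| <= del ->
     `|f (x + h) - f x - dotv y h| <= e * `|h|].

Lemma approx_closed D y0 e del : closed (approx D y0 e del).
Proof.
have -> : approx D y0 e del = \bigcap_(h in [set h | D h /\ `|h| <= del])
    [set x | `|f (x + h) - f x - dotv y0 h| <= e * `|h|].
  apply/seteqP; split => x /=.
    by move=> H h [Dh hd]; exact: H.
  by move=> H h Dh hd; exact: H.
apply: closed_bigI => h _.
pose g (x : 'rV[R]_d) : R := `|f (x + h) - f x - dotv y0 h|.
rewrite -/(g @^-1` [set r | r <= e * `|h|]).
apply: closed_comp; last exact: closed_le.
suff cg : continuous g by move=> x _; exact: cg.
apply: (@lipschitzV_continuous _ _ (2 * L)) => x y.
apply: (le_trans (ler_dist_dist _ _)).
have -> : f (x + h) - f x - dotv y0 h - (f (y + h) - f y - dotv y0 h) =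
  (f (x + h) - f (y + h)) - (f x - f y) by ring.
apply: (le_trans (ler_normB _ _)).
have -> : 2 * L * `|x - y| = L * `|(x + h) - (y + h)| + L * `|x - y|.
  by rewrite opprD addrACA subrr addr0; ring.
by rewrite lerD.
Qed.

Lemma approx_le D y e e' del del' x : e <= e' -> del' <= del ->
  approx D y e del x -> approx D y e' del' x.
Proof.
move=> ee dd H h Dh hd; apply: (le_trans (H h Dh (le_trans hd dd))).
by rewrite ler_wpM2r.
Qed.

Definition axis (k : 'I_d) : set 'rV[R]_d := [set h | exists t, h = t *: delta_mx 0 k].

(** From x the point x + h is reached by going to x + s e_k along the axis k
    and then by h', a vector of the first k coordinates. The expansion along h'
    is known only from some x + t e_k close to x + s e_k; moving between the two,
    before and after h', costs L e |s| each time. *)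
Lemma approx_step (k : 'I_d) (y1 y2 : 'rV[R]_d) e del del' x : 0 <= e ->
  0 < del -> 0 < del' ->
  approx (axis k) y2 e del x ->
  (forall s, `|s| <= del' -> exists2 t, approx (zero_from k) y1 e del (x + t *: delta_mx 0 k) &
      `|t - s| <= e * `|s|) ->
  approx (zero_from k.+1) (\row_j if j == k then y2 0 j else y1 0 j)
    ((2 * L + 2) * e) (Num.min del del') x.
Proof.
move=> e0 del0 del'0 Ax Ex h hk; rewrite le_min => /andP[hd hd'].
pose s := h 0 k; pose h' := h - s *: delta_mx 0 k.
have sh : `|s| <= `|h| by exact: rV_norm_coord.
have h'E j : h' 0 j = if j == k then 0 else h 0 j.
  rewrite !mxE eqxx/= eq_sym; case: eqP => [<-|_]; first by rewrite mulr1 subrr.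
  by rewrite mulr0 subr0.
have h'k : zero_from k h'.
  move=> j; rewrite leq_eqVlt h'E => /orP[/eqP/val_inj->|kj]; first by rewrite eqxx.
  by case: eqP => // _; exact: hk.
have h'h : `|h'| <= `|h|.
  apply: rV_norm_le => // j; rewrite h'E; case: eqP => _; first by rewrite normr0.
  exact: rV_norm_coord.
have [t At ts] := Ex s (le_trans sh hd').
have E1 := At h' h'k (le_trans h'h hd).
have ssd : `|s *: delta_mx 0 k : 'rV[R]_d| <= `|s|.
  by rewrite normrZ ler_piMr// norm_delta.
have E2 := Ax (s *: delta_mx 0 k) (ex_intro _ s erefl) (le_trans ssd (le_trans sh hd)).
have E3 : `|f (x + h) - f (x + t *: delta_mx 0 k + h')| <= L * (e * `|s|).
  apply: (le_trans (fL _ _)); rewrite ler_wpM2l//.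
  have -> : x + h - (x + t *: delta_mx 0 k + h') = (s - t) *: delta_mx 0 k.
    by apply/rowP => j; rewrite !mxE; ring.
  rewrite normrZ distrC (le_trans _ ts)// ler_piMr//; exact: norm_delta.
have E4 : `|f (x + t *: delta_mx 0 k) - f (x + s *: delta_mx 0 k)| <= L * (e * `|s|).
  apply: (le_trans (fL _ _)); rewrite ler_wpM2l//.
  have -> : x + t *: delta_mx 0 k - (x + s *: delta_mx 0 k) = (t - s) *: delta_mx 0 k.
    by apply/rowP => j; rewrite !mxE; ring.
  rewrite normrZ (le_trans _ ts)// ler_piMr//; exact: norm_delta.
set y' := (\row_j _).
have dotE : dotv y' h = dotv y1 h' + dotv y2 (s *: delta_mx 0 k).
  rewrite dotvZr dotv_delta /dotv (bigD1 k)//= mxE eqxx [in RHS](bigD1 k)//= h'E eqxx mulr0 add0r.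
  rewrite addrC mulrC; congr (_ + _); apply: eq_bigr => j jk.
  by rewrite mxE h'E (negbTE jk).
have -> : f (x + h) - f x - dotv y' h =
  (f (x + h) - f (x + t *: delta_mx 0 k + h'))
  + (f (x + t *: delta_mx 0 k + h') - f (x + t *: delta_mx 0 k) - dotv y1 h')
  + (f (x + t *: delta_mx 0 k) - f (x + s *: delta_mx 0 k))
  + (f (x + s *: delta_mx 0 k) - f x - dotv y2 (s *: delta_mx 0 k)).
  by rewrite dotE; ring.
apply: (le_trans (ler_normD _ _)); apply: (le_trans (lerD (ler_normD _ _) (lexx _))).
apply: (le_trans (lerD (lerD (ler_normD _ _) (lexx _)) (lexx _))).
have F1 : L * (e * `|s|) <= L * (e * `|h|) by rewrite ler_wpM2l// ler_wpM2l.
have F2 : e * `|h'| <= e * `|h| by rewrite ler_wpM2l.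
have F3 : e * `|s *: delta_mx 0 k : 'rV[R]_d| <= e * `|h|.
  by rewrite ler_wpM2l// (le_trans ssd).
have -> : (2 * L + 2) * e * `|h| = L * (e * `|h|) + e * `|h| + L * (e * `|h|) + e * `|h| by ring.
rewrite lerD ?lerD//; [exact: le_trans F1|exact: le_trans F2|exact: le_trans F1|exact: le_trans F3].
Qed.

Lemma measurable_line (x : 'rV[R]_d) (k : 'I_d) :
  measurable_fun setT (fun t : measurableTypeR R => x + t *: delta_mx 0 k).
Proof.
apply: measurable_rVP => j; under eq_fun do rewrite !mxE.
apply: (@measurable_funD _ _ _ _ (fun=> x 0 j)); first exact: measurable_cst.
by apply: measurable_funM; [exact: measurable_id|exact: measurable_cst].
Qed.

Lemma measurable_shift (w : 'rV[R]_d) : measurable_fun setT (fun u => w + u).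
Proof.
by apply: continuous_rV_measurable_rV => u; exact: (cvgD (cvg_cst _) cvg_id).
Qed.

(** For fixed slopes, precision and radius, the first set met by a line in the
    direction k is a measurable subset of the line, and almost all its points are
    density points, where approx_step applies. *)
Lemma nearly_approx_null (k : 'I_d) (y1 y2 : 'rV[R]_d) e del x :
  0 < e -> 0 < del ->
  mu [set t | (approx (zero_from k) y1 e del `&` approx (axis k) y2 e del `\`
     \bigcup_p approx (zero_from k.+1) (\row_j if j == k then y2 0 j else y1 0 j)
        ((2 * L + 2) * e) p.+1%:R^-1) (x + t *: delta_mx 0 k)] = 0%E.
Proof.
move=> e0 del0.
set N := (X in [set t | X (x + t *: _)]).
have mN : measurable N.
  apply: measurableD.
    by apply: measurableI; apply: closed_rV_measurable; exact: approx_closed.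
  by apply: bigcupT_measurable => p; apply: closed_rV_measurable; exact: approx_closed.
have mS : measurable [set t : measurableTypeR R |
    approx (zero_from k) y1 e del (x + t *: delta_mx 0 k)].
  rewrite -[X in measurable X]setTI; apply: (measurable_line x k) => //.
  by apply: closed_rV_measurable; exact: approx_closed.
apply/negligibleP.
  by rewrite -[X in measurable X]setTI; exact: (measurable_line x k).
apply: negligibleS (density_approach mS) => t /= [[At Bt] Zt] H.
apply: Zt; have [del' del'0 Hs] := H At _ e0.
have m0 : 0 < Num.min del del' by rewrite lt_min del0.
exists (Num.truncn (Num.min del del')^-1) => //.
apply: (approx_le (lexx _)); last first.
  apply: (approx_step (ltW e0) del0 del'0 Bt) => s /Hs[t' At' tt'].
  exists (t' - t); last by rewrite -addrA -opprD.
  by rewrite -addrA -scalerDl subrKC.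
by rewrite invf_ple ?posrE// ltW// truncnS_gt.
Qed.

(** On a line in the direction k, f is a Lipschitz function of one variable.
    Only the k-th entry of the slope matters on the axis k, whence the constant
    vectors. *)
Lemma axis_approx_null (k : 'I_d) e x : 0 < e ->
  mu [set t | (\bigcap_(p : rat * nat)
    ~` approx (axis k) (const_mx (ratr p.1)) e p.2.+1%:R^-1) (x + t *: delta_mx 0 k)] = 0%E.
Proof.
move=> e0.
set N := (X in [set t | X (x + t *: _)]).
have mN : measurable N.
  rewrite /N -setC_bigcup; apply: measurableC.
  apply: countable_bigcupT_measurable => [|p]; first exact: countableP.
  by apply: closed_rV_measurable; exact: approx_closed.
pose phi t := f (x + t *: delta_mx 0 k).
have phiL s t : `|phi s - phi t| <= L * `|s - t|.
  apply: (le_trans (fL _ _)); rewrite ler_wpM2l//.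
  have -> : x + s *: delta_mx 0 k - (x + t *: delta_mx 0 k) = (s - t) *: delta_mx 0 k.
    by apply/rowP => j; rewrite !mxE; ring.
  by rewrite normrZ ler_piMr// norm_delta.
apply/negligibleP.
  by rewrite -[X in measurable X]setTI; exact: (measurable_line x k).
apply: negligibleS (lipschitz_derivable_ae phiL) => t /= Nt /cvg_ex[/= l].
move=> /cvgrPdist_le/(_ (e / 2)); rewrite divr_gt0// => /(_ isT).
rewrite /dnbhs/= /within/= => /nbhs_ballP[del /= del0 H].
have lt1 : l - e / 2 < l + e / 2 by lra.
have [z] := rat_in_itvoo lt1.
rewrite in_itv/= => /andP[z1 z2].
apply: (Nt (z, Num.truncn (2 / del))) => //= _ [s ->].
have [->|s0] := eqVneq s 0.
  by rewrite scale0r addr0 subrr sub0r normrN /dotv big1 ?normr0 ?mulr0// => j _; rewrite [X in _ * X]mxE mulr0.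
have nde : `|delta_mx 0 k : 'rV[R]_d| = 1.
  apply/le_anti; rewrite norm_delta/=.
  by apply: (le_trans _ (rV_norm_coord _ k)); rewrite mxE !eqxx normr1.
rewrite normrZ nde mulr1 => sdel.
have {}sdel : `|s| < del.
  apply: (le_lt_trans sdel); rewrite invf_plt ?posrE//.
  apply: (@lt_trans _ _ (2 / del)); last exact: truncnS_gt.
  by rewrite -[ltLHS]mul1r ltr_pM2r ?invr_gt0// ltr1n.
have := H s; rewrite /ball/= sub0r normrN => /(_ sdel s0).
rewrite dotvZr dotv_delta mxE /GRing.scale/= mulr1 => Hs.
have E : f (x + t *: delta_mx 0 k + s *: delta_mx 0 k) = phi (s + t).
  by rewrite /phi -addrA -scalerDl (addrC t).
rewrite E -/(phi t).
have s_gt0 : 0 < `|s| by rewrite normr_gt0.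
have -> : phi (s + t) - phi t - s * ratr z =
    s * ((l - ratr z) - (l - s^-1 * (phi (s + t) - phi t))).
  rewrite [RHS]mulrBr [X in _ = _ - X]mulrBr mulVKf//; ring.
rewrite normrM mulrC ler_wpM2r// (le_trans (ler_normB _ _))//.
rewrite [e in leRHS]splitr lerD// ler_norml; lra.
Qed.

(** Differentiability along the first k coordinates, with slopes and radii taken
    in countable sets so that the exceptional sets of the induction step are
    countable unions. *)
Definition nearly k (x : 'rV[R]_d) := forall n : nat, exists p : 'rV[rat]_d * nat,
  approx (zero_from k) (map_mx ratr p.1) n.+1%:R^-1 p.2.+1%:R^-1 x.

Lemma ae_nearly (a : R) (a0 : 0 < a) (w : 'rV[R]_d) (k : nat) : (k <= d)%N ->
  {ae uniform_cube a0 d, forall u, nearly k (w + u)}.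
Proof.
have inv0 n : 0 < n.+1%:R^-1 :> R by rewrite invr_gt0.
elim: k => [_|k IH kd].
  apply: aeW => u /= n; exists (0, 0%N) => h h0 _.
  have -> : h = 0 by apply/rowP => j; rewrite h0// mxE.
  by rewrite addr0 subrr sub0r normrN normr0 mulr0 /dotv big1 ?normr0 ?mulr0// => j _; rewrite [X in _ * X]mxE mulr0.
have {}IH := IH (ltnW kd); pose K := Ordinal kd.
(* The index q holds a slope for the first k coordinates, a slope for the
   k-th axis, a precision and a radius. NS q is the set where both expansions
   hold but not the joint one. *)
pose NS (q : 'rV[rat]_d * rat * nat * nat) : set 'rV[R]_d :=
  approx (zero_from K) (map_mx ratr q.1.1.1) q.1.2.+1%:R^-1 q.2.+1%:R^-1 `&`
  approx (axis K) (const_mx (ratr q.1.1.2)) q.1.2.+1%:R^-1 q.2.+1%:R^-1 `\`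
  \bigcup_p approx (zero_from K.+1)
     (\row_j if j == K then (const_mx (ratr q.1.1.2) : 'rV[R]_d) 0 j
              else (map_mx ratr q.1.1.1 : 'rV[R]_d) 0 j)
     ((2 * L + 2) * q.1.2.+1%:R^-1) p.+1%:R^-1.
pose DS (n : nat) : set 'rV[R]_d := \bigcap_(p : rat * nat)
    ~` approx (axis K) (const_mx (ratr p.1)) n.+1%:R^-1 p.2.+1%:R^-1.
have shiftP (N : set 'rV[R]_d) : measurable N ->
    (forall x, mu [set t | N (x + t *: delta_mx 0 K)] = 0%E) ->
    {ae uniform_cube a0 d, forall u, ~ N (w + u)}.
  move=> mN N0.
  have mN' : measurable ((fun u => w + u) @^-1` N).
    by rewrite -[X in measurable X]setTI; exact: (measurable_shift w).
  exists ((fun u => w + u) @^-1` N); split => //.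
    apply: (uniform_cube_null_lines _ (k := K)) => // x.
    by rewrite -(N0 (w + x)); congr (mu _); apply/funext => t /=; rewrite addrA.
  by move=> u /= /contrapT.
have aeN : {ae uniform_cube a0 d, forall u, forall q, ~ NS q (w + u)}.
  apply: ae_forall_count => q; apply: shiftP; last by move=> x; exact: nearly_approx_null.
  apply: measurableD.
    by apply: measurableI; apply: closed_rV_measurable; exact: approx_closed.
  by apply: bigcupT_measurable => p; apply: closed_rV_measurable; exact: approx_closed.
have aeD : {ae uniform_cube a0 d, forall u, forall n, ~ DS n (w + u)}.
  apply: ae_forall_count => n; apply: shiftP; last by move=> x; exact: axis_approx_null.
  rewrite /DS -setC_bigcup; apply: measurableC.
  apply: countable_bigcupT_measurable => [|p]; first exact: countableP.
  by apply: closed_rV_measurable; exact: approx_closed.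
apply: filterS3 IH aeN aeD => u /= IH nN nD n.
(* approx_step multiplies the precision by 2 L + 2. *)
pose n' := Num.truncn ((2 * L + 2) * n.+1%:R).
have [p Hp] := IH n'.
have [q Hq] : exists q : rat * nat, approx (axis K) (const_mx (ratr q.1)) n'.+1%:R^-1 q.2.+1%:R^-1 (w + u).
  by apply: contrapT => nex; apply: (nD n') => q _ Hq; apply: nex; exists q.
have invle i j : (i <= j)%N -> j.+1%:R^-1 <= i.+1%:R^-1 :> R.
  by move=> ij; rewrite lef_pV2 ?posrE// ler_nat.
have Hp' := approx_le (lexx _) (invle _ _ (leq_maxl p.2 q.2)) Hp.
have Hq' := approx_le (lexx _) (invle _ _ (leq_maxr p.2 q.2)) Hq.
have := nN (p.1, q.1, n', maxn p.2 q.2).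
rewrite /NS/= -[X in ~ X]/(_ /\ _) => /not_andP[[]//|/contrapT[r _ Hr]].
exists (\row_j (if j == K then q.1 else p.1 0 j), r) => /=.
have -> : map_mx ratr (\row_j (if j == K then q.1 else p.1 0 j)) =
  (\row_j if j == K then (const_mx (ratr q.1) : 'rV[R]_d) 0 j
              else (map_mx ratr p.1 : 'rV[R]_d) 0 j).
  by apply/rowP => j; rewrite !mxE; case: eqP.
apply: approx_le Hr => //.
rewrite ler_pdivrMr// ler_pdivlMl// mulrC ltW//; exact: truncnS_gt.
Qed.

(** The slopes of increasing precision form a Cauchy sequence; their limit is
    the differential. *)
Lemma nearly_differentiable (x : 'rV[R]_d) : nearly d x -> differentiable f x.
Proof.
move=> nx.
have dotE (y : 'rV[R]_d) : linear (dotv y : 'rV[R]_d -> R^o).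
  by move=> c u v; rewrite dotvDr dotvZr.
pose inv (n : nat) : R := n.+1%:R^-1.
have inv0 n : 0 < inv n by rewrite invr_gt0.
have /choice[p Hp] := nx.
pose y n : 'rV[R]_d := map_mx ratr (p n).1.
pose del n : R := (p n).2.+1%:R^-1.
have del0 n : 0 < del n by rewrite invr_gt0.
have allD h : zero_from d h by move=> j; rewrite leqNgt ltn_ord.
have {}Hp n h : `|h| <= del n -> `|f (x + h) - f x - dotv (y n) h| <= inv n * `|h|.
  by move=> hd; apply: Hp.
have yy n m j : y n 0 j - inv n <= y m 0 j + inv m.
  pose t := Num.min (del n) (del m).
  have t0 : 0 < t by rewrite lt_min !del0.
  have tj : `|t *: delta_mx 0 j : 'rV[R]_d| <= t.
    by rewrite normrZ gtr0_norm// ler_piMr ?norm_delta// ltW.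
  have tn : t <= del n by rewrite ge_min lexx.
  have tm : t <= del m by rewrite ge_min lexx orbT.
  have := Hp n _ (le_trans tj tn); have := Hp m _ (le_trans tj tm).
  rewrite !dotvZr !dotv_delta => Hm Hn.
  have {}Hm := le_trans Hm (ler_wpM2l (ltW (inv0 m)) tj).
  have {}Hn := le_trans Hn (ler_wpM2l (ltW (inv0 n)) tj).
  rewrite -(ler_pM2l t0) mulrBr mulrDr.
  move: Hm Hn; rewrite !ler_norml => /andP[Hm1 Hm2] /andP[Hn1 Hn2].
  by rewrite (mulrC t (inv n)) (mulrC t (inv m)); lra.
(* The limit of the slopes, as the supremum of their lower estimates. *)
pose z : 'rV[R]_d := \row_j sup [set r | exists n, r = y n 0 j - inv n].
have zn n j : `|y n 0 j - z 0 j| <= inv n.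
  rewrite [z 0 j]mxE; set S := (X in sup X).
  have ubS m : ubound S (y m 0 j + inv m) by move=> _ [k ->]; exact: yy.
  have hS : has_sup S.
    by split; [exists (y 0%N 0 j - inv 0%N), 0%N|exists (y 0%N 0 j + inv 0%N); exact: ubS].
  rewrite ler_distl; apply/andP; split.
    rewrite lerBlDr; apply: ge_sup; last exact: ubS.
    by exists (y 0%N 0 j - inv 0%N), 0%N.
  rewrite -lerBlDr; apply: ub_le_sup; first by case: hS.
  by exists n.
have dotz n h : `|dotv (y n) h - dotv z h| <= d%:R * inv n * `|h|.
  rewrite /dotv -sumrB (le_trans (ler_norm_sum _ _ _))//.
  have -> : d%:R * inv n * `|h| = \sum_(j < d) (inv n * `|h|).
    by rewrite sumr_const card_ord -mulrA mulr_natl.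
  apply: ler_sum => j _; rewrite -mulrBl normrM.
  by apply: ler_pM => //; exact: rV_norm_coord.
pose zL := GRing.isLinear.Build R 'rV[R]_d R^o *:%R (dotv z) (dotE z).
pose Z : {linear 'rV[R]_d -> R^o} := HB.pack (dotv z) zL.
have cZ : continuous Z.
  apply: (@lipschitzV_continuous _ _ (\sum_j `|z 0 j|)) => u v.
  have -> : Z u - Z v = dotv z (u - v).
    by rewrite dotvBr.
  rewrite (le_trans (ler_norm_sum _ _ _))// mulr_suml; apply: ler_sum => j _.
  by rewrite normrM ler_wpM2l//; exact: rV_norm_coord.
have fZ : f \o shift x = cst (f x) + Z +o_ (0 : 'rV[R]_d) id.
  apply/eqaddoP => e e0.
  pose n := Num.truncn ((1 + d%:R) / e).
  have ne : (1 + d%:R) * inv n <= e.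
    by rewrite ler_pdivrMr// -ler_pdivrMl// mulrC ltW//; exact: truncnS_gt.
  apply/nbhs_ballP; exists (del n) => //= h; rewrite mx_norm_ball/ball_/= sub0r normrN => hd.
  have -> : (f \o shift x - (cst (f x) + Z)) h =
      (f (x + h) - f x - dotv (y n) h) + (dotv (y n) h - dotv z h).
    rewrite -[LHS]/(f (h + x) - (f x + dotv z h)) (addrC h); ring.
  apply: (le_trans (ler_normD _ _)).
  apply: (le_trans (lerD (Hp n h (ltW hd)) (dotz n h))).
  by rewrite -mulrDl ler_wpM2r// -[X in X + _]mul1r -mulrDl.
have dE := diff_unique cZ fZ.
apply/diff_locallyP; split; first by rewrite dE.
by rewrite dE.
Qed.

(** Stated for the law of the cube around w, the only one over which f is
    averaged here. *)
Theorem rademacher (a : R) (a0 : 0 < a) (w : 'rV[R]_d) :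
  {ae uniform_cube a0 d, forall u, differentiable f (w + u)}.
Proof.
by apply: filterS (ae_nearly a0 w (leqnn d)) => u /=; exact: nearly_differentiable.
Qed.

End main.
End Rademacher.

(** * Euclidean geometry and gradients *)

Section Euclid.
Context {R : realType} {d : nat}.
Implicit Types (u v w x y : 'rV[R]_d).

Lemma dotvC u v : dotv u v = dotv v u.
Proof. by apply: eq_bigr => j _; rewrite mulrC. Qed.

Lemma dotvZl u v t : dotv (t *: u) v = t * dotv u v.
Proof. by rewrite dotvC dotvZr dotvC. Qed.

Lemma dotvDl u v w : dotv (u + v) w = dotv u w + dotv v w.
Proof. by rewrite dotvC dotvDr !(dotvC w). Qed.

Lemma dotvBl u v w : dotv (u - v) w = dotv u w - dotv v w.
Proof. by rewrite dotvC dotvBr !(dotvC w). Qed.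

Lemma l2norm_ge0 v : 0 <= l2norm v. Proof. exact: sqrtr_ge0. Qed.

Lemma l2normE v : l2norm v ^+ 2 = dotv v v.
Proof.
rewrite sqr_sqrtr; first by apply: eq_bigr => j _; rewrite expr2.
by apply: sumr_ge0 => j _; rewrite sqr_ge0.
Qed.

Lemma dotv_ge0 v : 0 <= dotv v v. Proof. by rewrite -l2normE sqr_ge0. Qed.

Lemma dotv_le_sqr u v : dotv u v <= (l2norm u ^+ 2 + l2norm v ^+ 2) / 2.
Proof.
have := dotv_ge0 (u - v); rewrite !l2normE dotvBl !dotvBr (dotvC v u); lra.
Qed.

(** dotv_le_sqr for the normalised vectors. *)
Lemma cauchy_schwarz u v : dotv u v <= l2norm u * l2norm v.
Proof.
have [u0|u0] := eqVneq (l2norm u) 0.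
  rewrite u0 mul0r /dotv big1// => j _.
  have : dotv u u = 0 by rewrite -l2normE u0 expr0n.
  move=> /eqP; rewrite psumr_eq0 => [/allP/(_ j)|i _]; last by rewrite -expr2 sqr_ge0.
  by rewrite mem_index_enum mulf_eq0 orbb => /(_ isT)/eqP ->; rewrite mul0r.
have [v0|v0] := eqVneq (l2norm v) 0.
  rewrite v0 mulr0 /dotv big1// => j _.
  have : dotv v v = 0 by rewrite -l2normE v0 expr0n.
  move=> /eqP; rewrite psumr_eq0 => [/allP/(_ j)|i _]; last by rewrite -expr2 sqr_ge0.
  by rewrite mem_index_enum mulf_eq0 orbb => /(_ isT)/eqP ->; rewrite mulr0.
have {}u0 : 0 < l2norm u by rewrite lt_def u0 l2norm_ge0.
have {}v0 : 0 < l2norm v by rewrite lt_def v0 l2norm_ge0.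
have := dotv_le_sqr ((l2norm u)^-1 *: u) ((l2norm v)^-1 *: v).
rewrite !l2normE !dotvZl !dotvZr -!l2normE.
have -> : ((l2norm u)^-1 * ((l2norm u)^-1 * l2norm u ^+ 2) +
   (l2norm v)^-1 * ((l2norm v)^-1 * l2norm v ^+ 2)) / 2 = 1.
  by field; rewrite !gt_eqF.
by rewrite mulrA -invfM ler_pdivrMl ?mulr_gt0// mulr1.
Qed.

Lemma l2normN v : l2norm (- v) = l2norm v.
Proof. by rewrite /l2norm; under eq_bigr do rewrite mxE sqrrN. Qed.

Lemma l2normZ t v : l2norm (t *: v) = `|t| * l2norm v.
Proof.
apply/eqP; rewrite -(@eqrXn2 _ 2)// ?mulr_ge0 ?l2norm_ge0//.
by rewrite exprMn !l2normE dotvZl dotvZr mulrA -expr2 real_normK// num_real.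
Qed.

Lemma l2norm_le_sqr v c : 0 <= c -> (l2norm v <= c) = (dotv v v <= c ^+ 2).
Proof. by move=> c0; rewrite -l2normE ler_pXn2r// ?nnegrE// l2norm_ge0. Qed.

Lemma coord_le_l2norm v j : `|v 0 j| <= l2norm v.
Proof.
rewrite -(@ler_pXn2r _ 2)// ?nnegrE ?l2norm_ge0// l2normE real_normK ?num_real//.
rewrite /dotv (bigD1 j)//= -expr2 lerDl sumr_ge0// => i _.
by rewrite -expr2 sqr_ge0.
Qed.

Lemma norm_le_l2norm v : `|v| <= l2norm v.
Proof. by apply: rV_norm_le; [exact: l2norm_ge0|exact: coord_le_l2norm]. Qed.

Lemma l2norm_le_coord v c : 0 <= c -> (forall j, `|v 0 j| <= c) ->
  l2norm v <= Num.sqrt d%:R * c.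
Proof.
move=> c0 vc; rewrite l2norm_le_sqr; last by rewrite mulr_ge0// sqrtr_ge0.
rewrite exprMn sqr_sqrtr// mulr_natl.
rewrite /dotv -[X in _ *+ X](card_ord d) -sumr_const; apply: ler_sum => j _.
by rewrite -expr2 -real_normK ?num_real// ler_pXn2r// nnegrE.
Qed.

Lemma l2norm_le_norm v : l2norm v <= Num.sqrt d%:R * `|v|.
Proof. by apply: l2norm_le_coord => // j; exact: rV_norm_coord. Qed.

Lemma l2norm_delta (k : 'I_d) : l2norm (delta_mx 0 k : 'rV[R]_d) = 1.
Proof.
apply/eqP; rewrite -(@eqrXn2 _ 2)// ?l2norm_ge0// l2normE dotv_delta mxE !eqxx.
by rewrite expr1n.
Qed.

Section lip.
Variables (f : 'rV[R]_d -> R) (L : R).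
Hypothesis L0 : 0 <= L.
Hypothesis fL : forall x y, `|f x - f y| <= L * l2norm (x - y).

Lemma lipschitz2_sup x y : `|f x - f y| <= (L * Num.sqrt d%:R) * `|x - y|.
Proof. by rewrite (le_trans (fL x y))// -mulrA ler_wpM2l// l2norm_le_norm. Qed.

Lemma lipschitz2_continuous : continuous f.
Proof. exact: lipschitzV_continuous lipschitz2_sup. Qed.

Lemma derive_lipschitz x v : derivable f x v -> `|'D_v f x| <= L * l2norm v.
Proof.
move=> dfv; apply: (cvgr_to_le (cvg_norm dfv)).
near=> h.
have h0 : h != 0 by near: h; exact: nbhs_dnbhs_neq.
rewrite /GRing.scale/= normrM normfV ler_pdivrMl ?normr_gt0//.
by rewrite (le_trans (fL _ _))// addrK l2normZ mulrCA.
Unshelve. all: by end_near. Qed.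

Lemma grad_lipschitz x : (forall v, derivable f x v) ->
  (forall v, 'D_v f x = dotv (grad f x) v) -> l2norm (grad f x) <= L.
Proof.
move=> df dfE; have := derive_lipschitz (df (grad f x)).
rewrite dfE -l2normE ger0_norm ?sqr_ge0// expr2.
have [->//|g0] := eqVneq (l2norm (grad f x)) 0.
by rewrite ler_pM2r// lt_def g0 l2norm_ge0.
Qed.

End lip.

Lemma derive_grad (f : 'rV[R]_d -> R) x v : differentiable f x ->
  'D_v f x = dotv (grad f x) v.
Proof.
move=> df; rewrite deriveE// [in LHS](row_sum_delta v) linear_sum/=.
by apply: eq_bigr => j _; rewrite linearZ/= mxE deriveE// mulrC.
Qed.

End Euclid.

(** * Integrals of real functions for a probability *)

Section RealIntegrals.
Context (dT : measure_display) (T : measurableType dT) (R : realType).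
Variable P : probability T R.

Lemma ae_bounded_integrable (h : T -> R) (M : R) : measurable_fun setT h ->
  {ae P, forall x, `|h x| <= M} -> P.-integrable setT (EFin \o h).
Proof.
move=> mh hM; apply/integrableP; split; first exact/measurable_EFinP.
apply: (@le_lt_trans _ _ (\int[P]_x (`|M|%:E))%E); last first.
  by rewrite integral_cst//= probability_setT mule1 ltry.
apply: ae_ge0_le_integral => //.
- by apply/measurable_EFinP; exact: measurableT_comp.
- apply: filterS hM => x hx _; rewrite /= lee_fin (le_trans hx)//; exact: ler_norm.
Qed.

Lemma bounded_integrable (h : T -> R) (M : R) : measurable_fun setT h ->
  (forall x, `|h x| <= M) -> P.-integrable setT (EFin \o h).
Proof. by move=> mh hM; apply: ae_bounded_integrable mh _; exact: aeW. Qed.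

Lemma Rintegral_cst_prob (c : R) : \int[P]_x c = c.
Proof. by rewrite Rintegral_cst//= probability_setT mulr1. Qed.

(** The real integral is a truncation of the extended one, so the difference is
    replaced by its positive part before comparing. *)
Lemma ae_le_Rintegral (h1 h2 : T -> R) :
  P.-integrable setT (EFin \o h1) -> P.-integrable setT (EFin \o h2) ->
  {ae P, forall x, h1 x <= h2 x} -> \int[P]_x h1 x <= \int[P]_x h2 x.
Proof.
move=> i1 i2 h12; rewrite -subr_ge0 -RintegralB//.
have m1 := measurable_int _ i1; have m2 := measurable_int _ i2.
rewrite /Rintegral fine_ge0//.
have -> : (\int[P]_x (h2 x - h1 x)%:E = \int[P]_x (Num.max 0 (h2 x - h1 x))%:E)%E.
  apply: ae_eq_integral => //.
  - by apply/measurable_EFinP; apply: measurable_funB; exact/measurable_EFinP.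
  - apply/measurable_EFinP; apply: measurable_maxr => //.
    by apply: measurable_funB; exact/measurable_EFinP.
  - apply: filterS h12 => x h12 _; congr EFin; apply/esym/max_idPr.
    by rewrite subr_ge0.
by apply: integral_ge0 => x _; rewrite lee_fin le_max lexx.
Qed.

Lemma ae_le_integrable (h1 h2 : T -> R) : measurable_fun setT h1 ->
  P.-integrable setT (EFin \o h2) -> {ae P, forall x, `|h1 x| <= h2 x} ->
  P.-integrable setT (EFin \o h1).
Proof.
move=> m1 i2 h12; have [m2 f2] := integrableP _ _ _ i2.
apply/integrableP; split; first exact/measurable_EFinP.
apply: le_lt_trans f2; apply: ae_ge0_le_integral => //.
- by apply/measurable_EFinP; exact: measurableT_comp.
- by apply: measurableT_comp m2.
- apply: filterS h12 => x hx _; rewrite /= lee_fin (le_trans hx)//; exact: ler_norm.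
Qed.

Lemma integrable_lin (h1 h2 : T -> R) (c : R) :
  P.-integrable setT (EFin \o h1) -> P.-integrable setT (EFin \o h2) ->
  P.-integrable setT (EFin \o (fun x => h1 x + c * h2 x)).
Proof.
move=> i1 i2; have := integrableD measurableT i1 (integrableZl measurableT c i2).
exact: eq_integrable.
Qed.

Lemma Rintegral_lin (h1 h2 : T -> R) (c : R) :
  P.-integrable setT (EFin \o h1) -> P.-integrable setT (EFin \o h2) ->
  \int[P]_x (h1 x + c * h2 x) = \int[P]_x h1 x + c * \int[P]_x h2 x.
Proof.
move=> i1 i2; have i3 : P.-integrable setT (EFin \o (fun x => c * h2 x)).
  by have := integrableZl measurableT c i2; apply: eq_integrable.
by rewrite RintegralD// RintegralZl.
Qed.

Lemma integrable_sum_real (I : Type) (s : seq I) (h : I -> T -> R) :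
  (forall i, P.-integrable setT (EFin \o h i)) ->
  P.-integrable setT (EFin \o (fun x => \sum_(i <- s) h i x)).
Proof.
move=> ih; elim: s => [|i s IH].
  by rewrite /comp; under eq_fun do rewrite big_nil; exact: integrable0.
rewrite /comp; under eq_fun do rewrite big_cons EFinD.
by apply: integrableD => //; exact: ih.
Qed.

Lemma Rintegral_sum (I : Type) (s : seq I) (h : I -> T -> R) :
  (forall i, P.-integrable setT (EFin \o h i)) ->
  \int[P]_x (\sum_(i <- s) h i x) = \sum_(i <- s) \int[P]_x h i x.
Proof.
move=> ih; elim: s => [|i s IH].
  by under eq_Rintegral do rewrite big_nil; rewrite big_nil Rintegral_cst_prob.
under eq_Rintegral do rewrite big_cons.
by rewrite big_cons RintegralD// ?IH//; exact: integrable_sum_real.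
Qed.

(** An infinite integral of the positive or of the negative part would make the
    integral of h infinite, since oo - oo is read as -oo. *)
Lemma fin_integral_integrable (h : T -> R) (c : R) : measurable_fun setT h ->
  (\int[P]_x (h x)%:E = c%:E)%E -> P.-integrable setT (EFin \o h).
Proof.
move=> mh hc.
have mE : measurable_fun setT (EFin \o h) by exact/measurable_EFinP.
apply/integrableP; split => //.
have -> : (\int[P]_x `|(EFin \o h) x| = \int[P]_x ((EFin \o h) ^\+ x) +
    \int[P]_x ((EFin \o h) ^\- x))%E.
  rewrite -ge0_integralD//; last 2 first.
  - exact: measurable_funepos.
  - exact: measurable_funeneg.
  by apply: eq_integral => x _; rewrite -[in LHS]/((abse \o (EFin \o h)) x) fune_abse.
have {}hc : (\int[P]_x (EFin \o h) x = c%:E)%E by exact: hc.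
move: hc; rewrite integralE.
have p0 : (0 <= \int[P]_x ((EFin \o h) ^\+ x))%E by exact: integral_ge0.
have n0 : (0 <= \int[P]_x ((EFin \o h) ^\- x))%E by exact: integral_ge0.
case: (\int[P]_x _)%E p0 => [r| |] // _; case: (\int[P]_x _)%E n0 => [s| |] // _ _.
by rewrite -EFinD ltry.
Qed.

End RealIntegrals.

(** * The smoothed function and its gradient *)

Lemma cvg_dnbhs_seq (R : realType) (t_ : nat -> R) : (forall n, t_ n != 0) ->
  t_ n @[n --> \oo] --> 0 -> t_ n @[n --> \oo] --> 0^'.
Proof.
move=> tn0 t0 A dA.
have H : \forall n \near \oo, t_ n != 0 -> A (t_ n) by exact: t0 _ dA.
by apply: filterS H => n; apply.
Qed.

Section Smoothing.
Context {R : realType} {d : nat}.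
Variables (f : 'rV[R]_d -> R) (L : R).
Hypothesis L0 : 0 <= L.
Hypothesis fL : forall x y, `|f x - f y| <= L * l2norm (x - y).
Variables (a : R) (a0 : 0 < a).
Local Notation P := (uniform_cube a0 d).
Local Notation fa := (smoothing a0 f).

Let cf : continuous f. Proof. exact: lipschitz2_continuous L0 fL. Qed.

Lemma measurable_translate w : measurable_fun setT (fun u : 'rV[R]_d => f (w + u)).
Proof.
apply: continuous_rV_measurable => u.
apply: (@continuous_comp _ _ _ (fun u => w + u) f); last exact: cf.
exact: (cvgD (cvg_cst _) cvg_id).
Qed.

Lemma integrable_translate w : P.-integrable setT (EFin \o (fun u => f (w + u))).
Proof.
apply: (@ae_bounded_integrable _ _ _ _ _ (`|f w| + L * (Num.sqrt d%:R * a))).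
  exact: measurable_translate.
apply: filterS (uniform_cube_support a0 d) => u ua.
have -> : f (w + u) = f w + (f (w + u) - f w) by ring.
rewrite (le_trans (ler_normD _ _))// lerD2l (le_trans (fL _ _))// ler_wpM2l//.
rewrite addrC addKr (le_trans (l2norm_le_norm _))// ler_wpM2l// sqrtr_ge0.
Qed.

Lemma smoothingE w : fa w = \int[P]_u f (w + u).
Proof. by rewrite /smoothing unlock. Qed.

Lemma smoothing_lipschitz x y : `|fa x - fa y| <= L * l2norm (x - y).
Proof.
rewrite !smoothingE -RintegralB//; [|exact: integrable_translate..].
have ib : P.-integrable setT (EFin \o (fun u => f (x + u) - f (y + u))).
  apply: (@bounded_integrable _ _ _ _ _ (L * l2norm (x - y))).
    by apply: measurable_funB; exact: measurable_translate.
  by move=> u; rewrite (le_trans (fL _ _))// opprD addrACA subrr addr0.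
rewrite (le_trans (le_normr_Rintegral _ _))//.
rewrite -[leRHS](Rintegral_cst_prob P) le_Rintegral//.
- exact: integrable_norm.
- by apply: finite_measure_integrable_cst.
- by move=> u _; rewrite (le_trans (fL _ _))// opprD addrACA subrr addr0.
Qed.

Lemma smoothing_ge0 w : (forall x, 0 <= f x) -> 0 <= fa w.
Proof. by move=> f0; rewrite smoothingE Rintegral_ge0. Qed.

Lemma smoothing_le w : fa w <= f w + L * (Num.sqrt d%:R * a).
Proof.
rewrite smoothingE -[leRHS](Rintegral_cst_prob P).
apply: ae_le_Rintegral; first exact: integrable_translate.
  exact: finite_measure_integrable_cst.
apply: filterS (uniform_cube_support a0 d) => u ua.
rewrite -lerBlDl (le_trans (ler_norm _))// (le_trans (fL _ _))// ler_wpM2l//.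
by rewrite addrC addKr (le_trans (l2norm_le_norm _))// ler_wpM2l// sqrtr_ge0.
Qed.

(** The gradient of f exists only almost everywhere; the upper limit of the
    difference quotients along 1 / (n + 1) is a version of it that is measurable
    everywhere. *)
Lemma grad_field w : exists2 g : 'I_d -> 'rV[R]_d -> R,
  (forall j, measurable_fun setT (g j)) &
  {ae P, forall u, differentiable f (w + u) /\ forall j, g j u = grad f (w + u) 0 j}.
Proof.
pose q (j : 'I_d) n u := (n.+1%:R^-1 : R)^-1 *
  (f (n.+1%:R^-1 *: delta_mx 0 j + (w + u)) - f (w + u)).
exists (fun j u => fine (limn_esup (fun n => (q j n u)%:E))).
  move=> j; apply: measurableT_comp => //.
  apply: (@measurable_fun_limn_esup _ _ _ _ (fun n u => (q j n u)%:E)) => n.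
  apply/measurable_EFinP; apply: measurable_funM => //.
  apply: measurable_funB; last exact: measurable_translate.
  by under eq_fun do rewrite addrA; exact: measurable_translate.
have := rademacher (mulr_ge0 L0 (sqrtr_ge0 d%:R)) (lipschitz2_sup L0 fL) a0 w.
apply: filterS => u du; split => // j.
rewrite [RHS]mxE.
have cv : q j n u @[n --> \oo] --> 'D_(delta_mx 0 j) f (w + u).
  have H : (n.+1%:R^-1 : R) @[n --> \oo] --> 0^'.
    by apply: cvg_dnbhs_seq; [move=> n; rewrite invr_eq0 pnatr_eq0|exact: cvg_harmonic].
  exact: (cvg_comp _ _ H (@diff_derivable _ _ _ _ _ (delta_mx 0 j) du)).
have cvE : (q j n u)%:E @[n --> \oo] --> ('D_(delta_mx 0 j) f (w + u))%:E.
  by apply: cvg_EFin; [exact: nearW|exact: cv].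
by have [_ ->] := cvg_limn_einf_sup cvE.
Qed.

(** Dominated convergence: the difference quotients of f in the direction v are
    bounded by L |v|. *)
Lemma smoothing_diffquot w (g : 'I_d -> 'rV[R]_d -> R) v (t_ : nat -> R) :
  (forall j, measurable_fun setT (g j)) ->
  {ae P, forall u, differentiable f (w + u) /\ forall j, g j u = grad f (w + u) 0 j} ->
  (forall n, t_ n != 0) -> t_ n @[n --> \oo] --> 0 ->
  (t_ n)^-1 * (fa (t_ n *: v + w) - fa w) @[n --> \oo] -->
    \int[P]_u (\sum_j g j u * v 0 j).
Proof.
move=> mg gE tn0 t0.
pose q n u := (t_ n)^-1 * (f (t_ n *: v + w + u) - f (w + u)).
have mq n : measurable_fun setT (q n).
  apply: measurable_funM => //.
  by apply: measurable_funB; exact: measurable_translate.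
have mG : measurable_fun setT (fun u => \sum_j g j u * v 0 j).
  by apply: measurable_sum => j; apply: measurable_funM.
have qb n u : `|q n u| <= L * l2norm v.
  rewrite /q normrM normfV ler_pdivrMl ?normr_gt0//.
  rewrite (le_trans (fL _ _))// -[_ + w + u]addrA addrK l2normZ mulrCA//.
have qG : {ae P, forall u, [set: 'rV[R]_d] u ->
    (q n u)%:E @[n --> \oo] --> (\sum_j g j u * v 0 j)%:E}.
  apply: filterS gE => u [du gu] _; apply: cvg_EFin; first exact: nearW.
  have -> : \sum_j g j u * v 0 j = 'D_v f (w + u).
    by rewrite derive_grad//; apply: eq_bigr => j _; rewrite gu.
  rewrite (_ : fine \o _ = (fun n => (t_ n)^-1 *:
      ((f \o shift (w + u)) (t_ n *: v) - f (w + u)))); last first.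
    by apply/funext => n; rewrite /q /= addrA.
  exact: (cvg_comp _ _ (cvg_dnbhs_seq tn0 t0) (@diff_derivable _ _ _ _ _ v du)).
have [|||iG _ H] := dominated_convergence measurableT _ _ qG
   (finite_measure_integrable_cst P (L * l2norm v) measurableT) _.
- by move=> n; apply/measurable_EFinP.
- exact/measurable_EFinP.
- by apply: aeW => u n _; rewrite lee_fin.
have qE n : \int[P]_u q n u = (t_ n)^-1 * (fa (t_ n *: v + w) - fa w).
  rewrite !smoothingE -RintegralB//; [|exact: integrable_translate..].
  rewrite RintegralZl//; apply: (@bounded_integrable _ _ _ _ _ (`|t_ n| * (L * l2norm v))).
    by apply: measurable_funB; exact: measurable_translate.
  by move=> u; rewrite (le_trans (fL _ _))// -[_ + w + u]addrA addrK l2normZ mulrCA.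
under eq_fun do rewrite -qE.
apply: fine_cvg; rewrite fineK; last exact: integrable_fin_num.
exact: H.
Qed.

End Smoothing.

Section SmoothingGradient.
Context {R : realType} {d : nat}.
Variables (f : 'rV[R]_d -> R) (L : R).
Hypothesis L0 : 0 <= L.
Hypothesis fL : forall x y, `|f x - f y| <= L * l2norm (x - y).
Variables (a : R) (a0 : 0 < a).
Local Notation P := (uniform_cube a0 d).
Local Notation fa := (smoothing a0 f).

Lemma smoothing_is_derive w (g : 'I_d -> 'rV[R]_d -> R) v :
  (forall j, measurable_fun setT (g j)) ->
  {ae P, forall u, differentiable f (w + u) /\ forall j, g j u = grad f (w + u) 0 j} ->
  is_derive w v fa (\int[P]_u (\sum_j g j u * v 0 j)).
Proof.
move=> mg gE; set l := (\int[P]_u _).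
pose q (h : R) : R := h^-1 * (fa (h *: v + w) - fa w).
have cv : q h @[h --> 0^'] --> l.
  apply: (@cvg_at_right_left_dnbhs _ R^o).
    apply/cvg_at_rightP => t [tn0 t0]; apply: (smoothing_diffquot L0 fL mg gE _ t0).
    by move=> n; rewrite gt_eqF.
  apply/cvg_at_leftP => t [tn0 t0]; apply: (smoothing_diffquot L0 fL mg gE _ t0).
  by move=> n; rewrite lt_eqF.
split; last exact/cvg_lim.
by apply/cvg_ex; exists l.
Qed.

Lemma ae_grad_bounded w : {ae P, forall u, differentiable f (w + u) ->
  l2norm (grad f (w + u)) <= L}.
Proof.
apply: aeW => u /= du; apply: (grad_lipschitz L0 fL) => v; last exact: derive_grad.
exact: diff_derivable.
Qed.

(** The smoothing is known so far to have directional derivatives, one direction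
    at a time; as integrals of <grad f (w + u), v> they are linear in v, and the
    basis vectors identify the coefficients. *)
Lemma smoothing_derive w :
  (forall v, derivable fa w v) /\
  (forall v, 'D_v fa w = dotv (grad fa w) v).
Proof.
have [g mg gE] := grad_field L0 fL a0 w.
have H := smoothing_is_derive _ mg gE.
split=> v; first exact: (@ex_derive _ _ _ _ _ _ _ (H v)).
rewrite (@derive_val _ _ _ _ _ _ _ (H v)).
have gi j : P.-integrable setT (EFin \o g j).
  apply: (ae_bounded_integrable (mg j) (M := L)).
  apply: filterS2 gE (ae_grad_bounded w) => u /= [du ->] /(_ du) gL.
  exact: le_trans (coord_le_l2norm _ _) gL.
have sumE : \int[P]_u (\sum_j g j u * v 0 j) = \sum_j (\int[P]_u g j u) * v 0 j.
  rewrite Rintegral_sum => [|j]; first by apply: eq_bigr => j _; rewrite RintegralZr.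
  by have := integrableZr measurableT (v 0 j) (gi j); apply: eq_integrable.
rewrite sumE; apply: eq_bigr => j _; congr (_ * _).
rewrite mxE (@derive_val _ _ _ _ _ _ _ (H _)); apply: eq_Rintegral => u _.
transitivity (dotv (\row_i g i u) (delta_mx 0 j)); first by rewrite dotv_delta mxE.
by apply: eq_bigr => i _; rewrite mxE.
Qed.

(** The gradient of the smoothing is the mean of the gradients of f over the
    cube, so it inherits their common affine bounds. *)
Lemma smoothing_grad_ge w x c :
  (forall u, differentiable f (w + u) -> `|u| <= a -> c <= dotv x (grad f (w + u))) ->
  c <= dotv x (grad fa w).
Proof.
move=> xc; have [_ D] := smoothing_derive w.
rewrite dotvC -D.
have [g mg gE] := grad_field L0 fL a0 w.
rewrite (@derive_val _ _ _ _ _ _ _ (smoothing_is_derive x mg gE)).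
rewrite -[leLHS](Rintegral_cst_prob P); apply: ae_le_Rintegral.
- exact: finite_measure_integrable_cst.
- apply: (@ae_bounded_integrable _ _ _ _ _ (\sum_j L * `|x 0 j|)).
    by apply: measurable_sum => j; exact: measurable_funM.
  apply: filterS2 gE (ae_grad_bounded w) => u /= [du gE] /(_ du) gL.
  rewrite (le_trans (ler_norm_sum _ _ _))//; apply: ler_sum => j _.
  by rewrite normrM ler_wpM2r// gE (le_trans (coord_le_l2norm _ _)).
apply: filterS2 gE (uniform_cube_support a0 d) => u /= [du gE] ua.
rewrite (le_trans (xc u du ua))// dotvC.
by apply: ler_sum => j _; rewrite gE.
Qed.

Lemma smoothing_grad_bounded w : l2norm (grad fa w) <= L.
Proof.
have [D1 D2] := smoothing_derive w.
exact: (grad_lipschitz L0 (smoothing_lipschitz L0 fL a0)).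
Qed.

(** The one-sided bound for non-negative functions is applied to B + h and to
    B - h, whose values lie between 0 and 2 B. *)
Lemma cube_shift_bound (h : 'rV[R]_d -> R) B t (j : 'I_d) :
  continuous h -> (forall u, `|h u| <= B) ->
  `|\int[P]_u h (u + t *: delta_mx 0 j) - \int[P]_u h u| <= `|t| * B / a.
Proof.
move=> ch hB.
have mh : measurable_fun setT h by exact: continuous_rV_measurable.
have mht : measurable_fun setT (fun u : 'rV[R]_d => h (u + t *: delta_mx 0 j)).
  apply: continuous_rV_measurable => u.
  apply: (@continuous_comp _ _ _ (fun u : 'rV[R]_d => u + t *: (delta_mx 0 j : 'rV[R]_d)) h); last exact: ch.
  exact: (cvgD cvg_id (cvg_cst _)).
have ih := bounded_integrable P mh hB.
have iht := bounded_integrable P mht (fun=> hB _).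
have key (k : 'rV[R]_d -> R) : measurable_fun setT k ->
    measurable_fun setT (fun u : 'rV[R]_d => k (u + t *: delta_mx 0 j)) -> (forall u, `|k u| <= B) ->
    \int[P]_u k (u + t *: delta_mx 0 j) - \int[P]_u k u <= `|t| * B / a.
  move=> mk mkt kB.
  have ik := bounded_integrable P mk kB.
  have ikt := bounded_integrable P mkt (fun=> kB _).
  have := @ge0_integral_uniform_cube_shift R a a0 (2 * B) t d j (fun u => (k u + B)%:E).
  have -> : `|t| * (2 * B) / (2 * a) = `|t| * B / a by field; rewrite gt_eqF.
  have mkB : measurable_fun setT (fun u => (k u + B)%:E).
    by apply/measurable_EFinP; apply: measurable_funD.
  move=> /(_ mkB) H.
  have {}H := H _.
  have : (\int[P]_u (k (u + t *: delta_mx 0 j) + B)%:E <= \int[P]_u (k u + B)%:E + (`|t| * B / a)%:E)%E.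
    apply: H => u; rewrite !lee_fin; have := kB u; rewrite ler_norml; lra.
  have ic : P.-integrable setT (EFin \o (cst B)) by exact: finite_measure_integrable_cst.
  have i1 : P.-integrable setT (EFin \o (fun u => k (u + t *: delta_mx 0 j) + B)).
    by have := integrableD measurableT ikt ic; apply: eq_integrable => //.
  have i2 : P.-integrable setT (EFin \o (fun u => k u + B)).
    by have := integrableD measurableT ik ic; apply: eq_integrable => //.
  rewrite -[X in (X <= _)%E]fineK; last exact: integrable_fin_num.
  rewrite -[X in (_ <= X + _)%E]fineK; last exact: integrable_fin_num.
  rewrite -EFinD lee_fin -!/(Rintegral _ _ _) !RintegralD//.
  lra.
rewrite ler_norml; apply/andP; split; last exact: key.
have := key (fun u => -1 * h u).
rewrite !RintegralZl//.
have mN (k : 'rV[R]_d -> R) : measurable_fun setT k -> measurable_fun setT (fun u => -1 * k u).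
  by move=> mk; exact: measurable_funM.
move=> /(_ (mN _ mh) (mN _ mht)) H.
have {}H : -1 * (\int[P]_u h (u + t *: delta_mx 0 j)) - -1 * (\int[P]_u h u) <= `|t| * B / a.
  by apply: H => u; rewrite mulN1r normrN.
lra.
Qed.

(** Shifting both w and w' by t e_j amounts to shifting the variable u in the
    mean of u |-> f (w + u) - f (w' + u), a function bounded by L |w - w'|. *)
Lemma smoothing_grad_coord_lipschitz w w' (j : 'I_d) :
  `|grad fa w 0 j - grad fa w' 0 j| <= L * l2norm (w - w') / a.
Proof.
pose B := L * l2norm (w - w').
have B0 : 0 <= B by rewrite mulr_ge0// l2norm_ge0.
have [D1 _] := smoothing_derive w; have [D2 _] := smoothing_derive w'.
rewrite !mxE.
apply: (cvgr_to_le (cvg_norm (cvgB (D1 (delta_mx 0 j)) (D2 (delta_mx 0 j))))).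
near=> t.
have t0 : t != 0 by near: t; exact: nbhs_dnbhs_neq.
rewrite /= /GRing.scale/= -mulrBr normrM normfV ler_pdivrMl ?normr_gt0//.
have cf := lipschitz2_continuous L0 fL.
pose h u := f (w + u) - f (w' + u).
have cw (v : 'rV[R]_d) : continuous (fun u => f (v + u)).
  move=> u; apply: (@continuous_comp _ _ _ (fun u => v + u) f); last exact: cf.
  exact: (cvgD (cvg_cst _) cvg_id).
have ch : continuous h by move=> u; exact: (cvgB (cw w u) (cw w' u)).
have hB u : `|h u| <= B.
  by rewrite (le_trans (fL _ _))// opprD addrACA subrr addr0.
have int2 (v v' : 'rV[R]_d) : \int[P]_u (f (v + u) - f (v' + u)) = fa v - fa v'.
  by rewrite !smoothingE RintegralB//; exact: (integrable_translate L0 fL).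
have E1 : \int[P]_u h u = fa w - fa w' by exact: int2.
have E2 : \int[P]_u h (u + t *: delta_mx 0 j) =
    fa (t *: delta_mx 0 j + w) - fa (t *: delta_mx 0 j + w').
  rewrite -int2; apply: eq_Rintegral => u _.
  by rewrite /h !(addrC u) !addrA !(addrC _ (t *: _)).
have := cube_shift_bound t j ch hB.
rewrite E1 E2 -[_ * B / a]mulrA; apply: le_trans.
rewrite le_eqVlt; apply/orP; left; apply/eqP; congr Num.norm.
rewrite -[LHS]/(fa (t *: delta_mx 0 j + w) - fa w - (fa (t *: delta_mx 0 j + w') - fa w')).
ring.
Unshelve. all: by end_near. Qed.

Lemma smoothing_grad_lipschitz w w' :
  l2norm (grad fa w - grad fa w') <= Num.sqrt d%:R * L / a * l2norm (w - w').
Proof.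
have -> : Num.sqrt d%:R * L / a * l2norm (w - w') =
    Num.sqrt d%:R * (L * l2norm (w - w') / a) by ring.
apply: l2norm_le_coord => [|j].
  by apply: divr_ge0; [apply: mulr_ge0 => //; exact: l2norm_ge0|exact: ltW].
by rewrite [X in `|X|]mxE [X in _ + X]mxE; exact: smoothing_grad_coord_lipschitz.
Qed.

(** Along the segment from w to w + v, the derivative of the left side stays
    below that of the right side. *)
Lemma smoothing_descent w v :
  fa (w + v) <= fa w + dotv (grad fa w) v
     + Num.sqrt d%:R * L / a / 2 * l2norm v ^+ 2.
Proof.
set C := Num.sqrt d%:R * L / a.
have C0 : 0 <= C by apply: divr_ge0; [apply: mulr_ge0 => //; exact: sqrtr_ge0|exact: ltW].
pose phi (s : R) := fa (s *: v + w).
pose p (s : R) := dotv (grad fa w) v * s + C / 2 * l2norm v ^+ 2 * s ^+ 2.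
have dphi (s : R) : is_derive s 1 phi (dotv (grad fa (s *: v + w)) v).
  have [D1 D2] := smoothing_derive (s *: v + w).
  have E : (fun h : R => h^-1 *: ((fa \o shift (s *: v + w)) (h *: v) - fa (s *: v + w))) =
     (fun h : R => h^-1 *: ((phi \o shift s) (h *: (1 : R)) - phi s)).
    by apply/funext => h; rewrite /phi /= /GRing.scale/= mulr1 addrA -scalerDl.
  split; first by rewrite /derivable -E; exact: D1.
  by rewrite -D2 /derive E.
have dp (s : R) : is_derive s 1 p (dotv (grad fa w) v + C * l2norm v ^+ 2 * s).
  have H := is_deriveD (is_deriveZ (dotv (grad fa w) v) (is_derive_id s 1))
    (is_deriveZ (C / 2 * l2norm v ^+ 2) (is_deriveX 2 (is_derive_id s 1))).
  move: H; set l := (X in is_derive _ _ _ X) => H.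
  rewrite (_ : _ + _ = l); first exact: H.
  by rewrite /l /GRing.scale/= !mulr1 expr1; field.
have dq (s : R) : is_derive s 1 (phi - p) (dotv (grad fa (s *: v + w)) v
    - (dotv (grad fa w) v + C * l2norm v ^+ 2 * s)).
  exact: (is_deriveB (dphi s) (dp s)).
have q01 : (phi - p) 1 <= (phi - p) 0.
  apply: (@ler0_derive1_nincr R (phi - p) 0 1) => //.
  - move=> s; rewrite in_itv/= => /andP[s0 _].
    rewrite derive1E (@derive_val _ _ _ _ _ _ _ (dq s)) opprD addrA subr_le0 -dotvBl.
    apply: (le_trans (cauchy_schwarz _ _)).
    apply: (le_trans (ler_wpM2r (l2norm_ge0 v) (smoothing_grad_lipschitz _ _))).
    rewrite addrK l2normZ gtr0_norm// -/C le_eqVlt; apply/orP; left; apply/eqP; ring.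
  - apply: continuous_subspaceT => s; apply: differentiable_continuous.
    by apply/derivable1_diffP; case: (dq s).
move: q01; rewrite -[(phi - p) 1]/(phi 1 - p 1) -[(phi - p) 0]/(phi 0 - p 0).
rewrite /phi /p scale1r scale0r add0r (addrC v) expr0n/= expr1n !mulr0 !mulr1 addr0 subr0.
lra.
Qed.

End SmoothingGradient.

(** * The distance to the Clarke subdifferential *)

Section ClarkeDistance.
Context {R : realType} {d : nat}.
Variables (f : 'rV[R]_d -> R) (L : R).
Hypothesis L0 : 0 <= L.
Hypothesis fL : forall x y, `|f x - f y| <= L * l2norm (x - y).
Variables (a : R) (a0 : 0 < a).
Local Notation P := (uniform_cube a0 d).
Local Notation fa := (smoothing a0 f).

Lemma conv_hull_convex (A : set 'rV[R]_d) x y (t : R) : 0 <= t <= 1 ->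
  conv_hull A x -> conv_hull A y -> conv_hull A (x + t *: (y - x)).
Proof.
move=> t01 Ax Ay M [cM AM].
have t'01 : 0 <= 1 - t <= 1 by lra.
pose l : {i01 R} := Itv01 (proj1 (andP t'01)) (proj2 (andP t'01)).
have := cM x y l; rewrite !inE => /(_ (Ax _ (conj cM AM)) (Ay _ (conj cM AM))).
have -> // : (conv l (x : convex_lmodType _) y : 'rV[R]_d) = x + t *: (y - x).
rewrite -[LHS]/((1 - t) *: x + (1 - (1 - t)) *: y) opprB addrCA subrr addr0.
by rewrite scalerBl scale1r scalerBr -addrA (addrC (- _)).
Qed.

Lemma grad_in_clarke_cube w u : `|u| <= a -> differentiable f (w + u) ->
  clarke_cube a f w (grad f (w + u)).
Proof.
move=> ua du; apply: sub_gen_smallest; exists (w + u) => /=.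
  by rewrite addrC addKr.
apply: sub_gen_smallest => /=; exists (fun=> w + u); split => //; exact: cvg_cst.
Qed.

Lemma dist_ge0 (A : set 'rV[R]_d) x : (0 <= dist x A)%E.
Proof. by apply: le_ereal_inf_tmp => _ [y _ <-]; rewrite lee_fin l2norm_ge0. Qed.

(** A point x of the convex set with almost minimal norm makes an inner product
    of at least almost |x|^2 with every gradient of f on the cube, hence with
    their mean; by Cauchy-Schwarz the mean is at least as long as x. *)
Lemma dist_clarke_le w :
  (dist 0%R (clarke_cube a f w) <= (l2norm (grad fa w))%:E)%E.
Proof.
set S := clarke_cube a f w; set r := l2norm (grad fa w).
pose N := [set l2norm x | x in S].
have : exists u, `|u| <= a /\ differentiable f (w + u).
  apply: contrapT => nex.
  have : {ae P, forall u, False}.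
    apply: filterS2 (uniform_cube_support a0 d)
      (rademacher (mulr_ge0 L0 (sqrtr_ge0 d%:R)) (lipschitz2_sup L0 fL) a0 w) => u ua du.
    by apply: nex; exists u.
  move=> [A [mA A0 AT]].
  have : (P setT <= P A)%E by apply: le_measure; rewrite ?inE// => x _; apply: AT.
  by rewrite A0 probability_setT lee_fin ler10.
move=> [u0 [u0a du0]].
have Sg u : `|u| <= a -> differentiable f (w + u) -> S (grad f (w + u)).
  exact: grad_in_clarke_cube.
have N0 : N !=set0 by exists (l2norm (grad f (w + u0))), (grad f (w + u0)) => //; exact: Sg.
have lbN : lbound N 0 by move=> _ [x _ <-]; exact: l2norm_ge0.
have hN : has_inf N by split => //; exists 0.
pose D := inf N.
have D0 : 0 <= D by apply: lb_le_inf.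
have Dle x : S x -> D <= l2norm x by move=> Sx; apply: ge_inf; [exists 0|exists x].
have Dr : D <= r.
  rewrite leNgt; apply/negP => rD.
  have r0 : 0 <= r by exact: l2norm_ge0.
  (* If the infimum D of the norms exceeded r, a step e towards a gradient
     would contradict minimality: B bounds the relative error terms, and e is
     small enough for e B to stay below half of D (D - r). *)
  pose B := 1 + ((D + 1) ^+ 2 + L ^+ 2).
  have B0 : 0 < B by rewrite /B ltr_wpDr// addr_ge0// sqr_ge0.
  pose e := Num.min 1 (D * (D - r) / (2 * B)).
  have DD : 0 < D * (D - r) by rewrite mulr_gt0 ?subr_gt0// (le_lt_trans r0).
  have e0 : 0 < e by rewrite lt_min ltr01/= divr_gt0// mulr_gt0.
  have e1 : e <= 1 by rewrite ge_min lexx.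
  have eB : e * B <= D * (D - r) / 2.
    have : e <= D * (D - r) / (2 * B) by rewrite ge_min lexx orbT.
    by rewrite invfM mulrA ler_pdivlMr.
  (* With this tolerance, a norm below D + eta has a square below
     D^2 + e^2. *)
  pose eta := e ^+ 2 / (2 * D + 1).
  have D1 : 0 < 2 * D + 1 by lra.
  have eta0 : 0 < eta by rewrite divr_gt0// exprn_gt0.
  have e21 : e ^+ 2 <= 1 by rewrite expr_le1// ltW.
  have eta1 : eta <= 1 by rewrite ler_pdivrMr//; lra.
  have etaE : eta * (2 * D + 1) = e ^+ 2 by rewrite divfK ?gt_eqF.
  have [_ [x Sx <-]] := inf_adherent eta0 hN; rewrite -/D => xD.
  have Dx := Dle _ Sx.
  have xx : l2norm x ^+ 2 <= D ^+ 2 + e ^+ 2.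
    have : l2norm x ^+ 2 <= (D + eta) ^+ 2 by rewrite ler_pXn2r ?nnegrE// ?ltW//; lra.
    move/le_trans; apply; rewrite -etaE sqrrD -addrA lerD2l.
    have : eta ^+ 2 <= eta by rewrite expr2 ler_piMl// ltW.
    lra.
  have key : l2norm x ^+ 2 - e * B <= dotv x (grad fa w).
    apply: (smoothing_grad_ge L0 fL) => u du ua.
    set y := grad f (w + u).
    have Sy : S y by exact: Sg.
    have yL : l2norm y <= L.
      apply: (grad_lipschitz L0 fL) => v; last exact: derive_grad.
      exact: diff_derivable.
    have Sz : S (x + e *: (y - x)) by apply: conv_hull_convex => //; rewrite (ltW e0).
    have := Dle _ Sz => Dz.
    have : D ^+ 2 <= l2norm (x + e *: (y - x)) ^+ 2.
      by rewrite ler_pXn2r ?nnegrE// l2norm_ge0.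
    rewrite l2normE !(dotvBl, dotvBr, dotvDl, dotvDr, dotvZl, dotvZr) -!l2normE (dotvC y x).
    set p := dotv x y => H.
    have y2 : l2norm y ^+ 2 <= L ^+ 2 by rewrite ler_pXn2r ?nnegrE// l2norm_ge0.
    have x2 : l2norm x ^+ 2 <= (D + 1) ^+ 2.
      by rewrite ler_pXn2r ?nnegrE ?l2norm_ge0//; lra.
    have np : - p <= (l2norm x ^+ 2 + l2norm y ^+ 2) / 2.
      have := dotv_le_sqr (- x) y; rewrite l2normN.
      by rewrite -scaleN1r dotvZl mulN1r.
    rewrite -(ler_pM2l e0).
    have : e ^+ 2 * (l2norm x ^+ 2 + l2norm y ^+ 2 - 2 * p) <=
       e ^+ 2 * (2 * (B - 1)).
      by rewrite ler_wpM2l ?sqr_ge0// /B; lra.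
    move: H xx; rewrite /B.
    set X := l2norm x ^+ 2; set Y := l2norm y ^+ 2; set B1 := (D + 1) ^+ 2 + L ^+ 2.
    move=> H xx H2.
    have {}H : D ^+ 2 <= X + 2 * (e * p) - 2 * (e * X) + e ^+ 2 * (X + Y - 2 * p).
      by apply: (le_trans H); rewrite le_eqVlt; apply/orP; left; apply/eqP; ring.
    have {}H2 : e ^+ 2 * (X + Y - 2 * p) <= 2 * (e ^+ 2 * B1).
      by apply: (le_trans H2); rewrite le_eqVlt; apply/orP; left; apply/eqP; ring.
    have -> : e * (X - e * (1 + B1)) = e * X - e ^+ 2 - e ^+ 2 * B1 by ring.
    have := sqr_ge0 e; lra.
  have := le_trans key (cauchy_schwarz _ _); rewrite -/r.
  have : D * (D - r) <= l2norm x * (l2norm x - r).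
    by apply: ler_pM => //; lra.
  rewrite mulrBr -expr2; lra.
apply/lee_addgt0Pr => e e0.
have [_ [x Sx <-]] := inf_adherent e0 hN; rewrite -/D => xD.
apply: (@le_trans _ _ (l2norm x)%:E).
  apply: ge_ereal_inf; exists (l2norm x)%:E => //.
  by exists x => //; rewrite sub0r l2normN.
by rewrite -EFinD lee_fin; lra.
Qed.

End ClarkeDistance.

(** * Conditional expectation and laws of independent variables *)

Section PullOut.
Context (dT : measure_display) (T : measurableType dT) (R : realType).
Variables (P : {measure set T -> \bar R}) (U : set_system T).
Hypothesis UT : U `<=` measurable.
Local Notation T' := (g_sigma_algebraType U).
Import HBNNSimple.

Lemma sub_sigma_measurable (A : set T) : <<s U >> A -> measurable A.
Proof. by apply: smallest_sub => //; exact: sigma_algebra_measurable. Qed.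

Lemma sub_sigma_measurable_fun (d' : measure_display) (T2 : measurableType d')
    (X : T -> T2) :
  measurable_fun setT (X : T' -> T2) -> measurable_fun setT X.
Proof.
move=> mX _ B mB; rewrite setTI; apply: sub_sigma_measurable.
by rewrite -[X in <<s _ >> X]setTI; exact: mX.
Qed.

(** On each of its level sets, which belong to the sub-sigma-algebra, k is
    constant. *)
Lemma integral_nnsfun_mul (k : {nnsfun T' >-> R}) (h : T -> R) :
  measurable_fun setT h -> (forall x, 0 <= h x) ->
  (\int[P]_x ((k x * h x)%:E) =
   \sum_(r \in range k) r%:E * \int[P]_(x in k @^-1` [set r]) (h x)%:E)%E.
Proof.
move=> mh h0.
have mk r : measurable (k @^-1` [set r] : set T).
  apply: sub_sigma_measurable; rewrite -[X in <<s _ >> X]setTI.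
  by apply: (measurable_funP k).
transitivity (\int[P]_x (\sum_(r \in range k) (r * \1_(k @^-1` [set r]) x * h x)%:E))%E.
  apply: eq_integral => x _.
  rewrite fsumEFin// (fimfunE k x); congr EFin.
  by rewrite mulr_fsuml.
rewrite ge0_integral_fsum//=; last 2 first.
- move=> r; apply/measurable_EFinP; apply: measurable_funM => //.
  by apply: measurable_funM => //; exact: measurable_indic.
- move=> r x _; rewrite lee_fin mulr_ge0//; exact: nnfun_muleindic_ge0.
apply: eq_fsbigr => r; rewrite inE => -[x _ kx].
have r0 : 0 <= r by rewrite -kx.
under eq_integral do rewrite -mulrA EFinM.
rewrite ge0_integralZl//; last 2 first.
- apply/measurable_EFinP; apply: measurable_funM => //; exact: measurable_indic.
- by move=> y _; rewrite lee_fin mulr_ge0.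
congr (_ * _)%E; rewrite [RHS]integral_mkcond; apply: eq_integral => y _.
by rewrite patchE indicE; case: ifP => _; rewrite ?mul1r ?mul0r.
Qed.

(** For a simple X the two sides agree level set by level set; monotone
    convergence extends this to any X. *)
Lemma pull_out_ge0 (h1 h2 : T -> R) (X : T -> R) :
  measurable_fun setT h1 -> measurable_fun setT h2 ->
  (forall x, 0 <= h1 x) -> (forall x, 0 <= h2 x) ->
  (forall A, <<s U >> A -> \int[P]_(x in A) (h1 x)%:E = \int[P]_(x in A) (h2 x)%:E)%E ->
  measurable_fun setT (X : T' -> R) -> (forall x, 0 <= X x) ->
  (\int[P]_x (X x * h1 x)%:E = \int[P]_x (X x * h2 x)%:E)%E.
Proof.
move=> mh1 mh2 h10 h20 h12 mX X0.
have mX' : measurable_fun setT (EFin \o (X : T' -> R)) by exact/measurable_EFinP.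
pose k := nnsfun_approx measurableT mX'.
have main (h : T -> R) : measurable_fun setT h -> (forall x, 0 <= h x) ->
    (\int[P]_x (X x * h x)%:E = limn (fun n => \int[P]_x (k n x * h x)%:E))%E.
  move=> mh h0.
  have cv x : (k n x * h x)%:E @[n --> \oo] --> (X x * h x)%:E.
    apply: cvg_EFin; first exact: nearW.
    apply: cvgMl; have := cvg_nnsfun_approx measurableT mX' (fun y _ => _) (x := x) I.
    by move=> H; apply: (fine_cvg (H _)) => y; rewrite lee_fin.
  rewrite -monotone_convergence//.
  - by apply: eq_integral => x _; apply/esym/cvg_lim => //; exact: cv.
  - move=> n; apply/measurable_EFinP; apply: measurable_funM => //.
    by apply: sub_sigma_measurable_fun.
  - by move=> n x _; rewrite lee_fin mulr_ge0.
  - move=> x _ a b ab; rewrite lee_fin ler_wpM2r//.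
    by have /lefP := nd_nnsfun_approx measurableT mX' ab; apply.
rewrite !main//; congr (limn _); apply/funext => n.
rewrite !integral_nnsfun_mul//; apply: eq_fsbigr => r _; congr (_ * _)%E.
apply: h12; rewrite -[X in <<s _ >> X]setTI.
by apply: (measurable_funP (k n)).
Qed.

(** The positive and negative parts of Z have equal integrals over the sets of
    the sub-sigma-algebra, so that pull_out_ge0 applies to them with the positive
    and with the negative part of X. *)
Lemma pull_out0 (Z X : T -> R) :
  P.-integrable setT (EFin \o Z) ->
  (forall A, <<s U >> A -> \int[P]_(x in A) (Z x)%:E = 0)%E ->
  measurable_fun setT (X : T' -> R) ->
  P.-integrable setT (EFin \o (fun x => X x * Z x)) ->
  \int[P]_x (X x * Z x) = 0.
Proof.
move=> iZ Z0 mX iXZ.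
have mZ : measurable_fun setT Z by exact/measurable_EFinP/(measurable_int _ iZ).
have mXT := sub_sigma_measurable_fun mX.
pose zp x := Num.max (Z x) 0; pose zn x := Num.max (- Z x) 0.
pose xp x := Num.max (X x) 0; pose xn x := Num.max (- X x) 0.
have pnE (r : R) : r = Num.max r 0 - Num.max (- r) 0.
  by rewrite /Num.max; case: ltP => h1; case: ltP => h2; lra.
have p0 (r : R) : 0 <= Num.max r 0 by rewrite le_max lexx orbT.
have pn (r : R) : Num.max r 0 <= `|r| by rewrite ge_max ler_norm normr_ge0.
have nn (r : R) : Num.max (- r) 0 <= `|r| by rewrite -normrN pn.
have mp (d' : measure_display) (S : measurableType d') (h : S -> R) :
    measurable_fun setT h -> measurable_fun setT (fun x => Num.max (h x) 0).
  by move=> mh; apply: measurable_maxr.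
have mn (d' : measure_display) (S : measurableType d') (h : S -> R) :
    measurable_fun setT h -> measurable_fun setT (fun x => Num.max (- h x) 0).
  by move=> mh; apply: measurable_maxr => //; exact: measurableT_comp.
have izp : P.-integrable setT (EFin \o zp).
  apply: le_integrable iZ => //; first exact/measurable_EFinP/mp.
  by move=> x _; rewrite /= lee_fin ger0_norm// /zp.
have izn : P.-integrable setT (EFin \o zn).
  apply: le_integrable iZ => //; first exact/measurable_EFinP/mn.
  by move=> x _; rewrite /= lee_fin ger0_norm// /zn.
have Zpn A : <<s U >> A -> (\int[P]_(x in A) (zp x)%:E = \int[P]_(x in A) (zn x)%:E)%E.
  move=> UA; have mA := sub_sigma_measurable UA.
  have izpA : P.-integrable A (EFin \o zp) by apply: integrableS izp.
  have iznA : P.-integrable A (EFin \o zn) by apply: integrableS izn.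
  have := Z0 A UA.
  under eq_integral do rewrite (pnE (Z _)) EFinB.
  rewrite integralB//.
  move=> /eqP; rewrite sube_eq ?add0e; last 2 first.
  - exact: integrable_fin_num.
  - by rewrite fin_num_adde_defl//; exact: integrable_fin_num.
  by move/eqP.
have i2 (x1 z1 : T -> R) : measurable_fun setT x1 -> measurable_fun setT z1 ->
    (forall x, 0 <= x1 x <= `|X x|) -> (forall x, 0 <= z1 x <= `|Z x|) ->
    P.-integrable setT (EFin \o (fun x => x1 x * z1 x)).
  move=> mx1 mz1 hx hz; apply: le_integrable iXZ => //.
    by apply/measurable_EFinP; exact: measurable_funM.
  move=> x _; rewrite /= lee_fin !normrM.
  have /andP[x0 xX] := hx x; have /andP[z0 zZ] := hz x.
  by rewrite (ger0_norm x0) (ger0_norm z0) ler_pM.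
have mzp := mp _ _ _ mZ; have mzn := mn _ _ _ mZ.
have mxp := mp _ _ _ mXT; have mxn := mn _ _ _ mXT.
have hxp x : 0 <= xp x <= `|X x| by rewrite p0 pn.
have hxn x : 0 <= xn x <= `|X x| by rewrite p0 nn.
have hzp x : 0 <= zp x <= `|Z x| by rewrite p0 pn.
have hzn x : 0 <= zn x <= `|Z x| by rewrite p0 nn.
have ipp := i2 _ _ mxp mzp hxp hzp; have ipn := i2 _ _ mxp mzn hxp hzn.
have inp := i2 _ _ mxn mzp hxn hzp; have inn := i2 _ _ mxn mzn hxn hzn.
have E1 : \int[P]_x (xp x * zp x) = \int[P]_x (xp x * zn x).
  congr fine; exact: (pull_out_ge0 mzp mzn (fun x => p0 _) (fun x => p0 _) Zpn (mp _ _ _ mX) (fun x => p0 _)).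
have E2 : \int[P]_x (xn x * zp x) = \int[P]_x (xn x * zn x).
  congr fine; exact: (pull_out_ge0 mzp mzn (fun x => p0 _) (fun x => p0 _) Zpn (mn _ _ _ mX) (fun x => p0 _)).
transitivity (\int[P]_x ((xp x * zp x - xp x * zn x) - (xn x * zp x - xn x * zn x))).
  by apply: eq_Rintegral => x _; rewrite {1}(pnE (X x)) {1}(pnE (Z x)) -/(xp x) -/(xn x) -/(zp x) -/(zn x); ring.
have i1 : P.-integrable setT (EFin \o (fun x => xp x * zp x - xp x * zn x)).
  by have := integrableB measurableT ipp ipn; apply: eq_integrable.
have i3 : P.-integrable setT (EFin \o (fun x => xn x * zp x - xn x * zn x)).
  by have := integrableB measurableT inp inn; apply: eq_integrable.
by rewrite RintegralB// !RintegralB// E1 E2 !subrr.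
Qed.

End PullOut.

Lemma cond_exp_pull_out (dT : measure_display) (T : measurableType dT) (R : realType)
    (P : probability T R) (U : set_system T) (Z Y X : T -> R) :
  U `<=` measurable ->
  is_cond_exp P <<s U >> Z Y ->
  measurable_fun setT (X : g_sigma_algebraType U -> R) ->
  P.-integrable setT (EFin \o (fun x => X x * Z x)) ->
  P.-integrable setT (EFin \o (fun x => X x * Y x)) ->
  \int[P]_x (X x * Z x) = \int[P]_x (X x * Y x).
Proof.
move=> UT [iZ iY YU ZY] mX iXZ iXY.
apply/eqP; rewrite -subr_eq0 -RintegralB//.
under eq_Rintegral do rewrite -mulrBr.
apply/eqP; apply: (pull_out0 UT) => //.
- by have := integrableB measurableT iZ iY; apply: eq_integrable.
- move=> A UA; have mA := sub_sigma_measurable UT UA.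
  have iZA : P.-integrable A (EFin \o Z) by apply: integrableS iZ.
  have iYA : P.-integrable A (EFin \o Y) by apply: integrableS iY.
  under eq_integral do rewrite EFinB.
  rewrite integralB// ZY// subee//; exact: integrable_fin_num.
- have := integrableB measurableT iXZ iXY; apply: eq_integrable => // x _ /=.
  by rewrite mulrBr EFinB.
Qed.

Section ProductLaw.
Context (R : realType).

(** The rectangles form a generating pi-system. *)
Lemma eq_measure_prod (d1 d2 : measure_display) (T1 : measurableType d1)
    (T2 : measurableType d2) (m1 m2 : {measure set (T1 * T2) -> \bar R}) :
  (m1 setT < +oo)%E ->
  (forall A B, measurable A -> measurable B -> m1 (A `*` B) = m2 (A `*` B)) ->
  forall C, measurable C -> m1 C = m2 C.
Proof.
move=> m1oo m12 C mC.
apply: (measure_unique [set A `*` B | A in measurable & B in measurable] (fun=> setT)) => //.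
- by rewrite measurable_prod_measurableType.
- move=> _ _ [A1 mA1 [B1 mB1 <-]] [A2 mA2 [B2 mB2 <-]].
  exists (A1 `&` A2); first exact: measurableI.
  by exists (B1 `&` B2); [exact: measurableI|rewrite setXI].
- by move=> _; exists setT => //; exists setT => //; rewrite setXTT.
- by rewrite bigcup_const.
- by move=> _ [A mA [B mB <-]]; exact: m12.
Qed.

(** With the last factor fixed, the measures restrict to measures on the product
    of the first two, where rectangles suffice. *)
Lemma eq_measure_prod3 (d1 d2 d3 : measure_display) (T1 : measurableType d1)
    (T2 : measurableType d2) (T3 : measurableType d3)
    (m1 m2 : {measure set (T1 * T2 * T3) -> \bar R}) :
  (m1 setT < +oo)%E ->
  (forall A B C, measurable A -> measurable B -> measurable C ->
     m1 (A `*` B `*` C) = m2 (A `*` B `*` C)) ->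
  forall D, measurable D -> m1 D = m2 D.
Proof.
move=> m1oo m12; apply: eq_measure_prod => // D C mD mC.
have mC' : measurable (setT `*` C : set (T1 * T2 * T3)) by exact: measurableX.
have E (m : {measure set (T1 * T2 * T3) -> \bar R}) A :
    pushforward (mrestr m mC') fst A = m (A `*` C).
  rewrite /pushforward /mrestr; congr (m _).
  by apply/seteqP; split => -[x y] /= []; tauto.
rewrite -!E; apply: eq_measure_prod => //.
- rewrite [ltLHS]E; apply: le_lt_trans m1oo.
  by apply: le_measure; rewrite ?inE.
- by move=> A B mA mB; rewrite /= ![LHS]E ![RHS]E; exact: m12.
Qed.

Lemma eq_measure_prod4 (d1 d2 d3 d4 : measure_display) (T1 : measurableType d1)
    (T2 : measurableType d2) (T3 : measurableType d3) (T4 : measurableType d4)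
    (m1 m2 : {measure set (T1 * T2 * T3 * T4) -> \bar R}) :
  (m1 setT < +oo)%E ->
  (forall A B C D, measurable A -> measurable B -> measurable C -> measurable D ->
     m1 (A `*` B `*` C `*` D) = m2 (A `*` B `*` C `*` D)) ->
  forall F, measurable F -> m1 F = m2 F.
Proof.
move=> m1oo m12; apply: eq_measure_prod => // F D mF mD.
have mD' : measurable (setT `*` D : set (T1 * T2 * T3 * T4)) by exact: measurableX.
have E (m : {measure set (T1 * T2 * T3 * T4) -> \bar R}) A :
    pushforward (mrestr m mD') fst A = m (A `*` D).
  rewrite /pushforward /mrestr; congr (m _).
  by apply/seteqP; split => -[x y] /= []; tauto.
rewrite -!E; apply: eq_measure_prod3 => //.
- rewrite [ltLHS]E; apply: le_lt_trans m1oo.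
  by apply: le_measure; rewrite ?inE.
- by move=> A B C mA mB mC; rewrite /= ![LHS]E ![RHS]E; exact: m12.
Qed.

End ProductLaw.

Section Transfer.
Context (dT : measure_display) (T : measurableType dT) (R : realType).
Variables (P : probability T R) (U : set_system T).
Hypothesis UT : U `<=` measurable.
Local Notation T' := (g_sigma_algebraType U).
Context (d2 d3 d4 : measure_display) (T2 : measurableType d2)
  (T3 : measurableType d3) (T4 : measurableType d4).

(** The variables are independent of each other and of the sigma-algebra
    generated by U, which stands for the past. *)
Definition indep_with (X : T -> T2) (Y : T -> T3) (Z : T -> T4) : Prop :=
  forall A B C D, <<s U >> A -> measurable B -> measurable C -> measurable D ->
    P (A `&` X @^-1` B `&` Y @^-1` C `&` Z @^-1` D) =
    (P A * P (X @^-1` B) * P (Y @^-1` C) * P (Z @^-1` D))%E.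

(** Both triples, taken jointly with the identity of T as a map to T endowed
    with the past, have the product law on rectangles. This identity component
    lets H depend on the past in an arbitrary measurable way. *)
Lemma transfer_integral (X1 X2 : T -> T2) (Y1 Y2 : T -> T3) (Z1 Z2 : T -> T4)
    (H : T' * T2 * T3 * T4 -> R) :
  measurable_fun setT X1 -> measurable_fun setT X2 ->
  measurable_fun setT Y1 -> measurable_fun setT Y2 ->
  measurable_fun setT Z1 -> measurable_fun setT Z2 ->
  indep_with X1 Y1 Z1 -> indep_with X2 Y2 Z2 ->
  same_law (pushforward P X1) (pushforward P X2) ->
  same_law (pushforward P Y1) (pushforward P Y2) ->
  same_law (pushforward P Z1) (pushforward P Z2) ->
  measurable_fun setT H ->
  (P.-integrable setT (EFin \o (fun o => H (o, X1 o, Y1 o, Z1 o))) <->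
   P.-integrable setT (EFin \o (fun o => H (o, X2 o, Y2 o, Z2 o)))) /\
  (P.-integrable setT (EFin \o (fun o => H (o, X1 o, Y1 o, Z1 o))) ->
   \int[P]_o H (o, X1 o, Y1 o, Z1 o) = \int[P]_o H (o, X2 o, Y2 o, Z2 o)).
Proof.
move=> mX1 mX2 mY1 mY2 mZ1 mZ2 I1 I2 XX YY ZZ mH.
pose V1 o : T' * T2 * T3 * T4 := (o, X1 o, Y1 o, Z1 o).
pose V2 o : T' * T2 * T3 * T4 := (o, X2 o, Y2 o, Z2 o).
have mid : measurable_fun setT (fun o : T => o : T').
  by move=> _ B mB; rewrite setTI; exact: (sub_sigma_measurable UT).
have mV1 : measurable_fun setT V1.
  by do 3 apply: measurable_fun_pair => //.
have mV2 : measurable_fun setT V2.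
  by do 3 apply: measurable_fun_pair => //.
have law F : measurable F -> pushforward P V1 F = pushforward P V2 F.
  apply: eq_measure_prod4.
    by rewrite /= /pushforward preimage_setT probability_setT ltry.
  move=> A B C D mA mB mC mD; rewrite /= /pushforward.
  have E X Y Z : (fun o => (o, X o, Y o, Z o)) @^-1` (A `*` B `*` C `*` D) =
      A `&` X @^-1` B `&` Y @^-1` C `&` Z @^-1` D by [].
  rewrite !E I1// I2//; congr (_ * _ * _ * _)%E; [exact: XX|exact: YY|exact: ZZ].
have mHE : measurable_fun setT (EFin \o H) by exact/measurable_EFinP.
have mHa : measurable_fun setT (fun q => `|H q|%:E).
  by apply/measurable_EFinP; exact: measurableT_comp.
have absE : (\int[P]_o `|H (V1 o)|%:E = \int[P]_o `|H (V2 o)|%:E)%E.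
  rewrite -[LHS](@ge0_integral_pushforward _ _ _ _ _ _ mV1 P setT (fun q => `|H q|%:E))//.
  rewrite -[RHS](@ge0_integral_pushforward _ _ _ _ _ _ mV2 P setT (fun q => `|H q|%:E))//.
  by apply: eq_measure_integral => A mA _; exact: law.
have intE (V : T -> T' * T2 * T3 * T4) : measurable_fun setT V ->
    P.-integrable setT (EFin \o (fun o => H (V o))) <->
    (\int[P]_o `|H (V o)|%:E < +oo)%E.
  move=> mV; split=> [/integrableP[]//|Hoo]; apply/integrableP; split => //.
  by apply: measurableT_comp mHE mV.
split; first by rewrite (intE _ mV1) (intE _ mV2) absE.
move=> i1.
have i2 : P.-integrable setT (EFin \o (fun o => H (V2 o))).
  by apply/(intE _ mV2); rewrite -absE; apply/(intE _ mV1).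
rewrite /Rintegral; congr fine.
rewrite -[LHS](@integral_pushforward _ _ _ _ _ _ mV1 P setT (EFin \o H))//.
rewrite -[RHS](@integral_pushforward _ _ _ _ _ _ mV2 P setT (EFin \o H))//.
by apply: eq_measure_integral => A mA _; exact: law.
Qed.

End Transfer.

(** * Measurability along the run *)

Section Mutual.
Context (dT : measure_display) (T : measurableType dT) (R : realType).
Variables (P : probability T R).

Lemma mutually_independent4 (Gs : seq (set_system T)) (i0 i1 i2 i3 : 'I_(size Gs))
    (A0 A1 A2 A3 : set T) :
  mutually_independent P Gs -> uniq [:: i0; i1; i2; i3] ->
  nth set0 Gs i0 A0 -> nth set0 Gs i1 A1 -> nth set0 Gs i2 A2 -> nth set0 Gs i3 A3 ->
  P (A0 `&` A1 `&` A2 `&` A3) = (P A0 * P A1 * P A2 * P A3)%E.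
Proof.
move=> ind; rewrite /= !inE !negb_or => /and4P[/and3P[n01 n02 n03] /andP[n12 n13] n23 _].
move=> G0 G1 G2 G3.
pose A i := if i == i0 then A0 else if i == i1 then A1 else if i == i2 then A2 else A3.
have E0 : A i0 = A0 by rewrite /A eqxx.
have E1 : A i1 = A1 by rewrite /A eq_sym (negbTE n01) eqxx.
have E2 : A i2 = A2 by rewrite /A eq_sym (negbTE n02) eq_sym (negbTE n12) eqxx.
have E3 : A i3 = A3.
  by rewrite /A eq_sym (negbTE n03) eq_sym (negbTE n13) eq_sym (negbTE n23).
have := ind (i0 |: (i1 |: (i2 |: [set i3]))) A.
rewrite !big_setU1/= ?inE ?negb_or ?n01 ?n02 ?n03 ?n12 ?n13 ?n23// big_set1 E0 E1 E2 E3.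
rewrite !muleA => <-.
  congr (P _); apply/seteqP; split => o /=.
    move=> [ [ [h0 h1] h2] h3] i; rewrite /= !inE.
    by case/or4P => /eqP ->; rewrite ?E0 ?E1 ?E2 ?E3.
  move=> H; rewrite -E0 -E1 -E2 -E3.
  by do ![split]; apply: H; rewrite /= !inE eqxx ?orbT.
by move=> i; rewrite !inE => /or4P[] /eqP ->; rewrite ?E0 ?E1 ?E2 ?E3.
Qed.

Lemma mutually_independent2 (G0 G1 : set_system T) (A0 A1 : set T) :
  mutually_independent P [:: G0; G1] -> G0 A0 -> G1 A1 ->
  P (A0 `&` A1) = (P A0 * P A1)%E.
Proof.
move=> ind GA0 GA1.
pose i0 : 'I_(size [:: G0; G1]) := @Ordinal 2 0 isT.
pose i1 : 'I_(size [:: G0; G1]) := @Ordinal 2 1 isT.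
pose A i := if i == i0 then A0 else A1.
have := ind (i0 |: [set i1]) A.
rewrite big_setU1 ?inE//= big_set1 {2 3}/A eqxx/= => <-.
  congr (P _); apply/seteqP; split => o /=.
    by move=> [h0 h1] i; rewrite /= !inE => /orP[] /eqP ->; rewrite /A/=.
  move=> H; split.
    by have := H i0; rewrite /A/=; apply; rewrite !inE eqxx.
  by have := H i1; rewrite /A/=; apply; rewrite !inE eqxx orbT.
by move=> i; rewrite !inE => /orP[] /eqP ->.
Qed.

End Mutual.

Section RunMeasurability.
Context (R : realType) (d : nat) (E : sgd_run R d).
Local Notation P := (prob E).

Definition step_gen k : set_system (Omega E) :=
  sigma_rv (uhat E k) `|`
      (\bigcup_(i in [set: 'I_(batch E)]) sigma_rv (xis E k i)) `|`
      (\bigcup_(i in [set: 'I_(batch E)]) sigma_rv (bs E k i)) `|`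
      sigma_rv (psi E k).

Definition past_gen k : set_system (Omega E) :=
  \bigcup_(j in [set j | (1 <= j <= k)%N]) (@sigma_step R d E j `|` sigma_rv (ehat E j)).

Lemma sigma_rv_measurable (d' : measure_display) (T' : measurableType d')
    (X : {RV P >-> T'}) : sigma_rv X `<=` measurable.
Proof. by move=> _ [B mB <-]; exact: measurable_funP. Qed.

Lemma step_gen_measurable k : step_gen k `<=` measurable.
Proof.
by move=> A [ [ [ | [i _] ] | [i _] ] | ]; exact: sigma_rv_measurable.
Qed.

Lemma sigma_step_measurable k : @sigma_step R d E k `<=` measurable.
Proof. exact/(sub_sigma_measurable (@step_gen_measurable k)). Qed.

Lemma past_gen_measurable k : past_gen k `<=` measurable.
Proof.
by move=> A [j _ [/sigma_step_measurable//|]]; exact: sigma_rv_measurable.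
Qed.

Lemma sigma_past_measurable k : @sigma_past R d E k `<=` measurable.
Proof. exact/(sub_sigma_measurable (@past_gen_measurable k)). Qed.

Lemma past_genS k l : (k <= l)%N -> past_gen k `<=` past_gen l.
Proof.
move=> kl A [j /andP[j1 jk] HA]; exists j => //=.
by rewrite j1 (leq_trans jk).
Qed.

Lemma sigma_pastS k l : (k <= l)%N -> @sigma_past R d E k `<=` @sigma_past R d E l.
Proof. by move=> kl; apply: sub_sigma_algebra2; exact: past_genS. Qed.

Lemma sigma_step_past k : (0 < k)%N -> @sigma_step R d E k `<=` @sigma_past R d E k.
Proof.
move=> k0 A HA; apply: sub_sigma_algebra; exists k => /=; first by rewrite k0/=.
by left.
Qed.

Lemma ehat_past k : (0 < k)%N -> sigma_rv (ehat E k) `<=` @sigma_past R d E k.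
Proof.
move=> k0 A HA; apply: sub_sigma_algebra; exists k => /=; first by rewrite k0/=.
by right.
Qed.

(** Measurability for a sub-sigma-algebra is measurability on the retyped sample
    space, to which the calculus of measurable functions applies directly. *)
Definition smeas (U : set_system (Omega E)) (d' : measure_display)
    (T' : measurableType d') (X : Omega E -> T') :=
  measurable_fun setT (X : g_sigma_algebraType U -> T').

Lemma smeas_sigma_rv (U : set_system (Omega E)) (d' : measure_display)
    (T' : measurableType d') (X : Omega E -> T') :
  sigma_rv X `<=` <<s U >> <-> smeas U X.
Proof.
split=> [XU _ B mB|mX _ [B mB <-]]; last exact: mX.
by apply: XU; exists B.
Qed.

Lemma smeasS (U V : set_system (Omega E)) (d' : measure_display)
    (T' : measurableType d') (X : Omega E -> T') :
  <<s U >> `<=` <<s V >> -> smeas U X -> smeas V X.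
Proof. by move=> UV /smeas_sigma_rv XU; apply/smeas_sigma_rv; exact: subset_trans UV. Qed.

Lemma smeas_uhat k : smeas (step_gen k) (uhat E k).
Proof. by apply/smeas_sigma_rv => A HA; apply: sub_sigma_algebra; do 3 left. Qed.

Lemma smeas_xis k i : smeas (step_gen k) (xis E k i).
Proof.
by apply/smeas_sigma_rv => A HA; apply: sub_sigma_algebra; left; left; right; exists i.
Qed.

Lemma smeas_bs k i : smeas (step_gen k) (bs E k i).
Proof.
by apply/smeas_sigma_rv => A HA; apply: sub_sigma_algebra; left; right; exists i.
Qed.

Lemma smeas_psi k : smeas (step_gen k) (psi E k).
Proof. by apply/smeas_sigma_rv => A HA; apply: sub_sigma_algebra; right. Qed.

Lemma measurable_rV_coordP (dT : measure_display) (T : measurableType dT) n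
    (X : T -> 'rV[R]_n) :
  measurable_fun setT X <-> forall j, measurable_fun setT (fun o => X o 0 j).
Proof.
split; last exact: measurable_rVP.
move=> mX j; apply: (@measurableT_comp _ _ _ _ _ _ (fun v : 'rV[R]_n => v 0 j)) => //.
exact: measurable_rV_coord.
Qed.

Lemma measurable_rV_add (dT : measure_display) (T : measurableType dT) n
    (X Y : T -> 'rV[R]_n) : measurable_fun setT X -> measurable_fun setT Y ->
  measurable_fun setT (fun o => X o + Y o).
Proof.
move=> /measurable_rV_coordP mX /measurable_rV_coordP mY.
by apply/measurable_rV_coordP => j; under eq_fun do rewrite mxE; exact: measurable_funD.
Qed.

Lemma measurable_rV_scale (dT : measure_display) (T : measurableType dT) n
    (c : T -> R) (X : T -> 'rV[R]_n) : measurable_fun setT c -> measurable_fun setT X ->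
  measurable_fun setT (fun o => c o *: X o).
Proof.
move=> mc /measurable_rV_coordP mX.
by apply/measurable_rV_coordP => j; under eq_fun do rewrite mxE; exact: measurable_funM.
Qed.

Lemma measurable_rV_sum (dT : measure_display) (T : measurableType dT) n (I : Type)
    (s : seq I) (X : I -> T -> 'rV[R]_n) : (forall i, measurable_fun setT (X i)) ->
  measurable_fun setT (fun o => \sum_(i <- s) X i o).
Proof.
move=> mX; elim: s => [|i s IH]; first by under eq_fun do rewrite big_nil; exact: measurable_cst.
by under eq_fun do rewrite big_cons; exact: measurable_rV_add.
Qed.

Lemma measurable_dotv (dT : measure_display) (T : measurableType dT) n
    (X Y : T -> 'rV[R]_n) : measurable_fun setT X -> measurable_fun setT Y ->
  measurable_fun setT (fun o => dotv (X o) (Y o)).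
Proof.
move=> /measurable_rV_coordP mX /measurable_rV_coordP mY.
by apply: measurable_sum => j; exact: measurable_funM.
Qed.

Lemma smeas_gradF (U : set_system (Omega E)) X Y Z :
  measurable_fun setT (gradF E) -> smeas U X -> smeas U Y -> smeas U Z ->
  smeas U (fun o => gradF E (X o, Y o, Z o)).
Proof.
move=> mG mX mY mZ; apply: measurableT_comp => //.
by do 2 apply: measurable_fun_pair => //.
Qed.

Section iterates.
Variables (w1 : 'rV[R]_d) (eta : R).
Hypothesis itE : is_iteration E w1 eta.
Hypothesis mG : measurable_fun setT (gradF E).

(** The k+1-st iterate depends on the samples, step sizes and errors of the
    first k steps only. *)
Lemma smeas_iterate k : smeas (past_gen k) (iterate E k.+1).
Proof.
have [it1 itS] := itE; elim: k => [|k IH].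
  rewrite (_ : iterate E 1 = fun=> w1); first exact: measurable_cst.
  exact/funext.
have step_past : <<s step_gen k.+1 >> `<=` <<s past_gen k.+1 >>.
  exact: sigma_step_past.
have {}IH : smeas (past_gen k.+1) (iterate E k.+1).
  by apply: smeasS IH; exact: sigma_pastS.
have mu_ := smeasS step_past (@smeas_uhat k.+1).
have mp := smeasS step_past (@smeas_psi k.+1).
rewrite (_ : iterate E k.+2 = fun o => iterate E k.+1 o +
    (- (eta * psi E k.+1 o / (batch E)%:R)) *: \sum_(i < batch E)
      gradF E (iterate E k.+1 o + uhat E k.+1 o, xis E k.+1 i o, bs E k.+1 i o)
    + ehat E k.+1 o); last by apply/funext => o; rewrite itS// scaleNr.
rewrite /smeas.
apply: measurable_rV_add; last by apply/smeas_sigma_rv; exact: ehat_past.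
apply: measurable_rV_add => //; apply: measurable_rV_scale.
  apply: measurableT_comp => //; apply: measurable_funM => //.
  exact: measurable_funM.
apply: measurable_rV_sum => i; apply: smeas_gradF => //.
- exact: measurable_rV_add.
- exact: smeasS step_past (@smeas_xis k.+1 i).
- exact: smeasS step_past (@smeas_bs k.+1 i).
Qed.

End iterates.
End RunMeasurability.
Arguments past_gen {R d} E k.
Arguments step_gen {R d} E k.

(** * The expected decrease in one step *)

Lemma ae_distribution (dT dS : measure_display) (T : measurableType dT)
    (S : measurableType dS) (R : realType) (P : probability T R)
    (X : {RV P >-> S}) (A : S -> Prop) :
  {ae distribution P X, forall x, A x} -> {ae P, forall o, A (X o)}.
Proof.
move=> [N [mN N0 AN]]; exists (X @^-1` N); split => //.
- by rewrite -[X in measurable X]setTI; exact: measurable_funP.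
- by move=> o /AN.
Qed.

Section Loss.
Context (R : realType) (d : nat) (E : sgd_run R d) (f : 'rV[R]_d -> R) (L0 Q : R).
Local Notation P := (prob E).
Hypothesis Hloss : is_loss E f L0 Q.

Lemma loss_lipschitz w w' : `|f w - f w'| <= L0 * l2norm (w - w').
Proof.
case: Hloss => _ mF mL lipL mom1 _ lE _.
have mFx v : measurable_fun setT (lossF E v \o xi E) by apply: measurableT_comp.
have mLx : measurable_fun setT (lipF E \o xi E) by apply: measurableT_comp.
have iF v : P.-integrable setT (EFin \o (fun o => lossF E v (xi E o))).
  by apply: (fin_integral_integrable (mFx v)); have := lE v; rewrite unlock; exact.
have iL : P.-integrable setT (EFin \o (fun o => lipF E (xi E o))).
  by apply: (fin_integral_integrable mLx); move: mom1; rewrite unlock; exact.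
have fE v : f v = \int[P]_o lossF E v (xi E o).
  by have := lE v; rewrite unlock /Rintegral => ->.
have LE : L0 = \int[P]_o lipF E (xi E o) by move: mom1; rewrite unlock /Rintegral => ->.
have aeL := ae_distribution lipL.
have iLc : P.-integrable setT (EFin \o (fun o => lipF E (xi E o) * l2norm (w - w'))).
  by have := integrableZr measurableT (l2norm (w - w')) iL; apply: eq_integrable.
have key v v' : l2norm (v - v') = l2norm (w - w') -> f v - f v' <= L0 * l2norm (w - w').
  move=> vv; rewrite !fE -RintegralB// LE -RintegralZr//.
  apply: ae_le_Rintegral => //.
    by have := integrableB measurableT (iF v) (iF v'); apply: eq_integrable.
  by apply: filterS aeL => o /(_ v v'); rewrite vv; apply: le_trans; exact: ler_norm.
rewrite ler_norml key// andbT lerNl opprB key//.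
by rewrite -l2normN opprB.
Qed.

Lemma loss_lipschitz_ge0 : (0 < d)%N -> 0 <= L0.
Proof.
case: d f E Hloss loss_lipschitz => // n f' E' _ H _.
have := H (delta_mx 0 ord0) 0; rewrite subr0 l2norm_delta mulr1.
exact: le_trans.
Qed.

End Loss.

Section OneStep.
Context (R : realType) (d : nat) (E : sgd_run R d).
Variables (f : 'rV[R]_d -> R) (L0 Q : R) (w1 : 'rV[R]_d) (eta : R).
Variables (c1 c2 c3 c4 psil psiu alpha : R) (alpha0 : 0 < alpha).
Local Notation P := (prob E).
Local Notation fa := (smoothing alpha0 f).
Local Notation M := (batch E).
Hypothesis d_gt0 : (0 < d)%N.
Hypothesis eta_gt0 : 0 < eta.
Hypothesis c1_gt0 : 0 < c1.
Hypothesis c4_gt0 : 0 < c4.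
Hypothesis psil_gt0 : 0 < psil.
Hypothesis Hloss : is_loss E f L0 Q.
Hypothesis Hsamp : is_sampling E.
Hypothesis Hit : is_iteration E w1 eta.
Hypothesis Hgrad : gradient_condition E f alpha0 c1 c2 Q.
Hypothesis Hstep : stepsize_condition E psil psiu.
Hypothesis Herr : error_condition E c3 eta.
Hypothesis Hgap : gap_condition E c4 eta alpha.

Let L0_ge0 : 0 <= L0 := loss_lipschitz_ge0 Hloss d_gt0.
Let fL := loss_lipschitz Hloss.
Let mG := gradF_measurable Hsamp.

Definition sgrad k o : 'rV[R]_d := grad fa (iterate E k o).

Definition batch_grad k (i : 'I_M) o : 'rV[R]_d :=
  gradF E (iterate E k o + uhat E k o, xis E k i o, bs E k i o).

Definition mean_grad k o : 'rV[R]_d := M%:R^-1 *: \sum_(i < M) batch_grad k i o.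

Lemma continuous_grad_smoothing : continuous (grad fa).
Proof.
move=> w; apply: (@cvgrPdist_le R _ _ (nbhs w) _ (grad fa) (grad fa w)).2 => e e0.
pose C := Num.sqrt d%:R * L0 / alpha * Num.sqrt d%:R + 1.
have C0 : 0 < C.
  apply: ltr_wpDl => //; apply: mulr_ge0; last exact: sqrtr_ge0.
  by apply: divr_ge0; [apply: mulr_ge0 => //; exact: sqrtr_ge0|exact: ltW].
have idw : y @[y --> w] --> w by exact: cvg_id.
have eC : 0 < e / C by rewrite divr_gt0.
have /cvgrPdist_le /(_ _ eC) := idw.
apply: filterS => y wy; apply: (le_trans (norm_le_l2norm _)).
apply: (le_trans (smoothing_grad_lipschitz L0_ge0 fL alpha0 _ _)).
have H0 : 0 <= Num.sqrt d%:R * L0 / alpha.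
  by apply: divr_ge0; [apply: mulr_ge0 => //; exact: sqrtr_ge0|exact: ltW].
apply: (le_trans (ler_wpM2l H0 (l2norm_le_norm _))).
rewrite mulrA; apply: (@le_trans _ _ (C * `|w - y|)).
  by rewrite ler_wpM2r// /C lerDl.
by rewrite mulrC -ler_pdivlMr.
Qed.

Lemma smeas_sgrad k : smeas (past_gen E k) (sgrad k.+1).
Proof.
apply: (@measurableT_comp _ _ _ _ _ _ (grad fa)).
  apply: continuous_rV_measurable_rV; exact: continuous_grad_smoothing.
exact: (@smeas_iterate _ _ _ _ _ Hit mG k).
Qed.

Lemma sgrad_bounded k o : l2norm (sgrad k o) <= L0.
Proof. exact: smoothing_grad_bounded. Qed.

Lemma measurable_iterate k : measurable_fun setT (iterate E k.+1).
Proof. exact: (sub_sigma_measurable_fun (@past_gen_measurable R d E k) (@smeas_iterate _ _ _ _ _ Hit mG k)). Qed.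

Lemma measurable_sgrad k : measurable_fun setT (sgrad k.+1).
Proof. exact: (sub_sigma_measurable_fun (@past_gen_measurable R d E k) (@smeas_sgrad k)). Qed.

(** A conditional probability equal to 1 almost surely integrates to a
    probability 1; the gap condition then bounds the distance of psi to PsiU, as
    psi is at least PsiL. *)
Lemma ae_stepsize k : {ae P, forall o, [/\ psil <= PsiU E k.+1 o <= psiu,
  0 <= PsiU E k.+1 o - psi E k.+1 o, PsiU E k.+1 o - psi E k.+1 o <= c4 * (eta / alpha) &
  0 <= psi E k.+1 o <= psiu]}.
Proof.
have [[mL mU] LU [Y YE Y1] PU] := Hstep (ltn0Sn k).
have [/smeas_sigma_rv mL' /smeas_sigma_rv mU'] := conj mL mU.
have mLT : measurable_fun setT (PsiL E k.+1) := sub_sigma_measurable_fun (@past_gen_measurable R d E k) mL'.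
have mUT : measurable_fun setT (PsiU E k.+1) := sub_sigma_measurable_fun (@past_gen_measurable R d E k) mU'.
have mpsi : measurable_fun setT (psi E k.+1) by [].
have mge (h1 h2 : Omega E -> R) : measurable_fun setT h1 -> measurable_fun setT h2 ->
    measurable [set o | h1 o <= h2 o].
  move=> m1 m2; rewrite (_ : mkset _ = (fun o => h2 o - h1 o) @^-1` `[0, +oo[%classic).
    by rewrite -[X in measurable X]setTI; apply: measurable_funB.
  by apply/seteqP; split => o /=; rewrite in_itv/= andbT subr_ge0.
have mA1 : measurable [set o | psil <= PsiU E k.+1 o <= psiu].
  rewrite (_ : mkset _ = [set o | psil <= PsiU E k.+1 o] `&` [set o | PsiU E k.+1 o <= psiu]).
    by apply: measurableI; apply: mge => //; exact: measurable_cst.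
  by apply/seteqP; split => o /= /andP.
have mA2 : measurable [set o | PsiL E k.+1 o <= psi E k.+1 o <= PsiU E k.+1 o].
  rewrite (_ : mkset _ = [set o | PsiL E k.+1 o <= psi E k.+1 o] `&`
      [set o | psi E k.+1 o <= PsiU E k.+1 o]).
    by apply: measurableI; apply: mge.
  by apply/seteqP; split => o /= /andP.
have prob1_ae (A : set (Omega E)) : measurable A -> P A = 1%E -> {ae P, forall o, A o}.
  move=> mA PA; exists (~` A); split => //; first exact: measurableC.
  by rewrite probability_setC// PA subee.
have ae1 := prob1_ae _ mA1 PU.
have ae2 : {ae P, forall o, PsiL E k.+1 o <= psi E k.+1 o <= PsiU E k.+1 o}.
  apply: (prob1_ae _ mA2).
  have [iX iY _ XY] := YE.
  have ET : @sigma_past R d E k setT.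
    exact: (@measurableT _ (g_sigma_algebraType (past_gen E k))).
  have := XY _ ET; rewrite integral_indic// setIT => <-.
  transitivity (\int[P]_o (1 : \bar R))%E; last by rewrite integral_cst//= probability_setT mule1.
  apply: ae_eq_integral => //; first exact: measurable_int iY.
  by apply: filterS Y1 => o -> _.
have := Hgap (ltn0Sn k).
apply: filterS3 ae1 ae2 => o a1 /andP[a2 a2'] a3.
have := psi_ge0 Hsamp o (ltn0Sn k); have /andP[a11 a12] := a1.
by split => //; [lra|lra|apply/andP; split; lra].
Qed.

Lemma indep_samples k (i : 'I_M) :
  indep_with P (past_gen E k) (uhat E k.+1) (xis E k.+1 i) (bs E k.+1 i).
Proof.
move=> A B C D GA mB mC mD.
have := samples_independent Hsamp (ltn0Sn k).
set Gs := (X in mutually_independent P X) => ind.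
have sx (X : 'I_M -> set_system (Omega E)) : size [seq X j | j <- enum 'I_M] = M.
  by rewrite size_map size_enum_ord.
have sz : size Gs = (2 + (M + M))%N by rewrite /= size_cat !sx.
have l0 : (0 < size Gs)%N by rewrite sz.
have l1 : (1 < size Gs)%N by rewrite sz.
(* The list starts with the past and uhat, followed by the M samples of xi
   and the M samples of b. *)
have l2 : (2 + i < size Gs)%N by rewrite sz ltn_add2l (leq_trans (ltn_ord i))// leq_addr.
have l3 : (2 + (M + i) < size Gs)%N by rewrite sz ltn_add2l ltn_add2l.
have n2 : nth set0 Gs (2 + i) = sigma_rv (xis E k.+1 i).
  rewrite /Gs add2n /= nth_cat sx ltn_ord.
  by rewrite (nth_map i) ?size_enum_ord// nth_ord_enum.
have n3 : nth set0 Gs (2 + (M + i)) = sigma_rv (bs E k.+1 i).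
  rewrite /Gs add2n /= nth_cat sx ltnNge leq_addr/= addKn.
  by rewrite (nth_map i) ?size_enum_ord// nth_ord_enum.
apply: (mutually_independent4 (i0 := Ordinal l0) (i1 := Ordinal l1)
  (i2 := Ordinal l2) (i3 := Ordinal l3) ind).
- rewrite /= !inE -!val_eqE/= !add2n !eqSS/=.
  by rewrite ?andbT neq_ltn ltn_addr ?ltn_ord.
- exact: GA.
- by exists B; rewrite ?setTI.
- by rewrite (n2 : nth set0 Gs (Ordinal l2) = _); exists C; rewrite ?setTI.
- by rewrite (n3 : nth set0 Gs (Ordinal l3) = _); exists D; rewrite ?setTI.
Qed.

Lemma indep_generic k :
  indep_with P (past_gen E k) (uhat E k.+1) (xigen E k.+1) (bvec E k.+1).
Proof.
move=> A B C D GA mB mC mD.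
have := generic_independent Hsamp (ltn0Sn k).
set Gs := (X in mutually_independent P X) => ind.
have l0 : (0 < size Gs)%N by []. have l1 : (1 < size Gs)%N by [].
have l2 : (2 < size Gs)%N by []. have l3 : (3 < size Gs)%N by [].
apply: (mutually_independent4 (i0 := Ordinal l0) (i1 := Ordinal l1)
  (i2 := Ordinal l2) (i3 := Ordinal l3) ind) => //=.
- by exists B; rewrite ?setTI.
- by exists C; rewrite ?setTI.
- by exists D; rewrite ?setTI.
Qed.

(** The i-th sample of the batch can be traded for the generic one in any
    integral that involves the past and the perturbation. *)
Lemma transfer_generic k (i : 'I_M)
    (H : g_sigma_algebraType (past_gen E k) * 'rV[R]_d * 'rV[R]_(dim_xi E) *
         'rV[R]_(dim_b E) -> R) : measurable_fun setT H ->
  P.-integrable setT (EFin \o (fun o => H (o, uhat E k.+1 o, xigen E k.+1 o, bvec E k.+1 o))) ->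
  P.-integrable setT (EFin \o (fun o => H (o, uhat E k.+1 o, xis E k.+1 i o, bs E k.+1 i o))) /\
  \int[P]_o H (o, uhat E k.+1 o, xis E k.+1 i o, bs E k.+1 i o) =
  \int[P]_o H (o, uhat E k.+1 o, xigen E k.+1 o, bvec E k.+1 o).
Proof.
move=> mH iH.
have [] := @transfer_integral _ _ _ P (past_gen E k) (@past_gen_measurable R d E k)
  _ _ _ _ _ _ (uhat E k.+1) (uhat E k.+1) (xigen E k.+1) (xis E k.+1 i)
  (bvec E k.+1) (bs E k.+1 i) H _ _ _ _ _ _ (@indep_generic k) (@indep_samples k i) _ _ _ mH.
- by [].
- by [].
- by [].
- by [].
- by [].
- by [].
- by move=> B mB.
- move=> B mB; rewrite [LHS](xigen_law Hsamp (ltn0Sn k) mB).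
  by rewrite [RHS](xis_law Hsamp i (ltn0Sn k) mB).
- by move=> B mB; rewrite [RHS](bs_law Hsamp i (ltn0Sn k) mB).
by move=> i12 E12; split; [exact/i12|rewrite E12].
Qed.

Lemma measurable_model k : measurable_fun setT
  (fun q : g_sigma_algebraType (past_gen E k) * 'rV[R]_d * 'rV[R]_(dim_xi E) *
     'rV[R]_(dim_b E) => gradF E (iterate E k.+1 q.1.1.1 + q.1.1.2, q.1.2, q.2)).
Proof.
apply: measurableT_comp => //.
do 2 apply: measurable_fun_pair => //; last first.
  by apply: measurableT_comp => //; exact: measurable_snd.
apply: measurable_rV_add.
  apply: (measurableT_comp (@smeas_iterate _ _ _ _ _ Hit mG k)).
  apply: measurableT_comp; first exact: measurable_fst.
  by apply: measurableT_comp; exact: measurable_fst.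
apply: measurableT_comp; first exact: measurable_snd.
by apply: measurableT_comp; exact: measurable_fst.
Qed.

Lemma measurable_gen k : measurable_fun setT (@gradient_estimate R d E k.+1).
Proof.
apply: measurableT_comp => //; do 2 apply: measurable_fun_pair => //.
by apply: measurable_rV_add => //; exact: measurable_iterate.
Qed.

Lemma measurable_batch_grad k i : measurable_fun setT (batch_grad k.+1 i).
Proof.
apply: measurableT_comp => //; do 2 apply: measurable_fun_pair => //.
by apply: measurable_rV_add => //; exact: measurable_iterate.
Qed.

Lemma measurable_mean_grad k : measurable_fun setT (mean_grad k.+1).
Proof.
apply: (@measurable_rV_scale _ _ _ _ (fun=> M%:R^-1)); first exact: measurable_cst.
by apply: measurable_rV_sum => i; exact: measurable_batch_grad.
Qed.

Lemma measurable_sqnorm (dT : measure_display) (T : measurableType dT) n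
    (X : T -> 'rV[R]_n) : measurable_fun setT X ->
  measurable_fun setT (fun o => l2norm (X o) ^+ 2).
Proof. by move=> mX; under eq_fun do rewrite l2normE; exact: measurable_dotv. Qed.

Lemma gen_moment k :
  P.-integrable setT (EFin \o (fun o => l2norm (@gradient_estimate R d E k.+1 o) ^+ 2)) /\
  \int[P]_o (l2norm (@gradient_estimate R d E k.+1 o) ^+ 2) <= c2 * Q.
Proof.
have [_ [Z [iX iZ _ XZ] ZQ]] := Hgrad (ltn0Sn k); split => //.
have ET : @sigma_past R d E k setT.
  exact: (@measurableT _ (g_sigma_algebraType (past_gen E k))).
have -> : \int[P]_o (l2norm (@gradient_estimate R d E k.+1 o) ^+ 2) = \int[P]_o Z o.
  by rewrite /Rintegral -(XZ _ ET).
rewrite -[leRHS](Rintegral_cst_prob P); apply: ae_le_Rintegral => //.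
exact: finite_measure_integrable_cst.
Qed.

Lemma batch_moment k i :
  P.-integrable setT (EFin \o (fun o => l2norm (batch_grad k.+1 i o) ^+ 2)) /\
  \int[P]_o (l2norm (batch_grad k.+1 i o) ^+ 2) <= c2 * Q.
Proof.
have [i1 b1] := gen_moment k.
have [i2 E2] := transfer_generic i (measurable_sqnorm (@measurable_model k)) i1.
by split; [exact: i2|rewrite [leLHS]E2].
Qed.

Lemma dotv_suml (I : Type) (s : seq I) (X : I -> 'rV[R]_d) (v : 'rV[R]_d) :
  dotv (\sum_(i <- s) X i) v = \sum_(i <- s) dotv (X i) v.
Proof.
elim: s => [|i s IH]; last by rewrite !big_cons dotvDl IH.
by rewrite !big_nil -[0 : 'rV_d](scale0r 0) dotvZl mul0r.
Qed.

Let M_gt0 : 0 < M%:R :> R.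
Proof. by rewrite ltr0n; exact: batch_gt0 Hsamp. Qed.

Lemma dotv_mean k o v :
  dotv (mean_grad k o) v = M%:R^-1 * \sum_(i < M) dotv (batch_grad k i o) v.
Proof. by rewrite dotvZl dotv_suml. Qed.

(** Jensen's inequality, from <G_i, S> <= (|G_i|^2 + |S|^2) / 2 averaged over i,
    as the average of the left sides is |S|^2. *)
Lemma mean_grad_sqnorm k o :
  l2norm (mean_grad k o) ^+ 2 <= M%:R^-1 * \sum_(i < M) l2norm (batch_grad k i o) ^+ 2.
Proof.
set S := mean_grad k o; set s := \sum_(i < M) _.
have : l2norm S ^+ 2 <= M%:R^-1 * \sum_(i < M) ((l2norm (batch_grad k i o) ^+ 2 + l2norm S ^+ 2) / 2).
  rewrite {1}l2normE dotv_mean; apply: ler_wpM2l; first by rewrite invr_ge0 ltW.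
  by apply: ler_sum => i _; exact: dotv_le_sqr.
rewrite -mulr_suml big_split/= sumr_const card_ord -/s.
have -> : M%:R^-1 * ((s + l2norm S ^+ 2 *+ M) / 2) = (M%:R^-1 * s + l2norm S ^+ 2) / 2.
  by rewrite -mulr_natl; field; rewrite gt_eqF.
lra.
Qed.

Lemma mean_moment k :
  P.-integrable setT (EFin \o (fun o => l2norm (mean_grad k.+1 o) ^+ 2)) /\
  \int[P]_o (l2norm (mean_grad k.+1 o) ^+ 2) <= c2 * Q.
Proof.
have ib i := (batch_moment k i).1; have bb i := (batch_moment k i).2.
have is_ := integrable_sum_real (index_enum 'I_M) ib.
have iA : P.-integrable setT (EFin \o (fun o => M%:R^-1 * \sum_(i < M) l2norm (batch_grad k.+1 i o) ^+ 2)).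
  by have := integrableZl measurableT M%:R^-1 is_; apply: eq_integrable.
have iS : P.-integrable setT (EFin \o (fun o => l2norm (mean_grad k.+1 o) ^+ 2)).
  apply: (ae_le_integrable _ iA); first exact/measurable_sqnorm/measurable_mean_grad.
  by apply: aeW => o; rewrite ger0_norm ?sqr_ge0//; exact: mean_grad_sqnorm.
split => //.
apply: (@le_trans _ _ (\int[P]_o (M%:R^-1 * \sum_(i < M) l2norm (batch_grad k.+1 i o) ^+ 2))).
  by apply: ae_le_Rintegral => //; apply: aeW => o; exact: mean_grad_sqnorm.
rewrite RintegralZl// Rintegral_sum// ler_pdivrMl//.
have -> : M%:R * (c2 * Q) = \sum_(i < M) (c2 * Q).
  by rewrite sumr_const card_ord mulr_natl.
by apply: ler_sum => i _.
Qed.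

Lemma smeas_PsiU k : smeas (past_gen E k) (PsiU E k.+1).
Proof. by have [[_ mU] _ _ _] := Hstep (ltn0Sn k); exact/smeas_sigma_rv. Qed.

Lemma measurable_PsiU k : measurable_fun setT (PsiU E k.+1).
Proof. exact: (sub_sigma_measurable_fun (@past_gen_measurable R d E k) (@smeas_PsiU k)). Qed.

Lemma integrable_inner k (G : Omega E -> 'rV[R]_d) : measurable_fun setT G ->
  P.-integrable setT (EFin \o (fun o => l2norm (G o) ^+ 2)) ->
  P.-integrable setT (EFin \o (fun o => PsiU E k.+1 o * dotv (G o) (sgrad k.+1 o))).
Proof.
move=> mG' iG.
have ic : P.-integrable setT (EFin \o (fun=> psiu * L0 ^+ 2)).
  exact: finite_measure_integrable_cst.
apply: (ae_le_integrable _ (integrable_lin psiu ic iG)).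
  apply: measurable_funM; first exact: measurable_PsiU.
  by apply: measurable_dotv => //; exact: measurable_sgrad.
apply: filterS (ae_stepsize k) => o [/andP[p1 p2] _ _ _].
have p0 : 0 <= PsiU E k.+1 o by exact: le_trans (ltW psil_gt0) p1.
rewrite normrM ger0_norm// -mulrDr.
apply: ler_pM => //.
have g2 : l2norm (sgrad k.+1 o) ^+ 2 <= L0 ^+ 2.
  by rewrite ler_pXn2r ?nnegrE ?l2norm_ge0// sgrad_bounded.
have := dotv_le_sqr (G o) (sgrad k.+1 o).
have := dotv_le_sqr (- G o) (sgrad k.+1 o).
rewrite l2normN -scaleN1r dotvZl mulN1r => H1 H2.
have := sqr_ge0 (l2norm (G o)); have := sqr_ge0 L0.
by rewrite ler_norml; move=> *; apply/andP; split; lra.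
Qed.

Lemma integrable_sgrad2 k : P.-integrable setT (EFin \o (fun o => l2norm (sgrad k.+1 o) ^+ 2)).
Proof.
apply: (bounded_integrable P (measurable_sqnorm (@measurable_sgrad k)) (M := L0 ^+ 2)) => o.
by rewrite ger0_norm ?sqr_ge0// ler_pXn2r ?nnegrE ?l2norm_ge0// sgrad_bounded.
Qed.

(** PsiU and the gradient of the smoothing are known from the past, so the
    gradient estimate can be replaced by its conditional expectation. *)
Lemma inner_gen k :
  c1 * psil * \int[P]_o (l2norm (sgrad k.+1 o) ^+ 2) <=
  \int[P]_o (PsiU E k.+1 o * dotv (@gradient_estimate R d E k.+1 o) (sgrad k.+1 o)).
Proof.
have [[Y YE Yge] _] := Hgrad (ltn0Sn k).
have iX j : P.-integrable setT (EFin \o (fun o => @gradient_estimate R d E k.+1 o 0 j)).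
  by case: (YE j).
have iY j : P.-integrable setT (EFin \o (fun o => Y o 0 j)) by case: (YE j).
pose X j o := PsiU E k.+1 o * sgrad k.+1 o 0 j.
have sX j : smeas (past_gen E k) (X j).
  apply: measurable_funM; first exact: smeas_PsiU.
  by have /measurable_rV_coordP := @smeas_sgrad k; apply.
have mX j : measurable_fun setT (X j).
  exact: (sub_sigma_measurable_fun (@past_gen_measurable R d E k) (sX j)).
have iXZ (Z : Omega E -> R) j : P.-integrable setT (EFin \o Z) ->
    P.-integrable setT (EFin \o (fun o => X j o * Z o)).
  move=> iZ; have mZ : measurable_fun setT Z by exact/measurable_EFinP/(measurable_int _ iZ).
  have iN : P.-integrable setT (EFin \o (fun o => psiu * L0 * `|Z o|)).
    by have := integrableZl measurableT (psiu * L0) (integrable_norm iZ); apply: eq_integrable.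
  apply: (ae_le_integrable _ iN); first exact: measurable_funM.
  apply: filterS (ae_stepsize k) => o [/andP[p1 p2] _ _ _].
  have p0 : 0 <= PsiU E k.+1 o by exact: le_trans (ltW psil_gt0) p1.
  rewrite /X !normrM ger0_norm// ler_wpM2r// ler_pM//.
  exact: le_trans (coord_le_l2norm _ _) (sgrad_bounded _ _).
have -> : \int[P]_o (PsiU E k.+1 o * dotv (@gradient_estimate R d E k.+1 o) (sgrad k.+1 o))
   = \sum_j \int[P]_o (X j o * Y o 0 j).
  transitivity (\sum_j \int[P]_o (X j o * @gradient_estimate R d E k.+1 o 0 j)).
    rewrite -Rintegral_sum; last by move=> j; exact: iXZ.
    apply: eq_Rintegral => o _; rewrite mulr_sumr; apply: eq_bigr => j _.
    by rewrite /X; ring.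
  apply: eq_bigr => j _; apply: (cond_exp_pull_out (@past_gen_measurable R d E k) (YE j) (sX j)); exact: iXZ.
rewrite -Rintegral_sum; last by move=> j; exact: iXZ.
rewrite -RintegralZl//; last exact: integrable_sgrad2.
apply: ae_le_Rintegral.
- by have := integrableZl measurableT (c1 * psil) (integrable_sgrad2 k); apply: eq_integrable.
- by apply: integrable_sum_real => j; exact: iXZ.
apply: filterS2 (ae_stepsize k) Yge => o [/andP[p1 p2] _ _ _] /= Yo.
have -> : \sum_j X j o * Y o 0 j = PsiU E k.+1 o * dotv (Y o) (sgrad k.+1 o).
  by rewrite mulr_sumr; apply: eq_bigr => j _; rewrite /X; ring.
apply: (@le_trans _ _ (PsiU E k.+1 o * (c1 * l2norm (sgrad k.+1 o) ^+ 2))).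
  rewrite (mulrC c1) -mulrA ler_wpM2r// mulr_ge0// ?sqr_ge0// ltW//.
rewrite ler_wpM2l//; exact: le_trans (ltW psil_gt0) p1.
Qed.

Lemma inner_mean k :
  c1 * psil * \int[P]_o (l2norm (sgrad k.+1 o) ^+ 2) <=
  \int[P]_o (PsiU E k.+1 o * dotv (mean_grad k.+1 o) (sgrad k.+1 o)).
Proof.
pose H (q : g_sigma_algebraType (past_gen E k) * 'rV[R]_d * 'rV[R]_(dim_xi E) *
     'rV[R]_(dim_b E)) := PsiU E k.+1 q.1.1.1 *
  dotv (gradF E (iterate E k.+1 q.1.1.1 + q.1.1.2, q.1.2, q.2)) (sgrad k.+1 q.1.1.1).
have m111 : measurable_fun setT (fun q : g_sigma_algebraType (past_gen E k) * 'rV[R]_d * 'rV[R]_(dim_xi E) *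
     'rV[R]_(dim_b E) => q.1.1.1).
  apply: measurableT_comp; first exact: measurable_fst.
  by apply: measurableT_comp; exact: measurable_fst.
have mH : measurable_fun setT H.
  apply: measurable_funM; first exact: (measurableT_comp (@smeas_PsiU k)).
  apply: measurable_dotv; first exact: measurable_model.
  exact: (measurableT_comp (@smeas_sgrad k)).
have iB i := integrable_inner k (@measurable_batch_grad k i) (batch_moment k i).1.
have iG := integrable_inner k (@measurable_gen k) (gen_moment k).1.
have EB i : \int[P]_o (PsiU E k.+1 o * dotv (batch_grad k.+1 i o) (sgrad k.+1 o)) =
    \int[P]_o (PsiU E k.+1 o * dotv (@gradient_estimate R d E k.+1 o) (sgrad k.+1 o)).
  by have [_] := transfer_generic i mH iG.
have -> : \int[P]_o (PsiU E k.+1 o * dotv (mean_grad k.+1 o) (sgrad k.+1 o)) =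
    M%:R^-1 * \sum_(i < M) \int[P]_o (PsiU E k.+1 o * dotv (batch_grad k.+1 i o) (sgrad k.+1 o)).
  rewrite -Rintegral_sum// -RintegralZl//; last exact: integrable_sum_real.
  by apply: eq_Rintegral => o _; rewrite dotv_mean -mulr_sumr mulrCA.
under eq_bigr do rewrite EB.
rewrite sumr_const card_ord -[X in _ <= _ * X]mulr_natl mulrA mulVf ?gt_eqF// mul1r.
exact: inner_gen.
Qed.

(** The sigma-algebra given which the error has mean 0. *)
Definition err_gen k : set_system (Omega E) :=
  @sigma_past R d E k `|` @sigma_step R d E k.+1.

Lemma err_gen_measurable k : err_gen k `<=` measurable.
Proof.
by move=> A [/sigma_past_measurable|/sigma_step_measurable].
Qed.

Lemma past_err k : <<s past_gen E k >> `<=` <<s err_gen k >>.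
Proof. by move=> A HA; apply: sub_sigma_algebra; left. Qed.

Lemma step_err k : <<s step_gen E k.+1 >> `<=` <<s err_gen k >>.
Proof. by move=> A HA; apply: sub_sigma_algebra; right. Qed.

Lemma err_moment k :
  P.-integrable setT (EFin \o (fun o => l2norm (ehat E k.+1 o) ^+ 2)) /\
  \int[P]_o (l2norm (ehat E k.+1 o) ^+ 2) <= c3 * eta ^+ 2.
Proof.
have [_ [Z [iX iZ _ XZ] ZQ]] := Herr (ltn0Sn k); split => //.
have ET : @sigma_past R d E k setT.
  exact: (@measurableT _ (g_sigma_algebraType (past_gen E k))).
have -> : \int[P]_o (l2norm (ehat E k.+1 o) ^+ 2) = \int[P]_o Z o.
  by rewrite /Rintegral -(XZ _ ET).
rewrite -[leRHS](Rintegral_cst_prob P); apply: ae_le_Rintegral => //.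
exact: finite_measure_integrable_cst.
Qed.

(** X is known when the error is drawn, and the conditional mean of the error
    is 0. *)
Lemma cross_term k (X : Omega E -> 'rV[R]_d) : smeas (err_gen k) X ->
  P.-integrable setT (EFin \o (fun o => l2norm (X o) ^+ 2)) ->
  P.-integrable setT (EFin \o (fun o => dotv (X o) (ehat E k.+1 o))) /\
  \int[P]_o dotv (X o) (ehat E k.+1 o) = 0.
Proof.
move=> sX iX; have [ie _] := err_moment k.
have [[Y YE Y0] _] := Herr (ltn0Sn k).
have mX : measurable_fun setT X := sub_sigma_measurable_fun (@err_gen_measurable k) sX.
have i2 j : P.-integrable setT (EFin \o (fun o => X o 0 j * ehat E k.+1 o 0 j)).
  apply: (ae_le_integrable _ (integrable_lin 1 iX ie)).
    apply: measurable_funM; first by have /measurable_rV_coordP := mX; apply.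
    have me : measurable_fun setT (ehat E k.+1) by [].
    by have /measurable_rV_coordP := me; apply.
  apply: aeW => o; rewrite mul1r normrM.
  have h1 := coord_le_l2norm (X o) j; have h2 := coord_le_l2norm (ehat E k.+1 o) j.
  apply: (le_trans (ler_pM _ _ h1 h2)) => //.
  have := sqr_ge0 (l2norm (X o) - l2norm (ehat E k.+1 o)).
  have := sqr_ge0 (l2norm (X o)); have := sqr_ge0 (l2norm (ehat E k.+1 o)).
  by rewrite sqrrB; lra.
split; first exact: integrable_sum_real.
rewrite Rintegral_sum// big1// => j _.
have i0 : P.-integrable setT (EFin \o (fun=> 0 : R)) by exact: finite_measure_integrable_cst.
have mY : measurable_fun setT (fun o => Y o 0 j).
  by have [_ iY _ _] := YE j; exact/measurable_EFinP/(measurable_int _ iY).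
have mXj : measurable_fun setT (fun o => X o 0 j) by have /measurable_rV_coordP := mX; apply.
have XY0 : {ae P, forall o, X o 0 j * Y o 0 j = 0}.
  by apply: filterS Y0 => o ->; rewrite mxE mulr0.
have iXY : P.-integrable setT (EFin \o (fun o => X o 0 j * Y o 0 j)).
  apply: (ae_le_integrable _ i0); first exact: measurable_funM.
  by apply: filterS XY0 => o ->; rewrite normr0.
have sXj : smeas (err_gen k) (fun o => X o 0 j).
  by have /measurable_rV_coordP := sX; apply.
rewrite (cond_exp_pull_out (@err_gen_measurable k) (YE j) sXj)//.
apply/le_anti/andP; split.
  rewrite -[leRHS](Rintegral_cst_prob P); apply: ae_le_Rintegral => //.
  by apply: filterS XY0 => o ->.
rewrite -[leLHS](Rintegral_cst_prob P); apply: ae_le_Rintegral => //.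
by apply: filterS XY0 => o ->.
Qed.

Lemma smeas_mean_grad k : smeas (err_gen k) (mean_grad k.+1).
Proof.
apply: (@measurable_rV_scale _ _ _ _ (fun=> M%:R^-1)); first exact: measurable_cst.
apply: measurable_rV_sum => i; apply: smeas_gradF => //.
- apply: measurable_rV_add.
    exact: (smeasS (@past_err k) (@smeas_iterate _ _ _ _ _ Hit mG k)).
  exact: (smeasS (@step_err k) (@smeas_uhat _ _ E k.+1)).
- exact: (smeasS (@step_err k) (@smeas_xis _ _ E k.+1 i)).
- exact: (smeasS (@step_err k) (@smeas_bs _ _ E k.+1 i)).
Qed.

Let C := Num.sqrt d%:R * L0 / alpha.
Let del := c4 * (eta / alpha).

Let C_ge0 : 0 <= C.
Proof. by apply: divr_ge0; [apply: mulr_ge0 => //; exact: sqrtr_ge0|exact: ltW]. Qed.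

Let del_ge0 : 0 <= del.
Proof. by apply: mulr_ge0; [exact: ltW|apply: divr_ge0; exact: ltW]. Qed.

Lemma measurable_smoothing_iterate k : measurable_fun setT (fun o => fa (iterate E k.+1 o)).
Proof.
apply: (@measurableT_comp _ _ _ _ _ _ fa); last exact: measurable_iterate.
apply: continuous_rV_measurable.
exact: lipschitz2_continuous L0_ge0 (smoothing_lipschitz L0_ge0 fL alpha0).
Qed.

(** The descent inequality for the step e - eta psi S, where psi has been
    replaced by PsiU in front of <S, g>. The right side is written as a chain of
    sums h1 + c * h2 so that it integrates term by term with Rintegral_lin. *)
Lemma smoothing_step k : {ae P, forall o,
  fa (iterate E k.+2 o) <= fa (iterate E k.+1 o)
   + (- eta) * (PsiU E k.+1 o * dotv (mean_grad k.+1 o) (sgrad k.+1 o))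
   + (eta * del / 2 + C / 2 * (eta ^+ 2 * psiu ^+ 2)) * l2norm (mean_grad k.+1 o) ^+ 2
   + (eta * del / 2) * l2norm (sgrad k.+1 o) ^+ 2
   + 1 * dotv (sgrad k.+1 o) (ehat E k.+1 o)
   + (C / 2) * l2norm (ehat E k.+1 o) ^+ 2
   + (- (C * eta)) * dotv (psi E k.+1 o *: mean_grad k.+1 o) (ehat E k.+1 o)}.
Proof.
apply: filterS (ae_stepsize k) => o [_ gap0 gap /andP[psi0 psi1]].
set S := mean_grad k.+1 o; set e := ehat E k.+1 o; set g := sgrad k.+1 o.
set p := psi E k.+1 o; set pU := PsiU E k.+1 o.
have [_ itS] := Hit.
have -> : iterate E k.+2 o = iterate E k.+1 o + (e - (eta * p) *: S).
  rewrite itS// -addrA [- _ + _]addrC /S /mean_grad scalerA; congr (_ + (_ - _)).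
clearbody S e.
have := smoothing_descent L0_ge0 fL alpha0 (iterate E k.+1 o) (e - (eta * p) *: S).
move/le_trans; apply.
rewrite -/(sgrad k.+1 o) -/g -/C.
have -> : dotv g (e - (eta * p) *: S) = dotv g e - eta * p * dotv S g.
  by rewrite dotvBr dotvZr (dotvC g S).
have -> : l2norm (e - (eta * p) *: S) ^+ 2 = l2norm e ^+ 2 - 2 * (eta * p) * dotv S e
    + (eta * p) ^+ 2 * l2norm S ^+ 2.
  by rewrite !l2normE dotvBl !dotvBr !dotvZl !dotvZr (dotvC e S); ring.
rewrite dotvZl.
set x := dotv S g; set y := dotv S e; set z := dotv g e.
set s2 := l2norm S ^+ 2; set g2 := l2norm g ^+ 2; set e2 := l2norm e ^+ 2.
have s20 : 0 <= s2 by exact: sqr_ge0.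
have g20 : 0 <= g2 by exact: sqr_ge0.
have h1 : (pU - p) * x <= del * ((s2 + g2) / 2).
  apply: (@le_trans _ _ ((pU - p) * ((s2 + g2) / 2))).
    by rewrite ler_wpM2l//; exact: dotv_le_sqr.
  by rewrite ler_wpM2r// divr_ge0// addr_ge0.
have h2 : eta * ((pU - p) * x) <= eta * (del * ((s2 + g2) / 2)).
  by rewrite ler_wpM2l// ltW.
have p2 : p ^+ 2 <= psiu ^+ 2 by rewrite ler_pXn2r ?nnegrE// (le_trans psi0).
have h3 : C / 2 * (eta ^+ 2 * (p ^+ 2 * s2)) <= C / 2 * (eta ^+ 2 * (psiu ^+ 2 * s2)).
  apply: ler_wpM2l; first by rewrite divr_ge0.
  by apply: ler_wpM2l; [exact: sqr_ge0|exact: ler_wpM2r].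
have -> : eta * p * x = eta * (pU * x) - eta * ((pU - p) * x) by ring.
lra.
Qed.

(** Integrability of the next value comes from its being non-negative and below
    an integrable function. *)
Lemma smoothing_expected_step k :
  P.-integrable setT (EFin \o (fun o => fa (iterate E k.+1 o))) ->
  P.-integrable setT (EFin \o (fun o => fa (iterate E k.+2 o))) /\
  \int[P]_o fa (iterate E k.+2 o) <= \int[P]_o fa (iterate E k.+1 o)
    - eta * (c1 * psil - del / 2) * \int[P]_o (l2norm (sgrad k.+1 o) ^+ 2)
    + eta * del / 2 * (c2 * Q) + C / 2 * (eta ^+ 2 * (psiu ^+ 2 * c2 * Q + c3)).
Proof.
move=> i0.
have [iS bS] := mean_moment k; have [ie be] := err_moment k.
have iI := integrable_inner k (@measurable_mean_grad k) iS.
have ig := integrable_sgrad2 k.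
have sg : smeas (err_gen k) (sgrad k.+1) := smeasS (@past_err k) (@smeas_sgrad k).
have [ix1 x1] := cross_term sg ig.
have spS : smeas (err_gen k) (fun o => psi E k.+1 o *: mean_grad k.+1 o).
  apply: measurable_rV_scale; last exact: smeas_mean_grad.
  exact: (smeasS (@step_err k) (@smeas_psi _ _ E k.+1)).
have ipS : P.-integrable setT (EFin \o (fun o => l2norm (psi E k.+1 o *: mean_grad k.+1 o) ^+ 2)).
  have iN : P.-integrable setT (EFin \o (fun o => psiu ^+ 2 * l2norm (mean_grad k.+1 o) ^+ 2)).
    by have := integrableZl measurableT (psiu ^+ 2) iS; apply: eq_integrable.
  apply: (ae_le_integrable _ iN).
    apply: measurable_sqnorm; exact: (sub_sigma_measurable_fun (@err_gen_measurable k) spS).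
  apply: filterS (ae_stepsize k) => o [_ _ _ /andP[psi0 psi1]].
  rewrite ger0_norm ?sqr_ge0// l2normZ exprMn ler_wpM2r ?sqr_ge0//.
  by rewrite ger0_norm// ler_pXn2r ?nnegrE// (le_trans psi0).
have [ix2 x2] := cross_term spS ipS.
have j1 := integrable_lin (- eta) i0 iI.
have j2 := integrable_lin (eta * del / 2 + C / 2 * (eta ^+ 2 * psiu ^+ 2)) j1 iS.
have j3 := integrable_lin (eta * del / 2) j2 ig.
have j4 := integrable_lin 1 j3 ix1.
have j5 := integrable_lin (C / 2) j4 ie.
have j6 := integrable_lin (- (C * eta)) j5 ix2.
have st := smoothing_step k.
have i1 : P.-integrable setT (EFin \o (fun o => fa (iterate E k.+2 o))).
  apply: (ae_le_integrable _ j6); first exact: measurable_smoothing_iterate.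
  apply: filterS st => o so; rewrite ger0_norm//.
  exact: smoothing_ge0 (loss_ge0 Hloss).
split => //; apply: (le_trans (ae_le_Rintegral i1 j6 st)).
rewrite !Rintegral_lin// x1 x2 !mulr0 !addr0.
have := inner_mean k.
set G2 := (\int[P]_o (l2norm (sgrad k.+1 o) ^+ 2)).
set I2 := (\int[P]_o (PsiU E k.+1 o * _)) => hI.
have h1 : eta * (c1 * psil * G2) <= eta * I2 by rewrite ler_wpM2l// ltW.
have cc : 0 <= eta * del / 2 + C / 2 * (eta ^+ 2 * psiu ^+ 2).
  apply: addr_ge0; first by apply: divr_ge0 => //; apply: mulr_ge0 => //; exact: ltW.
  apply: mulr_ge0; first exact: divr_ge0.
  by apply: mulr_ge0; exact: sqr_ge0.
have h2 := ler_wpM2l cc bS.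
have C2 : 0 <= C / 2 by rewrite divr_ge0.
have h3 := ler_wpM2l C2 be.
lra.
Qed.

Lemma integrable_smoothing_iterate k :
  P.-integrable setT (EFin \o (fun o => fa (iterate E k.+1 o))).
Proof.
elim: k => [|k IH]; last by have [] := smoothing_expected_step IH.
have [it1 _] := Hit.
rewrite (_ : (fun o => _) = cst (fa w1)); first exact: finite_measure_integrable_cst.
by apply/funext => o; rewrite it1.
Qed.

Lemma telescoped_descent K :
  \int[P]_o fa (iterate E K.+1 o)
  + eta * (c1 * psil - del / 2) * \sum_(k < K) \int[P]_o (l2norm (sgrad k.+1 o) ^+ 2)
  <= fa w1 + K%:R * (eta * del / 2 * (c2 * Q)
       + C / 2 * (eta ^+ 2 * (psiu ^+ 2 * c2 * Q + c3))).
Proof.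
elim: K => [|K IH].
  have [it1 _] := Hit.
  under eq_Rintegral do rewrite it1.
  by rewrite Rintegral_cst_prob big_ord0 mulr0 mul0r !addr0.
have [_ H] := smoothing_expected_step (@integrable_smoothing_iterate K).
move: IH H; rewrite big_ord_recr/= -[K.+1%:R]natr1.
set B := (X in K%:R * X); set S := \sum_(k < K) _; set c := eta * _.
set G2 := (\int[P]_o (l2norm _ ^+ 2)) => IH H; rewrite -/B.
have {}H : \int[P]_o fa (iterate E K.+2 o) <=
    \int[P]_o fa (iterate E K.+1 o) - c * G2 + B by rewrite /B addrA.
clearbody B S c G2; lra.
Qed.

(** When del <= c1 psil, at least half of the decrease of each step is left
    after the price of the gap; the last value of the smoothed loss, being
    non-negative, is dropped. *)
Lemma average_grad_bound K : (0 < K)%N -> del <= c1 * psil ->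
  K%:R^-1 * \sum_(k < K) \int[P]_o (l2norm (sgrad k.+1 o) ^+ 2)
  <= 2 / (eta * (c1 * psil) * K%:R) * fa w1 + del / (c1 * psil) * (c2 * Q)
     + C * eta / (c1 * psil) * (psiu ^+ 2 * c2 * Q + c3).
Proof.
move=> K0 dc; have := telescoped_descent K.
set S := \sum_(k < K) _.
have S0 : 0 <= S by apply: sumr_ge0 => k _; apply: Rintegral_ge0 => o _; exact: sqr_ge0.
have I0 : 0 <= \int[P]_o fa (iterate E K.+1 o).
  by apply: Rintegral_ge0 => o _; exact: smoothing_ge0 (loss_ge0 Hloss).
have cp : 0 < c1 * psil by exact: mulr_gt0.
have KR : 0 < K%:R :> R by rewrite ltr0n.
have h : eta * (c1 * psil / 2) * S <= eta * (c1 * psil - del / 2) * S.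
  by apply: ler_wpM2r => //; apply: ler_wpM2l; [exact: ltW|lra].
set B := (X in K%:R * X) => H.
have {}H : eta * (c1 * psil / 2) * S <= fa w1 + K%:R * B by lra.
have c0 : 0 < eta * (c1 * psil) * K%:R / 2 by rewrite divr_gt0// mulr_gt0// mulr_gt0.
rewrite -(ler_pM2l c0).
have -> : eta * (c1 * psil) * K%:R / 2 * (K%:R^-1 * S) = eta * (c1 * psil / 2) * S.
  by field; rewrite gt_eqF.
apply: (le_trans H); rewrite le_eqVlt; apply/orP; left; apply/eqP.
by rewrite /B; field; rewrite !gt_eqF.
Qed.

(** * The random output *)

Section Output.
Variable K : nat.
Hypothesis K0 : (0 < K)%N.
Hypothesis Hout : is_uniform_output E K.

(** F is bounded by H, a measurable function of the run and of khat that equals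
    h khat on the event khat < K. By independence each indicator of khat = k can
    be replaced by its probability 1 / K. The event khat >= K is null. *)
Lemma output_integral_le (h : nat -> Omega E -> R) (B : R)
    (F : Omega E -> \bar R) :
  (forall k, smeas (past_gen E k) (h k)) -> (forall k o, 0 <= h k o <= B) ->
  (forall o, 0 <= F o <= (h (khat E o) o)%:E)%E ->
  (\int[P]_o F o <= (K%:R^-1 * \sum_(k < K) \int[P]_o h k o)%:E)%E.
Proof.
move=> sh hB FB.
have [Pk ind] := Hout.
pose U := \bigcup_k @sigma_past R d E k.
have UT : U `<=` measurable by move=> A [k _]; exact: sigma_past_measurable.
have mkh : measurable_fun setT (khat E) by [].
have mk j : measurable [set o | khat E o = j].
  have := mkh measurableT [set j] _; rewrite setTI; exact.
have mh k : measurable_fun setT (h k).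
  exact: (sub_sigma_measurable_fun (@past_gen_measurable R d E k) (sh k)).
have h0 k o : 0 <= h k o by have /andP[] := hB k o.
have B0 : 0 <= B by have /andP[h1 h2] := hB 0%N point; exact: le_trans h2.
pose H (o : Omega E) : R := \sum_(k < K) \1_[set o | khat E o = k] o * h k o
   + \1_[set o | (K <= khat E o)%N] o * B.
have mKle : measurable [set o | (K <= khat E o)%N].
  have := mkh measurableT [set n | (K <= n)%N] _; rewrite setTI; exact.
have PK : P [set o | (K <= khat E o)%N] = 0%E.
  have -> : [set o | (K <= khat E o)%N] = ~` \big[setU/set0]_(k < K) [set o | khat E o = k].
    rewrite -(bigcup_mkord K (fun k => [set o | khat E o = k])).
    apply/seteqP; split => o /=.
      by move=> Kk [k /= kK E1]; move: Kk; rewrite E1 leqNgt kK.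
    by rewrite leqNgt => nK; apply/negP => kK; apply: nK; exists (khat E o).
  rewrite probability_setC; last by apply: bigsetU_measurable => k _; exact: mk.
  have -> : P (\big[setU/set0]_(k < K) [set o | khat E o = k]) =
      (\sum_(k < K) P [set o | khat E o = k])%E.
    apply: (@measure_bigsetU_ord _ _ _ P K xpredT (fun k : 'I_K => [set o | khat E o = k])).
      by move=> k; exact: mk.
    apply/trivIsetP => i j _ _ ij; apply/seteqP; split => o //= [-> ji].
    by move: ij; rewrite (val_inj ji) eqxx.
  under eq_bigr do rewrite Pk//.
  rewrite sumEFin sumr_const card_ord -[X in (1 - X%:E)%E]mulr_natl.
  by rewrite mulfV ?subee// pnatr_eq0 -lt0n.
have FH o : (F o <= (H o)%:E)%E.
  have /andP[_ Fo] := FB o; apply: (le_trans Fo); rewrite lee_fin /H.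
  have [kK|Kk] := ltnP (khat E o) K.
    rewrite (bigD1 (Ordinal kK))//= indicE mem_set// mul1r -addrA lerDl addr_ge0//.
      by apply: sumr_ge0 => j _; rewrite mulr_ge0.
    by rewrite mulr_ge0.
  rewrite [X in _ + X * _]indicE mem_set//= mul1r ler_wpDl//.
    by apply: sumr_ge0 => j _; rewrite mulr_ge0.
  by have /andP[] := hB (khat E o) o.
have H0 o : 0 <= H o.
  by rewrite /H addr_ge0 ?mulr_ge0// sumr_ge0// => j _; rewrite mulr_ge0.
have leFH : (\int[P]_o F o <= \int[P]_o (H o)%:E)%E.
  rewrite ge0_integralTE; last by move=> o; have /andP[] := FB o.
  rewrite ge0_integralTE; last by move=> o; rewrite lee_fin.
  apply: le_ereal_sup => _ [g gF <-]; exists g => //= o.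
  exact: le_trans (FH o).
apply: (le_trans leFH).
have ik (k : nat) : (k < K)%N ->
    P.-integrable setT (EFin \o (fun o => \1_[set o | khat E o = k] o * h k o)) /\
    \int[P]_o (\1_[set o | khat E o = k] o * h k o) = K%:R^-1 * \int[P]_o h k o.
  move=> kK; split.
    apply: (bounded_integrable P (M := B)).
      by apply: measurable_funM => //; exact: measurable_indic.
    move=> o; have /andP[hk0 hkB] := hB k o.
    by rewrite ger0_norm ?mulr_ge0// indicE; case: (_ \in _); rewrite ?mul1r ?mul0r.
  rewrite -RintegralZl//; last first.
    apply: (bounded_integrable P (M := B)) => // o.
    by have /andP[hk0 hkB] := hB k o; rewrite ger0_norm.
  have sX : measurable_fun setT (h k : g_sigma_algebraType U -> R).
    by apply: smeasS (sh k) => A HA; apply: sub_sigma_algebra; exists k.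
  have Kinv : 0 <= K%:R^-1 :> R by rewrite invr_ge0.
  have cond A : <<s U >> A -> (\int[P]_(o in A) (\1_[set o | khat E o = k] o)%:E =
      \int[P]_(o in A) (K%:R^-1)%:E)%E.
    move=> UA; have mA := sub_sigma_measurable UT UA.
    rewrite integral_indic// integral_cst//= setIC.
    rewrite (mutually_independent2 ind (A1 := [set o | khat E o = k]) UA) ?Pk// 1?muleC//.
    by exists [set k]; rewrite ?setTI.
  have m1 : measurable_fun setT (\1_[set o | khat E o = k] : Omega E -> R).
    exact: measurable_indic.
  have m2 : measurable_fun setT (fun _ : Omega E => K%:R^-1 : R) by exact: measurable_cst.
  have p1 o : 0 <= \1_[set o | khat E o = k] o :> R by [].
  have H1 := pull_out_ge0 UT m1 m2 p1 (fun=> Kinv) cond sX (h0 k).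
  congr fine; under eq_integral do rewrite mulrC.
  by rewrite H1//; apply: eq_integral => o _; rewrite mulrC.
have iS := integrable_sum_real (index_enum 'I_K) (fun k : 'I_K => (ik k (ltn_ord k)).1).
have iB : P.-integrable setT (EFin \o (fun o => \1_[set o | (K <= khat E o)%N] o * B)).
  apply: (bounded_integrable P (M := B)).
    by apply: measurable_funM => //; exact: measurable_indic.
  move=> o; rewrite ger0_norm ?mulr_ge0// indicE; case: (_ \in _); rewrite ?mul1r ?mul0r//.
have iH : P.-integrable setT (EFin \o H).
  by have := integrableD measurableT iS iB; apply: eq_integrable.
rewrite -[leLHS]fineK; last exact: integrable_fin_num.
rewrite lee_fin -/(Rintegral P setT H) /H RintegralD// Rintegral_sum; last first.
  by move=> k; exact: (ik k (ltn_ord k)).1.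
under eq_bigr => k _ do rewrite (ik k (ltn_ord k)).2.
rewrite mulr_sumr gerDl.
have -> : \int[P]_o (\1_[set o | (K <= khat E o)%N] o * B) = 0; last by [].
rewrite RintegralZr//; last first.
  apply: (bounded_integrable P (M := 1)) => [|o]; first exact: measurable_indic.
  by rewrite indicE; case: (_ \in _); rewrite ?normr1 ?normr0.
rewrite /Rintegral integral_indic// setIT.
by rewrite [fine _](congr1 fine PK) mul0r.
Qed.

Let avg := K%:R^-1 * \sum_(k < K) \int[P]_o (l2norm (sgrad k.+1 o) ^+ 2).

Lemma output_dist (o : Omega E) :
  (0 <= dist 0%R (clarke_cube alpha f (output o)) <=
   (l2norm (sgrad (khat E o).+1 o))%:E)%E.
Proof. by rewrite dist_ge0/=; exact: dist_clarke_le L0_ge0 fL _ _ _. Qed.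

Lemma output_dist_sq_le :
  (\int[P]_o (dist 0%R (clarke_cube alpha f (output o)) ^+ 2) <= avg%:E)%E.
Proof.
apply: (@output_integral_le (fun k o => l2norm (sgrad k.+1 o) ^+ 2) (L0 ^+ 2)).
- by move=> k; apply: measurable_sqnorm; exact: smeas_sgrad.
- move=> k o; rewrite sqr_ge0/= ler_pXn2r ?nnegrE ?l2norm_ge0//; exact: sgrad_bounded.
move=> o; have /andP[] := output_dist o.
case: (dist _ _) => [s| |] //; rewrite !lee_fin => s0 sg.
by rewrite -expr2 sqr_ge0/= ler_pXn2r ?nnegrE ?l2norm_ge0.
Qed.

(** The bound x <= (x^2 / nu + nu) / 2, applied to the distance, stands in for
    Jensen's inequality: it holds pointwise and so passes through
    output_integral_le. *)
Lemma output_dist_le (nu : R) : 0 < nu -> avg <= nu ^+ 2 ->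
  (\int[P]_o dist 0%R (clarke_cube alpha f (output o)) <= nu%:E)%E.
Proof.
move=> nu0 avgnu.
pose h k o := (l2norm (sgrad k.+1 o) ^+ 2 / nu + nu) / 2.
have nuV : 0 < nu^-1 by rewrite invr_gt0.
apply: (@le_trans _ _ (K%:R^-1 * \sum_(k < K) \int[P]_o h k o)%:E).
  apply: (@output_integral_le h ((L0 ^+ 2 / nu + nu) / 2)).
  - move=> k; apply: measurable_funM => //; apply: measurable_funD => //.
    by apply: measurable_funM => //; apply: measurable_sqnorm; exact: smeas_sgrad.
  - move=> k o; have g2 : l2norm (sgrad k.+1 o) ^+ 2 <= L0 ^+ 2.
      by rewrite ler_pXn2r ?nnegrE ?l2norm_ge0//; exact: sgrad_bounded.
    rewrite /h divr_ge0//=; last by rewrite addr_ge0 ?divr_ge0 ?sqr_ge0// ltW.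
    by rewrite ler_pM2r ?invr_gt0// lerD2r ler_pM2r.
  move=> o; have /andP[d0 dg] := output_dist o; rewrite d0/= (le_trans dg)// lee_fin /h.
  set x := l2norm _; rewrite ler_pdivlMr// -(ler_pM2l nu0).
  have -> : nu * (x ^+ 2 / nu + nu) = x ^+ 2 + nu ^+ 2 by field; rewrite gt_eqF.
  have := sqr_ge0 (x - nu); rewrite sqrrB; lra.
rewrite lee_fin.
have E1 k : \int[P]_o h k o = (2 * nu)^-1 * \int[P]_o (l2norm (sgrad k.+1 o) ^+ 2) + nu / 2.
  have ig := integrable_sgrad2 k.
  have ic : P.-integrable setT (EFin \o (fun=> nu / 2)) by exact: finite_measure_integrable_cst.
  rewrite addrC -[X in X + _](Rintegral_cst_prob P) -Rintegral_lin//.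
  by apply: eq_Rintegral => o _; rewrite /h; field; rewrite gt_eqF.
under eq_bigr do rewrite E1.
rewrite big_split/= -mulr_sumr sumr_const card_ord mulrDr mulrCA -/avg.
have -> : K%:R^-1 * ((nu / 2) *+ K) = nu / 2.
  by rewrite -[X in _ * X]mulr_natl mulKf// pnatr_eq0 -lt0n.
have : (2 * nu)^-1 * avg <= (2 * nu)^-1 * nu ^+ 2.
  by apply: ler_wpM2l => //; rewrite invr_ge0 mulr_ge0// ltW.
have -> : (2 * nu)^-1 * nu ^+ 2 = nu / 2 by field; rewrite gt_eqF.
lra.
Qed.

End Output.

End OneStep.

(** * The bound and the number of iterations *)

Section Final.
Context (R : realType) (d : nat) (f : 'rV[R]_d -> R) (L0 Q : R) (w1 : 'rV[R]_d).
Variables (c1 c2 c3 c4 c5 psil psiu : R).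
Hypotheses (d_gt0 : (0 < d)%N) (c1_gt0 : 0 < c1) (c4_gt0 : 0 < c4) (c5_gt0 : 0 < c5)
  (psil_gt0 : 0 < psil).

Let bound alpha (alpha_gt0 : 0 < alpha) (K : nat) :=
  2 / (c1 * c5 * psil) * smoothing alpha_gt0 f w1 / Num.sqrt K%:R
      + c2 * c4 * c5 / (c1 * psil) * Q / (alpha * Num.sqrt K%:R)
      + c5 / (c1 * psil) * Num.sqrt d%:R * L0 / (alpha * Num.sqrt K%:R)
        * (psiu ^+ 2 * c2 * Q + c3).

Lemma run_average_bound alpha (alpha_gt0 : 0 < alpha) K (E : sgd_run R d) :
  (0 < K)%N ->
  sgd_setting E f L0 Q w1 c1 c2 c3 c4 c5 psil psiu alpha_gt0 K ->
  (c4 * c5 / (alpha * c1 * psil)) ^+ 2 <= K%:R ->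
  K%:R^-1 * \sum_(k < K) \int[prob E]_o l2norm (sgrad f alpha_gt0 k.+1 o) ^+ 2
  <= bound alpha_gt0 K.
Proof.
move=> K0 [Hl Hs Hi _ Hg Hst He Hga] HK.
have KR : 0 < K%:R :> R by rewrite ltr0n.
set r := Num.sqrt K%:R in Hi He Hga *.
have r0 : 0 < r by rewrite sqrtr_gt0.
have rr : r * r = K%:R by rewrite -expr2 sqr_sqrtr// ltW.
have eta0 : 0 < c5 / r by rewrite divr_gt0.
have cond : c4 * (c5 / r / alpha) <= c1 * psil.
  have c0 : 0 < alpha * c1 * psil by rewrite !mulr_gt0.
  have x0 : 0 <= c4 * c5 / (alpha * c1 * psil) by rewrite divr_ge0 ?mulr_ge0 ?ltW.
  have : c4 * c5 / (alpha * c1 * psil) <= r.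
    by rewrite -(@ler_pXn2r _ 2)// ?nnegrE ?(ltW r0)// [leRHS]expr2 rr.
  rewrite ler_pdivrMr// => H.
  have -> : c4 * (c5 / r / alpha) = c4 * c5 / (r * alpha) by field; rewrite !gt_eqF.
  rewrite ler_pdivrMr ?mulr_gt0//; apply: (le_trans H).
  by rewrite le_eqVlt; apply/orP; left; apply/eqP; ring.
have := average_grad_bound d_gt0 eta0 c1_gt0 c4_gt0 psil_gt0 Hl Hs Hi Hg Hst He Hga K0 cond.
move/le_trans; apply; rewrite /bound -/r le_eqVlt; apply/orP; left; apply/eqP.
by rewrite -rr; field; rewrite !gt_eqF.
Qed.

End Final.

Theorem corollary5p13 (R : realType) (d : nat) (f : 'rV[R]_d -> R)
    (L0 Q : R) (w1 : 'rV[R]_d) (c1 c2 c3 c4 c5 psil psiu : R)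
    (d_gt0 : (0 < d)%N) (c1_gt0 : 0 < c1) (c2_gt0 : 0 < c2) (c3_gt0 : 0 < c3)
    (c4_gt0 : 0 < c4) (c5_gt0 : 0 < c5) (psil_gt0 : 0 < psil)
    (psi_le : psil <= psiu) :
  (forall (alpha : R) (alpha_gt0 : 0 < alpha) (K : nat) (E : sgd_run R d),
    (0 < K)%N ->
    sgd_setting E f L0 Q w1 c1 c2 c3 c4 c5 psil psiu alpha_gt0 K ->
    (c4 * c5 / (alpha * c1 * psil)) ^+ 2 <= K%:R ->
    let kappa1 := 2 / (c1 * c5 * psil) in
    let kappa2 := c2 * c4 * c5 / (c1 * psil) in
    let kappa3 := c5 / (c1 * psil) in
    (\int[prob E]_o (dist 0%R (clarke_cube alpha f (output o)) ^+ 2) <=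
     (kappa1 * smoothing alpha_gt0 f w1 / Num.sqrt K%:R
      + kappa2 * Q / (alpha * Num.sqrt K%:R)
      + kappa3 * Num.sqrt d%:R * L0 / (alpha * Num.sqrt K%:R)
        * (psiu ^+ 2 * c2 * Q + c3))%R%:E)%E)
  /\
  (exists Kc : R -> R -> nat,
    (fun p : R * R => (Kc p.1 p.2)%:R : R) =O_ (filter_prod 0^'+ 0^'+)
      (fun p => p.1 ^- 2 * p.2 ^- 4 : R) /\
    forall (alpha nu : R) (alpha_gt0 : 0 < alpha), 0 < nu ->
      [/\ (0 < Kc alpha nu)%N,
          (c4 * c5 / (alpha * c1 * psil)) ^+ 2 <= (Kc alpha nu)%:R &
          forall E : sgd_run R d,
            sgd_setting E f L0 Q w1 c1 c2 c3 c4 c5 psil psiu alpha_gt0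
              (Kc alpha nu) ->
            (\int[prob E]_o dist 0%R (clarke_cube alpha f (output o))
             <= nu%:E)%E]).
Proof.
split=> [alpha alpha_gt0 K E K0 S HK /=|].
  have H := run_average_bound d_gt0 c1_gt0 c4_gt0 c5_gt0 psil_gt0 K0 S HK.
  have [Hl Hs Hi Ho Hg Hst He Hga] := S.
  by apply: (le_trans (output_dist_sq_le alpha_gt0 d_gt0 Hl Hs Hi K0 Ho)); rewrite lee_fin.
(* The bound is at most A alpha / sqrt K, by smoothing_le. The first square
   in X makes this at most nu^2, the second one is the threshold on K. *)
pose A (alpha : R) := 2 / (c1 * c5 * psil) * (`|f w1| + `|L0| * (Num.sqrt d%:R * alpha))
  + (`|c2 * c4 * c5 / (c1 * psil) * Q|
     + `|c5 / (c1 * psil) * Num.sqrt d%:R * L0 * (psiu ^+ 2 * c2 * Q + c3)|) / alpha.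
pose X (alpha nu : R) := (A alpha / nu ^+ 2) ^+ 2 + (c4 * c5 / (alpha * c1 * psil)) ^+ 2.
pose Kc (alpha nu : R) := (Num.truncn (X alpha nu)).+1.
exists Kc; split; last first.
  move=> alpha nu alpha_gt0 nu0.
  have XK : X alpha nu <= (Kc alpha nu)%:R by rewrite ltW//; exact: truncnS_gt.
  have KR : 0 < (Kc alpha nu)%:R :> R by rewrite ltr0n.
  split => //.
    by apply: le_trans XK; rewrite lerDr sqr_ge0.
  move=> E S.
  have HK : (c4 * c5 / (alpha * c1 * psil)) ^+ 2 <= (Kc alpha nu)%:R.
    by apply: le_trans XK; rewrite lerDr sqr_ge0.
  have H := run_average_bound d_gt0 c1_gt0 c4_gt0 c5_gt0 psil_gt0 (ltn0Sn _) S HK.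
  have [Hl Hs Hi Ho Hg Hst He Hga] := S.
  apply: (output_dist_le d_gt0 Hl Hs Hi (ltn0Sn _) Ho nu0).
  apply: (le_trans H).
  set r := Num.sqrt (Kc alpha nu)%:R.
  have r0 : 0 < r by rewrite sqrtr_gt0.
  have fle : smoothing alpha_gt0 f w1 <= `|f w1| + `|L0| * (Num.sqrt d%:R * alpha).
    have L0_ge0 := loss_lipschitz_ge0 Hl d_gt0.
    apply: (le_trans (smoothing_le L0_ge0 (loss_lipschitz Hl) alpha_gt0 w1)).
    by rewrite (ger0_norm L0_ge0) lerD2r ler_norm.
  have Ar : A alpha / nu ^+ 2 <= r.
    apply: (@le_trans _ _ `|A alpha / nu ^+ 2|); first exact: ler_norm.
    rewrite -sqrtr_sqr; apply: ler_wsqrtr; apply: le_trans XK.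
    by rewrite lerDl sqr_ge0.
  apply: (@le_trans _ _ (A alpha / r)); last first.
    by rewrite ler_pdivrMr// mulrC -ler_pdivrMr// exprn_gt0.
  set B2 := c2 * c4 * c5 / (c1 * psil) * Q.
  set B3 := c5 / (c1 * psil) * Num.sqrt d%:R * L0 * (psiu ^+ 2 * c2 * Q + c3).
  have -> : 2 / (c1 * c5 * psil) * smoothing alpha_gt0 f w1 / r + B2 / (alpha * r)
    + c5 / (c1 * psil) * Num.sqrt d%:R * L0 / (alpha * r) * (psiu ^+ 2 * c2 * Q + c3)
    = (2 / (c1 * c5 * psil) * smoothing alpha_gt0 f w1 + (B2 + B3) / alpha) / r.
    by rewrite /B3; field; rewrite !gt_eqF.
  rewrite ler_pM2r ?invr_gt0// /A -/B2 -/B3; apply: lerD.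
    by apply: ler_wpM2l => //; rewrite divr_ge0// !mulr_ge0// ltW.
  by rewrite ler_pM2r ?invr_gt0// lerD// ler_norm.
pose A1 := 2 / (c1 * c5 * psil) * (`|f w1| + `|L0| * Num.sqrt d%:R)
  + (`|c2 * c4 * c5 / (c1 * psil) * Q|
     + `|c5 / (c1 * psil) * Num.sqrt d%:R * L0 * (psiu ^+ 2 * c2 * Q + c3)|).
pose D := c4 * c5 / (c1 * psil).
apply/eqO_exP; exists (A1 ^+ 2 + D ^+ 2 + 1).
  by rewrite ltr_wpDl// addr_ge0// sqr_ge0.
(* For alpha and nu at most 1, A alpha is at most A1 / alpha, and the
   rounding in Kc is absorbed by the last 1 of the constant. *)
pose S := [set x : R | 0 < x <= 1].
have SF : 0^'+ S.
  near=> x; rewrite /S/=; apply/andP; split; near: x.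
    exact: nbhs_right_gt.
  by apply: nbhs_right_le.
exists (S, S) => //= -[alpha nu] /= [/andP[a0 a1] /andP[n0 n1]].
set a := alpha^-1; set b := nu^-1.
have a1' : 1 <= a by rewrite invf_ge1.
have b1' : 1 <= b by rewrite invf_ge1.
have ab1 : 1 <= a ^+ 2 * b ^+ 4.
  by apply: mulr_ege1; exact: exprn_ege1.
rewrite -!exprVn -/a -/b ger0_norm// ger0_norm; last by rewrite mulr_ge0// exprn_ge0// (le_trans ler01).
have X0 : 0 <= X alpha nu by rewrite addr_ge0// sqr_ge0.
have cc : 0 <= 2 / (c1 * c5 * psil) by rewrite divr_ge0// !mulr_ge0// ltW.
have A0 : 0 <= A alpha.
  apply: addr_ge0; last by rewrite divr_ge0 ?(ltW a0)// addr_ge0.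
  apply: mulr_ge0 => //; apply: addr_ge0 => //.
  by rewrite !mulr_ge0 ?sqrtr_ge0// ltW.
have AE : A alpha <= A1 * a.
  rewrite /A /A1 -/a [leRHS]mulrDl lerD2r -[leRHS]mulrA; apply: ler_wpM2l => //.
  rewrite mulrDl; apply: lerD; first exact: ler_peMr.
  rewrite -mulrA; apply: ler_wpM2l => //; apply: ler_wpM2l; first exact: sqrtr_ge0.
  exact: le_trans a1 a1'.
have K1 : (Kc alpha nu)%:R <= X alpha nu + 1.
  by rewrite -natr1 lerD2r truncn_le.
apply: (le_trans K1).
rewrite !mulrDl mul1r; apply: lerD => //; rewrite /X; apply: lerD.
  have -> : A1 ^+ 2 * (a ^+ 2 * b ^+ 4) = (A1 * a * b ^+ 2) ^+ 2 by ring.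
  have -> : A alpha / nu ^+ 2 = A alpha * b ^+ 2 by rewrite -exprVn.
  have b0 : 0 <= b ^+ 2 by rewrite sqr_ge0.
  have AEb : A alpha * b ^+ 2 <= A1 * a * b ^+ 2 by rewrite ler_wpM2r.
  have Ab0 : 0 <= A alpha * b ^+ 2 by rewrite mulr_ge0.
  by rewrite ler_pXn2r// nnegrE// (le_trans Ab0).
have -> : c4 * c5 / (alpha * c1 * psil) = D * a.
  by rewrite /D /a; field; rewrite !gt_eqF.
rewrite exprMn; apply: ler_wpM2l; first exact: sqr_ge0.
by apply: ler_peMr; [exact: sqr_ge0|exact: exprn_ege1].
Unshelve. all: by end_near. Qed.
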